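(* Let $f\in C(\Omega)\cap L^\infty(\Omega)$ and $g\in C(\partial\Omega)$. For each $\varepsilon>0$ there exist solutions $\underline u_\varepsilon,\bar u_\varepsilon\in C(\bar\Omega)$ of $$-\Delta^\varepsilon_\infty u=f \ \text{ in } \Omega,\qquad u=g\ \text{ on }\partial\Omega,$$ with the following properties. If $w:\bar\Omega\to\mathbb{R}$ is any bounded function satisfying $-\Delta^\varepsilon_\infty w\le f$ in $\Omega$ and $w\le g$ on $\partial\Omega$, then $w\le\bar u_\varepsilon$ on $\bar\Omega$. If $w:\bar\Omega\to\mathbb{R}$ is any bounded function satisfying $-\Delta^\varepsilon_\infty w\ge f$ in $\Omega$ and $w\ge g$ on $\partial\Omega$, then $w\ge\underline u_\varepsilon$ on $\bar\Omega$. Moreover, $\underline u_\varepsilon$ is the value function for Player I, and $\bar u_\varepsilon$ is the value function for Player II, for boundary-biased $\varepsilon$-step tug-of-war with running payoff function $f$ and terminal payoff function $g$.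
   Context: $\Omega\subseteq\mathbb{R}^n$ is a bounded, connected, open set. For $x,y\in\bar\Omega$, $d(x,y)$ is the path distance: the infimum of the lengths of Lipschitz paths $\gamma:[0,1]\to\bar\Omega$ with $\gamma(0)=x$, $\gamma(1)=y$. It is assumed that $\operatorname{diam}(\Omega):=\sup\{d(x,y):x,y\in\bar\Omega\}<\infty$. Write $\bar\Omega(x,r):=\{y\in\bar\Omega: d(x,y)\le r\}$. For $\varepsilon>0$ set $\rho_\varepsilon(x,y):=\max\{d(x,y),\varepsilon\}$ if $x,y\in\Omega$, and $\rho_\varepsilon(x,y):=d(x,y)$ if $x\in\partial\Omega$ or $y\in\partial\Omega$. For $u:\bar\Omega\to\mathbb{R}$ and $x\in\Omega$, $$S^+_\varepsilon u(x):=\sup_{y\in\bar\Omega(x,\varepsilon)}\frac{u(y)-u(x)}{\rho_\varepsilon(x,y)},\quad S^-_\varepsilon u(x):=\sup_{y\in\bar\Omega(x,\varepsilon)}\frac{u(x)-u(y)}{\rho_\varepsilon(x,y)},\quad \Delta^\varepsilon_\infty u(x):=\frac1\varepsilon\big(S^+_\varepsilon u(x)-S^-_\varepsilon u(x)\big).$$ Equations and inequalities involving $\Delta^\varepsilon_\infty$ are understood pointwise. Boundary-biased $\varepsilon$-step tug-of-war: a token starts at $x_0\in\Omega$. At stage $k\ge1$, Players I and II select points $x^I_k,x^{II}_k\in\bar\Omega(x_{k-1},\varepsilon)$. The token moves to $x_k$, chosen randomly, with $x_k=x^I_k$ with probability $$P=\frac{\rho_\varepsilon(x_{k-1},x^{II}_k)}{\rho_\varepsilon(x_{k-1},x^{I}_k)+\rho_\varepsilon(x_{k-1},x^{II}_k)}$$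 and $x_k=x^{II}_k$ with probability $1-P$. If $x_k\in\Omega$ the game continues to stage $k+1$; if $x_k\in\partial\Omega$ the game ends and Player II pays Player I the amount $$\mathrm{Payoff}=g(x_k)+\frac{\varepsilon}{2}\sum_{j=1}^k\rho_\varepsilon(x_{j-1},x_j)f(x_{j-1}).$$ A strategy for a player is a mapping from the set of all partially played games $(x_0,\dots,x_{k-1})$ to moves in $\bar\Omega(x_{k-1},\varepsilon)$. Given strategies $\sigma_I,\sigma_{II}$, let $F_I(\sigma_I,\sigma_{II})$ and $F_{II}(\sigma_I,\sigma_{II})$ both denote the expected payoff if the game terminates with probability one and this expectation is defined in $[-\infty,\infty]$; otherwise set $F_I=-\infty$ and $F_{II}=+\infty$. The value for Player I at $x_0\in\Omega$ is $\sup_{\sigma_I}\inf_{\sigma_{II}}F_I(\sigma_I,\sigma_{II})$ and the value for Player II is $\inf_{\sigma_{II}}\sup_{\sigma_I}F_{II}(\sigma_I,\sigma_{II})$, as functions of the starting point $x_0$; both value functions are extended to $\partial\Omega$ by $g$. *)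

(* Defs.v *)
From mathcomp Require Import all_boot all_order all_algebra.
From mathcomp Require Import all_classical all_reals all_analysis.

Set Implicit Arguments.
Unset Strict Implicit.
Unset Printing Implicit Defensive.

Import Order.TTheory GRing.Theory Num.Theory.
Import numFieldNormedType.Exports.

Local Open Scope classical_set_scope.
Local Open Scope ring_scope.

(* Functions on Omega, its boundary or its closure are represented by total
   functions on 'rV[R]_n; their values off the relevant set are never used. *)

Section PathDistance.
Variables (R : realType) (n : nat) (Omega : set 'rV[R]_n).
Implicit Types (x y : 'rV[R]_n) (eps r : R).

(* The library norm on 'rV[R]_n is the sup norm: it gives the usual topology,
   bounded sets and Lipschitz maps, but lengths need the Euclidean norm. *)
Definition euclidean_dist x y : R := Num.sqrt (\sum_(i < n) (x 0 i - y 0 i) ^+ 2).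

Definition polygonal_length (gamma : R -> 'rV[R]_n) (s : seq R) : R :=
  let F := gamma \o nth 1 (0 :: s) in
  \sum_(0 <= k < size s) euclidean_dist (F k) (F k.+1).

Definition path_length (gamma : R -> 'rV[R]_n) : \bar R :=
  ereal_sup [set (polygonal_length gamma s)%:E | s in itv_partition 0 1].

Definition lipschitz_path x y : set (R -> 'rV[R]_n) :=
  [set gamma | [/\ [lipschitz (gamma : R^o -> 'rV[R]_n) t | t in (`[0, 1] : set R^o)],
                   forall t, t \in `[0, 1] -> closure Omega (gamma t),
                   gamma 0 = x & gamma 1 = y]].

(* +oo when x and y are not joined by any Lipschitz path. *)
Definition path_edist x y : \bar R :=
  ereal_inf [set path_length gamma | gamma in lipschitz_path x y].

Definition path_diam : \bar R :=
  ereal_sup [set path_edist z.1 z.2 | z in closure Omega `*` closure Omega].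

(* Meaningful on the closure of Omega when path_diam < +oo: path_edist is then
   finite there. *)
Definition path_dist x y : R := fine (path_edist x y).

Definition path_ball x r : set 'rV[R]_n :=
  [set y | closure Omega y /\ path_dist x y <= r].

Definition boundary : set 'rV[R]_n := closure Omega `\` interior Omega.

Definition rho eps x y : R :=
  if `[< Omega x /\ Omega y >] then Num.max (path_dist x y) eps
  else path_dist x y.

(* The real supremum is 0 on sets that are not bounded above; for u bounded on
   the closure of Omega and x in Omega, the sets below are nonempty and bounded,
   since rho eps x is bounded away from 0. *)
Definition Splus eps (u : 'rV[R]_n -> R) x : R :=
  sup [set (u y - u x) / rho eps x y | y in path_ball x eps].

Definition Sminus eps (u : 'rV[R]_n -> R) x : R :=
  sup [set (u x - u y) / rho eps x y | y in path_ball x eps].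

Definition inf_laplacian eps (u : 'rV[R]_n -> R) x : R :=
  eps^-1 * (Splus eps u x - Sminus eps u x).

End PathDistance.

Section TugOfWar.
Variables (R : realType) (n : nat) (Omega : set 'rV[R]_n).
Variables (eps : R) (f g : 'rV[R]_n -> R).
Implicit Types (x : 'rV[R]_n) (s : seq 'rV[R]_n) (w : seq bool).

(* A partially played game (x_0, x_1, ..., x_(k-1)) is given by x0 and
   s = [:: x_1; ...; x_(k-1)]; the current position is last x0 s. *)
Definition partial_game x0 s : Prop :=
  Omega x0 /\
  path (fun x y => `[< Omega y /\ path_ball Omega x eps y >]) x0 s.

Definition strategy : set ('rV[R]_n -> seq 'rV[R]_n -> 'rV[R]_n) :=
  [set sigma | forall x0 s, partial_game x0 s ->
     path_ball Omega (last x0 s) eps (sigma x0 s)].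

Section Play.
Variables sI sII : 'rV[R]_n -> seq 'rV[R]_n -> 'rV[R]_n.

Definition prob_I x0 s : R :=
  let dI := rho Omega eps (last x0 s) (sI x0 s) in
  let dII := rho Omega eps (last x0 s) (sII x0 s) in
  dII / (dI + dII).

(* Once both strategies are fixed, a play is determined by the sequence w of
   random outcomes (true: the token moves to the point selected by Player I,
   false: to that of Player II). play x0 s w extends s by the positions visited
   along w, and play_prob x0 s w is the probability of w from (x0, s). *)
Fixpoint play x0 s w : seq 'rV[R]_n :=
  if w is b :: w' then
    play x0 (rcons s (if b then sI x0 s else sII x0 s)) w'
  else s.

Fixpoint play_prob x0 s w : R :=
  if w is b :: w' then
    (if b then prob_I x0 s else 1 - prob_I x0 s) *
    play_prob x0 (rcons s (if b then sI x0 s else sII x0 s)) w'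
  else 1.

(* The outcomes w after which the game has just ended: x_0, ..., x_(k-1) lie in
   Omega and x_k on the boundary, where k = size w. These events are disjoint
   and form a countable family, so the terminated game is a discrete random
   variable and its expectation is a countable sum. *)
Definition terminal x0 : set (seq bool) :=
  [set w | let xs := x0 :: play x0 [::] w in
     (forall j, (j < size w)%N -> Omega (nth x0 xs j)) /\
     boundary Omega (nth x0 xs (size w))].

Definition payoff x0 w : R :=
  let xs := x0 :: play x0 [::] w in
  g (nth x0 xs (size w)) +
  eps / 2 * \sum_(1 <= j < (size w).+1)
    rho Omega eps (nth x0 xs j.-1) (nth x0 xs j) * f (nth x0 xs j.-1).

Local Open Scope ereal_scope.

Definition terminates_as x0 : Prop :=
  \esum_(w in terminal x0) (play_prob x0 [::] w)%:E = 1.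

Definition weighted_payoff x0 w : \bar R :=
  (play_prob x0 [::] w * payoff x0 w)%:E.

Definition mean_pos x0 : \bar R :=
  \esum_(w in terminal x0) (weighted_payoff x0)^\+ w.

Definition mean_neg x0 : \bar R :=
  \esum_(w in terminal x0) (weighted_payoff x0)^\- w.

Definition payoff_mean_defined x0 : Prop :=
  terminates_as x0 /\ ~ (mean_pos x0 = +oo /\ mean_neg x0 = +oo).

Definition F_I x0 : \bar R :=
  if `[< payoff_mean_defined x0 >] then mean_pos x0 - mean_neg x0 else -oo.

Definition F_II x0 : \bar R :=
  if `[< payoff_mean_defined x0 >] then mean_pos x0 - mean_neg x0 else +oo.

End Play.

Definition value_I x : \bar R :=
  if `[< Omega x >] then
    ereal_sup [set ereal_inf [set F_I sI sII x | sII in strategy]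
              | sI in strategy]
  else (g x)%:E.

Definition value_II x : \bar R :=
  if `[< Omega x >] then
    ereal_inf [set ereal_sup [set F_II sI sII x | sI in strategy]
              | sII in strategy]
  else (g x)%:E.

End TugOfWar.

(* Main.v *)
(* The upper solution u is the Perron envelope, i.e. the supremum of all bounded
   subsolutions. It is a solution by bumping at one point; a barrier (a concave
   parabola in the distance to the complement) and a strict comparison principle
   bound it. Half-relaxed limits of subsolutions are subsolutions, because
   closed balls of the path distance are compact: curves of bounded length,
   parametrized with unit speed, have ultralimits. Applied to the envelopes of
   f + gamma as gamma decreases to 0, this shows that u is upper semicontinuous
   and is the limit of supersolutions with strictly larger right-hand side;
   upper semicontinuity and the equation then give continuity.

   For the game, a bounded supersolution u of f + gamma makes
   u(x_k) + (eps / 2) * sum rho (f + gamma) a supermartingale when Player II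
   always moves nearly optimally for u. Player II plays so for K rounds and then
   follows a barrier which ends the game in bounded expected time. If gamma > 0,
   the gain pays for the switch once K is large; if gamma = 0, the switch costs
   little because Player II loses only if the unswitched game terminates, and
   then it rarely lasts K rounds. The first case bounds the value of Player II
   from above; the second one bounds that of Player I from above and, exchanging
   the players, that of Player II from below. The lower solution is minus the
   upper one for - f and - g. *)
Require Import Defs.
From mathcomp Require Import all_boot all_order all_algebra.
From mathcomp Require Import all_classical all_reals all_analysis.
From mathcomp Require Import zify ring lra.
Set Implicit Arguments.
Unset Strict Implicit.
Unset Printing Implicit Defensive.
Import Order.TTheory GRing.Theory Num.Theory.
Import numFieldNormedType.Exports.
Local Open Scope classical_set_scope.
Local Open Scope ring_scope.

(** * Euclidean distance *)

Section EuclideanDistance.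
Variables (R : realType) (n : nat).
Implicit Types (x y z : 'rV[R]_n) (s t : R).

(** The probabilities of the game fit the operator. If the two moves have [rho] values [r] and [s],
    then against a steepest descending reply the mean of [u] rises by at most [r * s / (r + s)]
    times [Splus - Sminus], while the mean running payoff of the round is
    [eps * f * r * s / (r + s)]; this is the origin of the factor [eps / 2]. Comparison is available
    only with a strict gap between the right-hand sides, because the supremum of a difference of
    bounded functions need not be attained; hence the perturbations of [f]. In the game the order of
    quantifiers decides: Player II fixes a strategy before seeing that of Player I, so the switch
    has to be paid by the gap; in the value of Player I the reply, and with it the round of the
    switch, may depend on the opponent. The path distance is used only through its lower
    semicontinuity for the Euclidean topology, and [rho] drops at the boundary; but lower
    semicontinuity is exactly what a limit of ascending targets requires. *)

Lemma eucl_ge0 x y : 0 <= euclidean_dist x y.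
Proof. exact: sqrtr_ge0. Qed.

Lemma euclC x y : euclidean_dist x y = euclidean_dist y x.
Proof.
rewrite /euclidean_dist; congr Num.sqrt; apply: eq_bigr => i _.
by rewrite -sqrrN opprB.
Qed.

Lemma sqr_eucl x y : euclidean_dist x y ^+ 2 = \sum_(i < n) (x 0 i - y 0 i) ^+ 2.
Proof. by rewrite sqr_sqrtr// sumr_ge0// => i _; exact: sqr_ge0. Qed.

(** Cauchy-Schwarz comes from expanding the sum of the squares [(B * a i - A * b i) ^+ 2], which is
    a multiple of [2 * (A * B)]; the cases [A = 0] and [B = 0] are treated apart because this factor
    is divided out. *)
Lemma eucl_triangle y x z :
  euclidean_dist x z <= euclidean_dist x y + euclidean_dist y z.
Proof.
set A := euclidean_dist x y; set B := euclidean_dist y z.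
pose a i := x 0 i - y 0 i; pose b i := y 0 i - z 0 i.
have A0 : 0 <= A by exact: eucl_ge0.
have B0 : 0 <= B by exact: eucl_ge0.
have A2 : \sum_i a i ^+ 2 = A ^+ 2 by rewrite sqr_eucl.
have B2 : \sum_i b i ^+ 2 = B ^+ 2 by rewrite sqr_eucl.
have null c d : \sum_i c i ^+ 2 = 0 -> \sum_(i < n) c i * d i = 0 :> R.
  move=> /eqP; rewrite psumr_eq0; last by move=> i _; exact: sqr_ge0.
  move=> /allP c0; rewrite big1// => i _.
  have := c0 i; rewrite mem_index_enum => /(_ isT) /=.
  by rewrite sqrf_eq0 => /eqP ->; rewrite mul0r.
have cs : \sum_i a i * b i <= A * B.
  have [A00|An0] := eqVneq A 0.
    by rewrite null ?A2 ?A00 ?expr0n// mul0r.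
  have [B00|Bn0] := eqVneq B 0.
    under eq_bigr do rewrite mulrC.
    by rewrite null ?B2 ?B00 ?expr0n// mulr0.
  have AB0 : 0 < 2 * (A * B) by rewrite !mulr_gt0// lt0r ?An0 ?Bn0.
  rewrite -subr_ge0 -(pmulr_rge0 _ AB0).
  have : 0 <= \sum_i (B * a i - A * b i) ^+ 2.
    by apply: sumr_ge0 => i _; exact: sqr_ge0.
  suff -> : \sum_i (B * a i - A * b i) ^+ 2 =
      2 * (A * B) * (A * B - \sum_i a i * b i) by [].
  transitivity (B ^+ 2 * \sum_i a i ^+ 2 - 2 * (A * B) * (\sum_i a i * b i)
      + A ^+ 2 * \sum_i b i ^+ 2); last by rewrite A2 B2; ring.
  rewrite !mulr_sumr -sumrB -big_split/=; apply: eq_bigr => i _; ring.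
rewrite -(ler_pXn2r (ltn0Sn 1)) ?nnegrE ?addr_ge0 ?eucl_ge0//.
rewrite sqr_eucl.
have -> : \sum_(i < n) (x 0 i - z 0 i) ^+ 2 =
   \sum_i a i ^+ 2 + 2 * (\sum_i a i * b i) + \sum_i b i ^+ 2.
  rewrite mulr_sumr -!big_split/=; apply: eq_bigr => i _; rewrite /a /b; ring.
by rewrite A2 B2; lra.
Qed.

Lemma norm_le_eucl x y : `|x - y| <= euclidean_dist x y.
Proof.
rewrite {1}/Num.norm/= mx_normrE; apply: bigmax_le; first exact: eucl_ge0.
move=> [i j] _ /=; rewrite !mxE (ord1 i).
rewrite -(ler_pXn2r (ltn0Sn 1)) ?nnegrE ?eucl_ge0//.
rewrite sqr_eucl (bigD1 j)//= real_normK ?num_real// lerDl.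
by apply: sumr_ge0 => k _; exact: sqr_ge0.
Qed.

Lemma eucl_le_norm x y : euclidean_dist x y <= n%:R * `|x - y|.
Proof.
rewrite -(ler_pXn2r (ltn0Sn 1)) ?nnegrE ?eucl_ge0 ?mulr_ge0//.
rewrite sqr_eucl.
have le1 i : (x 0 i - y 0 i) ^+ 2 <= `|x - y| ^+ 2.
  rewrite -[leLHS]real_normK ?num_real// ler_pXn2r ?nnegrE//.
  rewrite [leRHS]/Num.norm/= mx_normrE.
  have := @le_bigmax _ _ _ (0 : R) (fun ij : 'I_1 * 'I_n => `|(x - y) ij.1 ij.2|) (0, i).
  by rewrite /= !mxE.
apply: (@le_trans _ _ (\sum_(i < n) `|x - y| ^+ 2)); first exact: ler_sum.
rewrite sumr_const card_ord -[leLHS]mulr_natl exprMn ler_wpM2r ?sqr_ge0//.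
by rewrite -natrX ler_nat; case: (n) => // m; rewrite leq_pmulr.
Qed.

Lemma eucl_line x y s t :
  euclidean_dist (x + s *: (y - x)) (x + t *: (y - x))
  = `|s - t| * euclidean_dist x y.
Proof.
rewrite /euclidean_dist -sqrtr_sqr -sqrtrM ?sqr_ge0//; congr Num.sqrt.
rewrite mulr_sumr; apply: eq_bigr => i _; rewrite !mxE; ring.
Qed.

Lemma euclxx x : euclidean_dist x x = 0.
Proof.
by rewrite /euclidean_dist big1 ?sqrtr0// => i _; rewrite subrr expr0n.
Qed.

Lemma eucl_eq0 x y : euclidean_dist x y = 0 -> x = y.
Proof.
move=> xy; apply/eqP; rewrite -subr_eq0 -normr_le0.
by apply: le_trans (norm_le_eucl x y) _; rewrite xy.
Qed.

Lemma nbhs_euclP x (A : set 'rV[R]_n) :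
  nbhs x A <-> exists2 r, 0 < r & forall y, euclidean_dist x y < r -> A y.
Proof.
split.
  move=> /nbhs_ballP[r /= r0 xrA]; exists r => // y xy; apply: xrA.
  by rewrite mx_norm_ball /ball_/=; apply: le_lt_trans xy; exact: norm_le_eucl.
(* [n.+1] rather than [n] keeps the radius positive when [n = 0]. *)
move=> [r r0 rA]; apply/nbhs_ballP; exists (r / n.+1%:R) => /=.
  by rewrite divr_gt0.
move=> y; rewrite mx_norm_ball /ball_/= ltr_pdivlMr// => xy; apply: rA.
apply: le_lt_trans xy; apply: (le_trans (eucl_le_norm _ _)).
by rewrite mulrC ler_wpM2l// ler_nat.
Qed.

Lemma closure_euclP x (A : set 'rV[R]_n) :
  closure A x <-> forall r, 0 < r -> exists2 y, A y & euclidean_dist x y < r.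
Proof.
split.
  move=> clA r r0; have [|y [Ay xy]] := clA [set y | euclidean_dist x y < r].
    by apply/nbhs_euclP; exists r.
  by exists y.
by move=> H B /nbhs_euclP[r r0 rB]; have [y Ay /rB By] := H r r0; exists y.
Qed.

Lemma within_continuous_euclP (A : set 'rV[R]_n) (u : 'rV[R]_n -> R) :
  {within A, continuous u} <->
  forall x, A x -> forall e, 0 < e -> exists2 r, 0 < r &
    forall y, A y -> euclidean_dist x y < r -> `|u x - u y| < e.
Proof.
split=> [/subspace_continuousP cu x Ax e e0|H].
  have /cvgrPdist_lt/(_ e e0) := cu x Ax.
  rewrite near_withinE => /nbhs_euclP[r r0 rH].
  by exists r => // y Ay xy; exact: rH.
apply/subspace_continuousP => x Ax; apply/cvgrPdist_lt => e e0.
have [r r0 rH] := H x Ax e e0.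
rewrite near_withinE; apply/nbhs_euclP; exists r => // y xy Ay; exact: rH.
Qed.

(* Ultralimits replace the extraction of convergent subsequences. *)
Lemma bounded_ultralimit (F : set_system nat) (v : nat -> 'rV[R]_n) (M : R) :
  UltraFilter F -> (forall k, `|v k| <= M) ->
  exists z, forall r, 0 < r -> F [set k | euclidean_dist z (v k) < r].
Proof.
move=> FU vM.
have cpt : compact [set y : 'rV[R]_n | `|y| <= M].
  apply: bounded_closed_compact.
    by exists M; split; [exact: num_real|move=> N MN y /= yM; exact: le_trans yM (ltW MN)].
  apply: (@closed_comp _ _ (fun y : 'rV[R]_n => `|y|) [set t | t <= M]).
    by move=> y _; exact: norm_continuous.
  exact: closed_le.
have vF : (v @ F) [set y : 'rV[R]_n | `|y| <= M].
  by apply: (@filterS _ F _ setT) => [k _|]; [exact: vM|exact: filterT].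
have [z [_ clz]] := cpt (v @ F) _ vF.
exists z => r r0; pose A := [set k | euclidean_dist z (v k) < r].
have [//|FnA] := in_ultra_setVsetC A FU.
have [] := clz [set y | r <= euclidean_dist z y] [set y | euclidean_dist z y < r].
- suff : F [set k | r <= euclidean_dist z (v k)] by [].
  by apply: filterS FnA => k; rewrite /A/= leNgt => /negP.
- by apply: (proj2 (nbhs_euclP z _)); exists r.
- by move=> y [/=]; rewrite leNgt => /negP.
Qed.

Lemma cofinite_ultrafilter :
  exists2 F : set_system nat, UltraFilter F & forall N, F [set k | (N <= k)%N].
Proof.
have [F [FU FN]] := @ultraFilterLemma nat \oo _.
by exists F => // N; apply: FN; exists N.
Qed.

Lemma bounded_cluster (v : nat -> 'rV[R]_n) (M : R) :
  (forall k, `|v k| <= M) ->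
  exists z, forall r N, 0 < r -> exists2 k, (N <= k)%N & euclidean_dist z (v k) < r.
Proof.
move=> vM; have [F FU FN] := cofinite_ultrafilter.
have [z zF] := bounded_ultralimit FU vM.
exists z => r N r0; have FP := @ultra_proper _ _ FU.
by have [k [/= Nk zk]] := filter_ex (filterI (FN N) (zF r r0)); exists k.
Qed.

End EuclideanDistance.

(** * Arc length and unit-speed curves *)

Lemma le_of_small (R : realType) (a b c : R) : 0 <= c ->
  (forall e, 0 < e -> e < 1 -> a <= b + e * c) -> a <= b.
Proof.
move=> c0 H; apply/ler_addgt0Pr => e e0.
pose e' := Num.min (2^-1) (e / (c + 1)).
have c1 : 0 < c + 1 by rewrite ltr_wpDl.
have e'0 : 0 < e' by rewrite lt_min divr_gt0// andbT.
have e'1 : e' < 1.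
  by rewrite gt_min; apply/orP; left; lra.
apply: le_trans (H _ e'0 e'1) _; rewrite lerD2l.
apply: (@le_trans _ _ (e' * (c + 1))).
  by apply: ler_wpM2l; [exact: ltW|rewrite lerDl].
by rewrite -ler_pdivlMr// ge_min lexx orbT.
Qed.

Lemma clamp_lipschitz (R : realType) (L s t : R) : 0 <= L ->
  `|Num.max 0 (Num.min s L) - Num.max 0 (Num.min t L)| <= `|s - t|.
Proof.
move=> L0; wlog st : s t / s <= t.
  by move=> H; have [/H|/ltW/H] := leP s t; [|rewrite distrC (distrC s)]; exact.
rewrite distrC (distrC s) (@ger0_norm _ (t - s)) ?subr_ge0// ler_norml.
by case: (leP s L) => ?; case: (leP t L) => ?; rewrite ?(max_idPr L0);
  case: (leP 0 s) => ?; case: (leP 0 t) => ?; lra.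
Qed.

Section PolygonalLength.
Variables (R : realType) (n : nat).
Implicit Types (gamma : R -> 'rV[R]_n) (a b : R) (s : seq R).

(** Recursive form of [polygonal_length] with a free starting parameter, which allows induction on
    the partition. *)
Fixpoint chain_length gamma a s : R :=
  if s is b :: s' then euclidean_dist (gamma a) (gamma b) + chain_length gamma b s'
  else 0.

Lemma polygonal_lengthE gamma s : polygonal_length gamma s = chain_length gamma 0 s.
Proof.
suff gen a : \sum_(0 <= k < size s) euclidean_dist (gamma (nth 1 (a :: s) k))
    (gamma (nth 1 (a :: s) k.+1)) = chain_length gamma a s by exact: gen.
elim: s a => [|b s IH] a /=; first by rewrite big_geq.
by rewrite big_nat_recl//= -IH.
Qed.

Lemma chain_length_rcons gamma a s b :
  chain_length gamma a (rcons s b) =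
  chain_length gamma a s + euclidean_dist (gamma (last a s)) (gamma b).
Proof.
by elim: s a => [|c s IH] a /=; rewrite ?addr0 ?add0r// IH addrA.
Qed.

Lemma chain_length_ge0 gamma a s : 0 <= chain_length gamma a s.
Proof. by elim: s a => //= b s IH a; rewrite addr_ge0// eucl_ge0. Qed.

Lemma path_lt_last a s : path <%R a s -> a <= last a s.
Proof.
elim: s a => //= b s IH a /andP[ab /IH]; apply: le_trans; exact: ltW.
Qed.

Lemma chain_length_lipschitz gamma a s (C B : R) :
  (forall u v, a <= u -> u <= v -> v <= B ->
     euclidean_dist (gamma u) (gamma v) <= C * (v - u)) ->
  path <%R a s -> last a s <= B -> chain_length gamma a s <= C * (last a s - a).
Proof.
elim: s a => [|b s IH] a /= lip; first by rewrite subrr mulr0.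
move=> /andP[ab bs] lB; have bl := path_lt_last bs.
have lipb u v : b <= u -> u <= v -> v <= B ->
    euclidean_dist (gamma u) (gamma v) <= C * (v - u).
  by move=> bu uv vB; apply: lip => //; exact: le_trans (ltW ab) bu.
have := IH b lipb bs lB.
have := lip a b (lexx _) (ltW ab) (le_trans bl lB).
by lra.
Qed.

End PolygonalLength.

Section ArcLength.
Variables (R : realType) (n : nat) (gamma : R -> 'rV[R]_n) (C L : R).
Hypothesis C_ge0 : 0 <= C.
Hypothesis gamma_lip : forall s t, 0 <= s -> s <= t -> t <= 1 ->
  euclidean_dist (gamma s) (gamma t) <= C * (t - s).
Hypothesis gamma_len : forall s, path <%R 0 s -> last 0 s = 1 ->
  chain_length gamma 0 s <= L.

(** Partitions may stop before [t]: this makes the arc length function [ell] visibly monotone and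
    admits the empty partition. *)
Let lengths t := [set chain_length gamma 0 s | s in
   [set s | path <%R 0 s /\ last 0 s <= t]].
Let ell t := sup (lengths t).

Let lengths_le t x : t <= 1 -> lengths t x -> x <= L.
Proof.
move=> t1 [s [ps ls] <-].
have := le_trans ls t1; rewrite le_eqVlt => /orP[/eqP ls1|ls1].
  exact: gamma_len.
have := @gamma_len (rcons s 1).
rewrite rcons_path ps/= last_rcons chain_length_rcons => /(_ ls1 erefl).
by apply: le_trans; rewrite lerDl eucl_ge0.
Qed.

Let lengths0 t : 0 <= t -> lengths t 0.
Proof. by move=> t0; exists [::]. Qed.

Let lengths_sup t : 0 <= t -> t <= 1 -> has_sup (lengths t).
Proof.
by move=> t0 t1; split; [exists 0; exact: lengths0|exists L => x; exact: lengths_le].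
Qed.

Let ell_ge s t : 0 <= t -> t <= 1 -> path <%R 0 s -> last 0 s <= t ->
  chain_length gamma 0 s <= ell t.
Proof.
move=> t0 t1 ps ls; apply: sup_upper_bound; first exact: lengths_sup.
by exists s.
Qed.

Let ell_superadd s t : 0 <= s -> s <= t -> t <= 1 ->
  ell s + euclidean_dist (gamma s) (gamma t) <= ell t.
Proof.
move=> s0 st t1.
have t0 := le_trans s0 st; have s1 := le_trans st t1.
rewrite -lerBrDr; apply: ge_sup; first by exists 0; exact: lengths0.
move=> _ [p [pp lp] <-]; rewrite lerBrDr.
have [q [pq lq chq]] : exists q, [/\ path <%R 0 q, last 0 q = s &
    chain_length gamma 0 p <= chain_length gamma 0 q].
  move: lp; rewrite le_eqVlt => /orP[/eqP lp|lp]; first by exists p.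
  exists (rcons p s); rewrite rcons_path pp lp last_rcons chain_length_rcons.
  by split => //; rewrite lerDl eucl_ge0.
apply: (@le_trans _ _ (chain_length gamma 0 q + euclidean_dist (gamma s) (gamma t))).
  by rewrite lerD2r.
move: st; rewrite le_eqVlt => /orP[/eqP st|st].
  by rewrite -st euclxx addr0; apply: ell_ge => //; rewrite lq.
have := @ell_ge (rcons q t) t t0 t1.
by rewrite rcons_path pq last_rcons chain_length_rcons lq st; exact.
Qed.

Let ell_lip s t : 0 <= s -> s <= t -> t <= 1 -> ell t <= ell s + C * (t - s).
Proof.
move=> s0 st t1.
have t0 := le_trans s0 st; have s1 := le_trans st t1.
apply: ge_sup; first by exists 0; exact: lengths0.
move=> _ [p [pp lp] <-].
elim/last_ind: p t st t1 t0 pp lp => [|p b IH] t st t1 t0 /=.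
  move=> _ _; rewrite addr_ge0//; last by rewrite mulr_ge0// subr_ge0.
  by apply: (@ell_ge [::]).
rewrite rcons_path last_rcons chain_length_rcons => /andP[pp lpb] bt.
have p0 := path_lt_last pp.
have [bs|sb] := leP b s.
  apply: (@le_trans _ _ (ell s)); last by rewrite lerDl mulr_ge0// subr_ge0.
  rewrite -chain_length_rcons; apply: ell_ge => //.
    by rewrite rcons_path pp.
  by rewrite last_rcons.
have [lps|slp] := leP (last 0 p) s.
  apply: (@le_trans _ _ (chain_length gamma 0 p + euclidean_dist (gamma (last 0 p)) (gamma s)
     + C * (t - s))); last first.
    rewrite lerD2r; move: lps; rewrite le_eqVlt => /orP[/eqP ls|ls].
      by rewrite ls euclxx addr0; apply: ell_ge => //; rewrite ls.
    have := @ell_ge (rcons p s) s s0 s1.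
    by rewrite rcons_path pp last_rcons chain_length_rcons ls; exact.
  rewrite -addrA lerD2l.
  apply: le_trans (eucl_triangle (gamma s) _ _) _; rewrite lerD2l.
  apply: (le_trans (gamma_lip s0 (ltW sb) (le_trans bt t1))).
  by rewrite ler_wpM2l// lerD2r.
have lpt := le_trans (ltW lpb) bt.
have := IH (last 0 p) (ltW slp) (le_trans lpt t1) (le_trans s0 (ltW slp)) pp (lexx _).
have := gamma_lip (le_trans s0 (ltW slp)) (ltW lpb) (le_trans bt t1).
have : C * (b - s) <= C * (t - s) by rewrite ler_wpM2l// lerD2r.
by lra.
Qed.

(** [sigma] is merely a right inverse of a modified arc length [h], given by the intermediate value
    theorem. It may jump, but [gamma \o sigma] cannot, since [gamma] moves by at most the increment
    of [h]. *)
Lemma arc_length_reparametrization : exists sigma : R -> R,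
  [/\ forall tau, 0 <= sigma tau <= 1,
      gamma (sigma 0) = gamma 0, gamma (sigma L) = gamma 1 &
      forall s t, euclidean_dist (gamma (sigma s)) (gamma (sigma t)) <= `|s - t|].
Proof.
have ell1 : ell 1 <= L.
  by apply: ge_sup => [|x]; [exists 0; exact: lengths0|exact: lengths_le].
have ell0 : ell 0 = 0.
  apply/eqP; rewrite eq_le; apply/andP; split; last exact: (@ell_ge [::]).
  apply: ge_sup => [|_ [p [pp lp] <-]]; first by exists 0; exact: lengths0.
  by case: p pp lp => //= b p /andP[b0 /path_lt_last bp]; lra.
(* The linear term stretches the arc length so that [h] runs from 0 to exactly [L], even if the
   curve is shorter. *)
pose h t := ell t + (L - ell 1) * t.
have hd s t : 0 <= s -> s <= t -> t <= 1 ->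
    euclidean_dist (gamma s) (gamma t) <= h t - h s.
  move=> s0 st t1; have := ell_superadd s0 st t1.
  have : 0 <= (L - ell 1) * (t - s) by rewrite mulr_ge0 ?subr_ge0.
  by rewrite /h; lra.
have hlip s t : 0 <= s -> s <= t -> t <= 1 -> h t - h s <= (C + (L - ell 1)) * (t - s).
  by move=> s0 st t1; have := ell_lip s0 st t1; rewrite /h; lra.
have hmono s t : 0 <= s -> s <= t -> t <= 1 -> h s <= h t.
  by move=> s0 st t1; rewrite -subr_ge0; exact: le_trans (eucl_ge0 _ _) (hd _ _ s0 st t1).
have h0 : h 0 = 0 by rewrite /h ell0 mulr0 addr0.
have h1 : h 1 = L by rewrite /h mulr1; lra.
have L0 : 0 <= L by rewrite -h0 -h1 hmono.
have hdn s t : 0 <= s <= 1 -> 0 <= t <= 1 ->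
    euclidean_dist (gamma s) (gamma t) <= `|h s - h t|.
  move=> /andP[s0 s1] /andP[t0 t1]; have [st|/ltW ts] := leP s t.
    by rewrite distrC; exact: le_trans (hd _ _ s0 st t1) (ler_norm _).
  by rewrite euclC; exact: le_trans (hd _ _ t0 ts s1) (ler_norm _).
pose K := C + (L - ell 1) + 1.
have K0 : 0 < K by rewrite ltr_wpDl// addr_ge0// subr_ge0.
have hdK s t : 0 <= s <= 1 -> 0 <= t <= 1 -> `|h s - h t| <= K * `|s - t|.
  move=> /andP[s0 s1] /andP[t0 t1]; wlog st : s t s0 s1 t0 t1 / s <= t.
    by move=> H; have [/H|/ltW/H] := leP s t; [|rewrite distrC (distrC s)]; exact.
  rewrite distrC (distrC s) !ger0_norm ?subr_ge0 ?hmono//.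
  by apply: le_trans (hlip _ _ s0 st t1) _; rewrite ler_wpM2r ?subr_ge0// lerDl.
have hc : {within `[0, 1], continuous h}.
  apply/subspace_continuousP => x; rewrite /= in_itv/= => x01.
  apply/cvgrPdist_lt => e e0; rewrite near_withinE; apply/nbhs_ballP.
  exists (e / K) => /=; first exact: divr_gt0.
  move=> y; rewrite /ball/= => xy; rewrite in_itv/= => y01.
  by apply: le_lt_trans (hdK _ _ x01 y01) _; rewrite mulrC -ltr_pdivlMr.
have surj tau : 0 <= tau <= L -> exists t, 0 <= t <= 1 /\ h t = tau.
  move=> tauL.
  have vh : Num.min (h 0) (h 1) <= tau <= Num.max (h 0) (h 1).
    by rewrite h0 h1 (min_idPl L0) (max_idPr L0).
  have [t] := IVT ler01 hc vh.
  by rewrite in_itv/= => t01 ht; exists t.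
(* Clamping extends the curve to the whole line by its end points. *)
pose clamp tau := Num.max 0 (Num.min tau L).
have clampL tau : 0 <= clamp tau <= L.
  by rewrite /clamp le_max lexx/= ge_max L0 ge_min lexx orbT.
have [sigma sigmaP] := choice (fun tau => surj _ (clampL tau)).
have s01 tau : 0 <= sigma tau <= 1 by have [] := sigmaP tau.
have hs tau : h (sigma tau) = clamp tau by have [] := sigmaP tau.
exists sigma; split => //.
(* [sigma 0] need not be 0, but [h] takes the same value at both, hence so does [gamma]. *)
- apply: eucl_eq0; apply/eqP; rewrite eq_le eucl_ge0 andbT.
  apply: le_trans (hdn _ _ (s01 0) _) _; first by rewrite lexx ler01.
  by rewrite hs h0 /clamp (min_idPl L0) maxxx subrr normr0.
- apply: eucl_eq0; apply/eqP; rewrite eq_le eucl_ge0 andbT.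
  apply: le_trans (hdn _ _ (s01 L) _) _; first by rewrite lexx ler01.
  by rewrite hs h1 /clamp minxx (max_idPr L0) subrr normr0.
- move=> s t; apply: le_trans (hdn _ _ (s01 s) (s01 t)) _; rewrite !hs.
  by rewrite /clamp clamp_lipschitz.
Qed.

End ArcLength.

Section UnitSpeedCurves.
Variables (R : realType) (n : nat) (Omega : set 'rV[R]_n).
Implicit Types (x y : 'rV[R]_n) (r L : R).

(** A bound on the path distance without any infimum. The curve is 1-Lipschitz on the whole line, so
    that pointwise limits and concatenations need no reparametrization. *)
Definition joined x y L := 0 <= L /\ exists gamma : R -> 'rV[R]_n,
  [/\ gamma 0 = x, gamma L = y, forall t, closure Omega (gamma t) &
      forall s t, euclidean_dist (gamma s) (gamma t) <= `|s - t|].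

Lemma joined_eucl x y L : joined x y L -> euclidean_dist x y <= L.
Proof.
by move=> [L0 [gamma [<- <- _ lip]]]; apply: le_trans (lip _ _) _; rewrite sub0r normrN ger0_norm.
Qed.

Lemma path_edist_joined x y L : joined x y L -> (path_edist Omega x y <= L%:E)%E.
Proof.
move=> [L0 [gamma [g0 gL gcl lip]]].
have lipL s t : euclidean_dist (gamma (L * s)) (gamma (L * t)) <= L * `|s - t|.
  by apply: le_trans (lip _ _) _; rewrite -mulrBr normrM (ger0_norm L0).
apply: (@le_trans _ _ (path_length (fun t => gamma (L * t)))).
  apply: ereal_inf_lbound; exists (fun t => gamma (L * t)) => //.
  split; rewrite ?mulr0 ?mulr1//.
  exists L; split; first exact: num_real.
  move=> K LK [s t] /= _; apply: le_trans (norm_le_eucl _ _) _.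
  by apply: le_trans (lipL _ _) _; rewrite ler_wpM2r// ltW.
apply: ge_ereal_sup => _ [s [ps /eqP ls] <-]; rewrite lee_fin polygonal_lengthE.
have := @chain_length_lipschitz _ _ (fun t => gamma (L * t)) 0 s L 1.
rewrite ls subr0 mulr1; apply => // u v _ uv _.
by rewrite -[leRHS]mulrC -(ger0_norm (_ : 0 <= v - u)) ?subr_ge0// distrC mulrC.
Qed.

(** The strict inequality provides one curve of length below [L], which is then reparametrized by
    arc length. *)
Lemma path_edist_lt_joined x y L : (path_edist Omega x y < L%:E)%E -> joined x y L.
Proof.
move=> /ereal_inf_lt[_ [gamma [glip gcl g0 g1] <-] lenL].
have len s : path <%R 0 s -> last 0 s = 1 -> chain_length gamma 0 s <= L.
  move=> ps ls; rewrite -lee_fin; apply: le_trans (ltW lenL).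
  rewrite -polygonal_lengthE; apply: ereal_sup_ubound; exists s => //.
  by split => //; apply/eqP.
have L0 : 0 <= L.
  by apply: le_trans (len [:: 1] _ erefl); rewrite ?chain_length_ge0//= ltr01.
have [K [K0 lipK]] : exists K, 0 <= K /\ forall s t, 0 <= s -> s <= t -> t <= 1 ->
    euclidean_dist (gamma s) (gamma t) <= K * (t - s).
  case: glip => K [_ /(_ (`|K| + 1))]; rewrite (le_lt_trans (ler_norm _)) ?ltrDl//.
  move=> /(_ isT) glip; exists (n%:R * (`|K| + 1)); split=> [|s t s0 st t1].
    by rewrite mulr_ge0// addr_ge0.
  apply: le_trans (eucl_le_norm _ _) _; rewrite -mulrA ler_wpM2l//.
  have /= := glip (t, s); rewrite (distrC (gamma t)) (@ger0_norm _ (t - s)) ?subr_ge0//.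
  apply; split; rewrite /= in_itv/= ?t1 ?s0 ?(le_trans s0 st)//.
  exact: le_trans st t1.
have [sigma [s01 s0 sL slip]] := arc_length_reparametrization K0 lipK len.
split => //; exists (gamma \o sigma); split; rewrite /= ?s0 ?sL//.
by move=> t; apply: gcl; rewrite in_itv/=.
Qed.

(** A pointwise ultralimit of 1-Lipschitz curves is 1-Lipschitz and stays in the closure. Both the
    attainment of the infimum and the lower semicontinuity of the path distance follow from this. *)
Lemma joined_closed x y r (M : R) : 0 <= r ->
  (forall z, closure Omega z -> `|z| <= M) ->
  (forall e, 0 < e -> exists x' y', [/\ joined x' y' (r + e),
     euclidean_dist x x' < e & euclidean_dist y y' < e]) ->
  joined x y r.
Proof.
move=> r0 clM H.
pose d k : R := k.+1%:R^-1.
have d0 k : 0 < d k by rewrite invr_gt0.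
have ex k : exists g : R -> 'rV[R]_n,
    [/\ euclidean_dist x (g 0) < d k, euclidean_dist y (g (r + d k)) < d k,
      forall t, closure Omega (g t) &
      forall s t, euclidean_dist (g s) (g t) <= `|s - t|].
  have [x' [y' [[_ [g [g0 gr gcl glip]]] xx' yy']]] := H _ (d0 k).
  by exists g; rewrite g0 gr.
have [v vP] := choice ex.
have [F FU FN] := cofinite_ultrafilter.
have FP := @ultra_proper _ _ FU.
have vM t k : `|v k t| <= M by have [_ _ vcl _] := vP k; exact: clM.
have [gamma gP] := choice (fun t => bounded_ultralimit FU (vM t)).
have small e : 0 < e -> F [set k | d k < e].
  move=> e0; have [N _ NP] := near_infty_natSinv_lt (PosNum e0).
  by apply: filterS (FN N) => k /=; exact: NP.
have lim0 a b : (forall e, 0 < e -> F [set k | euclidean_dist a b <= 4 * e]) -> a = b.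
  move=> ab; apply: eucl_eq0; apply/eqP; rewrite eq_le eucl_ge0 andbT.
  apply: (@le_of_small _ _ _ 4) => // e e0 _; rewrite add0r mulrC.
  by have [k] := filter_ex (ab e e0).
split => //; exists gamma; split.
- apply: lim0 => e e0.
  apply: filterS (filterI (gP 0 e e0) (small e e0)) => k /= [gv de].
  have [xv _ _ _] := vP k; have := eucl_triangle (v k 0) (gamma 0) x.
  by rewrite (euclC (v k 0)); lra.
- apply: lim0 => e e0.
  apply: filterS (filterI (gP r e e0) (small e e0)) => k /= [gv de].
  have [_ yv _ lip] := vP k; have := eucl_triangle (v k r) (gamma r) y.
  have := eucl_triangle (v k (r + d k)) (v k r) y.
  have := lip r (r + d k); rewrite opprD addNKr normrN gtr0_norm//.
  by rewrite (euclC y) in yv; lra.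
- move=> t; apply: (@closed_closure _ Omega).
  apply/closure_euclP => e e0; have [k /= gv] := filter_ex (gP t e e0).
  by exists (v k t) => //; have [] := vP k.
- move=> s t; apply: (@le_of_small _ _ _ 2) => // e e0 _.
  have [k /= [gs gt]] := filter_ex (filterI (gP s e e0) (gP t e e0)).
  have [_ _ _ /(_ s t) lip] := vP k.
  have := eucl_triangle (v k s) (gamma s) (gamma t).
  have := eucl_triangle (v k t) (v k s) (gamma t).
  by rewrite (euclC (v k t) (gamma t)); lra.
Qed.

Lemma joined_segment x y :
  (forall t, 0 <= t <= 1 -> closure Omega (x + t *: (y - x))) ->
  joined x y (euclidean_dist x y).
Proof.
set L := euclidean_dist x y => seg; have L0 : 0 <= L by exact: eucl_ge0.
split => //; have [L00|Ln0] := eqVneq L 0.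
  exists (fun=> x); split => //; first exact: eucl_eq0.
    by move=> _; have := seg 0; rewrite scale0r addr0; apply; rewrite lexx ler01.
  by move=> s t; rewrite euclxx.
have Lp : 0 < L by rewrite lt0r Ln0.
pose c t := Num.max 0 (Num.min (t / L) 1).
have c01 t : 0 <= c t <= 1 by rewrite /c le_max lexx/= ge_max ler01 ge_min lexx orbT.
exists (fun t => x + c t *: (y - x)); split.
- by rewrite /c mul0r (min_idPl ler01) maxxx scale0r addr0.
- by rewrite /c divff// minxx (max_idPr ler01) scale1r addrC subrK.
- by move=> t; exact: seg.
- move=> s t; rewrite eucl_line -/L -ler_pdivlMr//.
  rewrite -[X in _ / X](gtr0_norm Lp) -normf_div mulrBl.
  exact: clamp_lipschitz.
Qed.

Lemma joined_trans x y z L L' : joined x y L -> joined y z L' -> joined x z (L + L').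
Proof.
move=> [L0 [g [g0 gL gcl glip]]] [L'0 [h [h0 hL hcl hlip]]].
split; first by rewrite addr_ge0.
exists (fun t => if t <= L then g t else h (t - L)); split.
- by rewrite L0.
- rewrite gerDl; case: ifPn => [L'le0|_]; last by rewrite addrC addKr.
  have L'00 : L' = 0 by apply/eqP; rewrite eq_le L'le0.
  by rewrite L'00 addr0 gL -h0 -hL L'00.
- by move=> t; case: ifP.
- move=> s t; wlog st : s t / s <= t.
    move=> H; have [/H|/ltW/H] := leP s t; first exact.
    by rewrite euclC distrC.
  have [tL|Lt] := leP t L; first by rewrite (le_trans st tL).
  have [sL|Ls] := leP s L.
    apply: le_trans (eucl_triangle y _ _) _.
    have := glip s L; have := hlip 0 (t - L); rewrite gL h0.
    have -> : `|s - t| = t - s by rewrite distrC ger0_norm ?subr_ge0.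
    have -> : `|s - L| = L - s by rewrite distrC ger0_norm ?subr_ge0.
    have -> : `|0 - (t - L)| = t - L by rewrite sub0r normrN ger0_norm ?subr_ge0 ?ltW.
    by lra.
  by apply: le_trans (hlip _ _) _; rewrite opprB addrA subrK.
Qed.

Lemma joined_shrink x y L s : joined x y L -> 0 <= s <= L ->
  exists2 z, joined x z (L - s) & closure Omega z /\ euclidean_dist y z <= s.
Proof.
move=> [L0 [g [g0 gL gcl glip]]] /andP[s0 sL].
exists (g (L - s)); first by split; [rewrite subr_ge0|exists g].
split => //; rewrite -gL; apply: le_trans (glip _ _) _.
by rewrite opprB addrC subrK ger0_norm.
Qed.

End UnitSpeedCurves.

(** * The path distance *)

Section PathMetric.
Variables (R : realType) (n : nat) (Omega : set 'rV[R]_n).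
Hypothesis n_gt0 : (0 < n)%N.
Hypothesis Omega_bounded : bounded_set Omega.
Hypothesis Omega_open : open Omega.
Hypothesis Omega_diam : (path_diam Omega < +oo)%E.
Variable eps : R.
Hypothesis eps_gt0 : 0 < eps.
Implicit Types (x y z : 'rV[R]_n) (r s c : R).

Local Notation e := (@euclidean_dist R n).
Local Notation X := (closure Omega).
Local Notation d := (path_dist Omega).
Local Notation rho := (rho Omega eps).

Lemma closure_bounded : exists M, forall x, X x -> `|x| <= M.
Proof.
case: Omega_bounded => M [_ /(_ (`|M| + 1))].
rewrite (le_lt_trans (ler_norm _)) ?ltrDl// => /(_ isT) OM.
exists (`|M| + 1 + 1) => x /closure_euclP/(_ 1 ltr01)[y /OM /= yM xy].
have := norm_le_eucl x y; have := ler_normD (x - y) y; rewrite subrK; lra.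
Qed.

Lemma sub_closure x : Omega x -> X x.
Proof. exact: subset_closure. Qed.

(** Attainment of the infimum. The finite diameter ensures that [fine] does not turn +oo into 0. *)
Lemma joined_fine x y r : X x -> X y -> d x y <= r <-> joined Omega x y r.
Proof.
move=> Xx Xy.
have fin : path_edist Omega x y \is a fin_num.
  rewrite fin_numE; apply/andP; split.
    apply/eqP => pd; have /path_edist_lt_joined[] : (path_edist Omega x y < (-1)%:E)%E.
      by rewrite pd ltNyr.
    by rewrite leNgt ltrN10.
  rewrite -ltey; apply: le_lt_trans Omega_diam.
  by apply: ereal_sup_ubound; exists (x, y).
split=> [dr|/path_edist_joined]; last by rewrite -lee_fin fineK.
have [M XM] := closure_bounded.
have lt_joined s : d x y < s -> joined Omega x y s.
  by move=> ds; apply: path_edist_lt_joined; rewrite -(fineK fin) lte_fin.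
apply: (joined_closed _ XM).
  rewrite leNgt; apply/negP => r0.
  have [] := lt_joined (r / 2) _; last by lra.
  by apply: le_lt_trans dr _; lra.
move=> c c0; exists x, y; rewrite !euclxx; split => //; apply: lt_joined.
by apply: le_lt_trans dr _; rewrite ltrDl.
Qed.

Lemma joined_path_dist x y : X x -> X y -> joined Omega x y (d x y).
Proof. by move=> Xx Xy; apply/joined_fine. Qed.

Lemma eucl_le_path_dist x y : X x -> X y -> e x y <= d x y.
Proof. by move=> Xx Xy; apply: joined_eucl (joined_path_dist Xx Xy). Qed.

Lemma path_dist_ge0 x y : X x -> X y -> 0 <= d x y.
Proof. by move=> Xx Xy; exact: le_trans (eucl_ge0 _ _) (eucl_le_path_dist Xx Xy). Qed.

Lemma path_dist_triangle y x z : X x -> X y -> X z -> d x z <= d x y + d y z.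
Proof.
by move=> Xx Xy Xz; apply/joined_fine => //; apply: joined_trans; exact: joined_path_dist.
Qed.

(** Otherwise points tending to [x] and [z] would be joined by curves of length at most [d x z - c],
    and a limit of these would join [x] to [z]. *)
Lemma path_dist_lsc x z c : X x -> X z -> 0 < c -> exists2 r, 0 < r &
  forall x' z', X x' -> X z' -> e x x' < r -> e z z' < r -> d x z <= d x' z' + c.
Proof.
move=> Xx Xz c0; apply: contrapT => H.
have H' r : 0 < r -> exists x' z', [/\ X x', X z', e x x' < r, e z z' < r & d x' z' < d x z - c].
  move=> r0; apply: contrapT => nH; apply: H; exists r => // x' z' Xx' Xz' xx' zz'.
  rewrite leNgt; apply/negP => dd; apply: nH; exists x', z'; split => //; lra.
suff : d x z <= d x z - c by lra.
have [M XM] := closure_bounded.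
apply/joined_fine => //; apply: (joined_closed _ XM).
  have [x' [z' [Xx' Xz' _ _]]] := H' 1 ltr01.
  by have := path_dist_ge0 Xx' Xz'; lra.
move=> r r0; have [x' [z' [Xx' Xz' xx' zz' dd]]] := H' r r0.
exists x', z'; split => //; apply/joined_fine => //; lra.
Qed.

Lemma path_dist_segment x y :
  (forall t, 0 <= t <= 1 -> X (x + t *: (y - x))) -> d x y <= e x y.
Proof.
move=> seg; apply/joined_fine; last exact: joined_segment.
  by have := seg 0; rewrite scale0r addr0; apply; rewrite lexx ler01.
by have := seg 1; rewrite scale1r addrC subrK; apply; rewrite lexx ler01.
Qed.

Lemma path_ball_shrink x y r s : X x -> X y -> d x y <= r -> 0 <= s <= r ->
  exists z, [/\ X z, d x z <= r - s & e y z <= s].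
Proof.
move=> Xx Xy /(joined_fine _ Xx Xy) j /(joined_shrink j)[z jz [Xz yz]].
by exists z; split => //; apply/joined_fine.
Qed.

Lemma open_euclP x : Omega x -> exists2 r, 0 < r & forall y, e x y < r -> Omega y.
Proof. by move=> Ox; apply/nbhs_euclP; apply: open_nbhs_nbhs. Qed.

Lemma boundaryP x : boundary Omega x <-> X x /\ ~ Omega x.
Proof.
rewrite /boundary; split => -[Xx nOx]; split => // Ox; apply: nOx; last exact: interior_subset.
by rewrite /interior; apply: open_nbhs_nbhs.
Qed.

Lemma closure_cases x : X x -> Omega x \/ boundary Omega x.
Proof.
by move=> Xx; have [|nO] := pselect (Omega x); [left|right; apply/boundaryP].
Qed.

Lemma path_dist_near x y r : (forall z, e x z < r -> Omega z) -> e x y < r ->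
  d x y <= e x y /\ d y x <= e x y.
Proof.
move=> xr xy; rewrite {2}euclC; split; apply: path_dist_segment => t /andP[t0 t1]; apply/sub_closure/xr.
  have := eucl_line x y 0 t; rewrite scale0r addr0 => ->.
  rewrite sub0r normrN ger0_norm//; apply: le_lt_trans xy.
  by rewrite ler_piMl// eucl_ge0.
have := eucl_line y x 1 t; rewrite scale1r addrC subrK => ->.
  rewrite ger0_norm ?subr_ge0//.
rewrite (euclC y) (le_lt_trans _ xy)// ler_piMl ?eucl_ge0//; lra.
Qed.

Lemma path_distxx x : X x -> d x x = 0.
Proof.
move=> Xx; apply/eqP; rewrite eq_le path_dist_ge0// andbT -(euclxx x).
by apply: path_dist_segment => t _; rewrite subrr scaler0 addr0.
Qed.

Lemma rho_interior x y : Omega x -> Omega y -> d x y <= eps -> rho x y = eps.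
Proof. by move=> Ox Oy dxy; rewrite /Defs.rho asboolT//; exact: max_idPr. Qed.

Lemma rho_boundary x y : ~ Omega y -> rho x y = d x y.
Proof. by move=> nOy; rewrite /Defs.rho asboolF// => -[]. Qed.

Lemma path_dist_le_rho x y : d x y <= rho x y.
Proof. by rewrite /Defs.rho; case: ifP => // _; rewrite le_max lexx. Qed.

Lemma rho_le_eps x y : d x y <= eps -> rho x y <= eps.
Proof. by rewrite /Defs.rho; case: ifP => // _; rewrite ge_max lexx andbT. Qed.

Lemma rho_ge x y r : (forall z, e x z < r -> Omega z) -> Omega x -> X y ->
  Num.min eps r <= rho x y.
Proof.
move=> xr Ox Xy; have [Oy|nOy] := pselect (Omega y).
  by rewrite /Defs.rho asboolT// ge_min le_max lexx orbT.
rewrite rho_boundary// ge_min; apply/orP; right.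
apply: le_trans (eucl_le_path_dist (sub_closure Ox) Xy).
by rewrite leNgt; apply/negP => /xr.
Qed.

Lemma rho_bounds x : Omega x -> exists2 r, 0 < r & forall y, X y -> r <= rho x y.
Proof.
move=> Ox; have [r r0 xr] := open_euclP Ox.
exists (Num.min eps r); first by rewrite lt_min eps_gt0.
by move=> y Xy; exact: rho_ge.
Qed.

Lemma rho_gt0 x y : Omega x -> X y -> 0 < rho x y.
Proof.
by move=> /rho_bounds[r r0 H] Xy; apply: lt_le_trans r0 (H _ Xy).
Qed.

Lemma path_ball_center x : Omega x -> path_ball Omega x eps x.
Proof.
by move=> Ox; split; [exact: sub_closure|rewrite path_distxx ?ltW//; exact: sub_closure].
Qed.

(** The jump of [rho] has the harmless sign: near an interior [z] all targets are interior and
    [rho = eps], while for [z] on the boundary [rho x z] is the path distance, which never exceeds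
    [rho]. The second conclusion puts limits of targets into the limit ball. *)
Lemma rho_lsc x z c : Omega x -> X z -> 0 < c -> exists2 r, 0 < r &
  forall x' z', Omega x' -> X z' -> d x' z' <= eps -> e x x' < r -> e z z' < r ->
    rho x z <= rho x' z' + c /\ d x z <= eps + c.
Proof.
move=> Ox Xz c0; have [r r0 rH] := path_dist_lsc (sub_closure Ox) Xz c0.
have [Oz|nOz] := pselect (Omega z).
  have [s s0 sH] := open_euclP Oz; exists (Num.min r s); first by rewrite lt_min r0.
  move=> x' z' Ox' Xz' d'; rewrite !lt_min => /andP[xr _] /andP[zr zs].
  have dd := rH x' z' (sub_closure Ox') Xz' xr zr.
  rewrite (rho_interior Ox' (sH _ zs) d'); split; last by lra.
  rewrite /Defs.rho asboolT// ge_max lerDl (ltW c0) andbT; lra.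
exists r => // x' z' Ox' Xz' d' xr zr.
have dd := rH x' z' (sub_closure Ox') Xz' xr zr.
rewrite rho_boundary//; split; last by lra.
by have := path_dist_le_rho x' z'; lra.
Qed.

(** A target too far for the new centre is pulled back along its curve by [s]. *)
Lemma path_ball_move x x' y s : Omega x -> Omega x' -> d x' x <= s -> s <= eps ->
  path_ball Omega x eps y ->
  exists y', [/\ path_ball Omega x' eps y', e y y' <= s & rho x' y' <= rho x y + s].
Proof.
move=> Ox Ox' xx' seps [Xy dy].
have [Xx Xx'] := (sub_closure Ox, sub_closure Ox').
have s0 := le_trans (path_dist_ge0 Xx' Xx) xx'.
have [dys|dys] := leP (d x y) (eps - s).
  have dx'y : d x' y <= d x y + s by have := path_dist_triangle Xx' Xx Xy; lra.
  exists y; rewrite euclxx; split => //; first by split => //; lra.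
  have [Oy|nOy] := pselect (Omega y); last by rewrite !rho_boundary.
  rewrite !rho_interior//; lra.
have s0eps : 0 <= s <= eps by rewrite s0.
have [y' [Xy' xy' yy']] := path_ball_shrink Xx Xy dy s0eps.
have dx'y' : d x' y' <= eps by have := path_dist_triangle Xx' Xx Xy'; lra.
(* [y'] may be interior while [y] is not; the bound holds because [rho x' y' <= eps < d x y + s]. *)
exists y'; split => //; have := rho_le_eps dx'y'; have := path_dist_le_rho x y; lra.
Qed.

(** A nearest point of the complement exists by compactness. The half-open segment towards it is
    closer to [x] than the complement, hence inside [Omega], so it is an admissible path. *)
Lemma nearest_exit x : Omega x -> exists z,
  [/\ boundary Omega z, forall y, ~ Omega y -> e x z <= e x y,
      forall t, 0 <= t < 1 -> Omega (x + t *: (z - x)) &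
      forall t, 0 <= t <= 1 -> d x (x + t *: (z - x)) <= t * e x z].
Proof.
move=> Ox.
have [M XM] := closure_bounded.
(* A point outside the bounded set [Omega]; its coordinates are seen by the norm because [n > 0]. *)
pose far : 'rV[R]_n := const_mx (`|M| + 1).
have nOfar : ~ Omega far.
  move=> /sub_closure/XM; apply/negP; rewrite -ltNge.
  apply: (@lt_le_trans _ _ `|far 0 (Ordinal n_gt0)|).
    by rewrite mxE ger0_norm ?addr_ge0// (le_lt_trans (ler_norm _))// ltrDl.
  rewrite [leRHS]/Num.norm/= mx_normrE.
  exact: (@le_bigmax _ _ _ (0 : R) (fun ij : 'I_1 * 'I_n => `|far ij.1 ij.2|) (0, _)).
pose D := [set e x y | y in ~` Omega].
have infD : has_inf D.
  by split; [exists (e x far), far|exists 0 => _ [y _ <-]; exact: eucl_ge0].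
have ex k : exists y, ~ Omega y /\ e x y < inf D + k.+1%:R^-1.
  have k0 : 0 < k.+1%:R^-1 :> R by rewrite invr_gt0.
  by have [_ [y nOy <-] yk] := inf_adherent k0 infD; exists y.
have [v vP] := choice ex.
have [z zv] : exists z, forall r N, 0 < r -> exists2 k, (N <= k)%N & e z (v k) < r.
  apply: (@bounded_cluster _ _ v (`|x| + (inf D + 1))) => k.
  rewrite -[X in `|X|](subrK x) addrC; apply: le_trans (ler_normD _ _) _.
  rewrite lerD2l; apply: le_trans (norm_le_eucl _ _) _; rewrite euclC.
  have [_ /ltW vk] := vP k; apply: le_trans vk _.
  by rewrite lerD2l invf_le1// ler1n.
have nOz : ~ Omega z.
  move=> /open_euclP[r r0 rH]; have [k _ /rH] := zv r 0%N r0.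
  by have [] := vP k.
have zmin y : ~ Omega y -> e x z <= e x y.
  move=> nOy; apply: (@le_trans _ _ (inf D)); last first.
    by apply: ge_inf; [case: infD|exists y].
  apply: (@le_of_small _ _ _ 2) => // r r0 _.
  have [N _ NP] := near_infty_natSinv_lt (PosNum r0).
  have [k Nk zk] := zv r N r0.
  have := NP k Nk; have [_] := vP k; have := eucl_triangle (v k) x z.
  by rewrite (euclC (v k)) /=; move: (k.+1%:R^-1) => q; lra.
have exz : 0 < e x z.
  rewrite lt0r eucl_ge0 andbT; apply/eqP => /eucl_eq0 xz; by rewrite -xz in nOz.
have seg t : e x (x + t *: (z - x)) = `|t| * e x z.
  by have := eucl_line x z 0 t; rewrite scale0r addr0 sub0r normrN.
have Oseg t : 0 <= t < 1 -> Omega (x + t *: (z - x)).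
  move=> /andP[t0 t1]; apply: contrapT => /zmin; apply/negP.
  by rewrite seg ger0_norm// -ltNge gtr_pMl.
have Xseg t : 0 <= t <= 1 -> X (x + t *: (z - x)).
  move=> /andP[t0]; rewrite le_eqVlt => /orP[/eqP->|t1]; last first.
    by apply/sub_closure/Oseg; rewrite t0.
  apply/closure_euclP => r r0.
  pose s := Num.max 0 (1 - r / (2 * e x z)).
  have s01 : 0 <= s < 1.
    rewrite /s le_max lexx/= gt_max ltr01/= gtrBl divr_gt0// mulr_gt0//.
  exists (x + s *: (z - x)); first exact: Oseg.
  rewrite eucl_line ger0_norm; last by case/andP: s01 => _ /ltW; rewrite subr_ge0.
  apply: (@le_lt_trans _ _ (r / 2)); last by lra.
  rewrite -ler_pdivlMr// -mulrA -invfM lerBlDr -lerBlDl /s le_max; apply/orP; right.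
  by rewrite mulrC.
exists z; split => //.
  apply/boundaryP; split => //; have := Xseg 1.
  by rewrite scale1r addrC subrK; apply; rewrite ler01 lexx.
move=> t /andP[t0 t1]; rewrite -{2}(ger0_norm t0) -seg; apply: path_dist_segment => s /andP[s0 s1].
rewrite [_ - x]addrC addKr scalerA; apply: Xseg.
by rewrite mulr_ge0//= mulr_ile1.
Qed.

(** * Comparison and Perron solutions *)

Section OneStep.
Variables (u : 'rV[R]_n -> R) (M : R).
Hypothesis uM : forall x, X x -> `|u x| <= M.
Variable x : 'rV[R]_n.
Hypothesis Ox : Omega x.

Lemma Splus_has_sup :
  has_sup [set (u y - u x) / rho x y | y in path_ball Omega x eps].
Proof.
split; first by exists ((u x - u x) / rho x x), x => //; exact: path_ball_center.
have [r r0 rH] := rho_bounds Ox.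
exists (2 * M / r) => _ [y [Xy _] <-].
rewrite ler_pdivrMr ?rho_gt0//.
have := uM Xy; have := uM (sub_closure Ox); rewrite !ler_norml => /andP[a b] /andP[c d].
apply: (@le_trans _ _ (2 * M)); first by lra.
rewrite -[leLHS](divfK (lt0r_neq0 r0)) ler_wpM2l ?rH// divr_ge0 ?(ltW r0)//; lra.
Qed.

Lemma Splus_ge y : path_ball Omega x eps y ->
  u y - u x <= Splus Omega eps u x * rho x y.
Proof.
move=> By; rewrite -ler_pdivrMr; last by apply: rho_gt0 => //; case: By.
by apply: sup_upper_bound; [exact: Splus_has_sup|exists y].
Qed.

Lemma Splus_le c : (forall y, path_ball Omega x eps y -> u y - u x <= c * rho x y) ->
  Splus Omega eps u x <= c.
Proof.
move=> H; apply: ge_sup; first by case: Splus_has_sup.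
by move=> _ [y By <-]; rewrite ler_pdivrMr ?H// rho_gt0//; case: By.
Qed.

Lemma Splus_ge0 : 0 <= Splus Omega eps u x.
Proof.
have := Splus_ge (path_ball_center Ox).
by rewrite subrr pmulr_lge0// rho_gt0//; exact: sub_closure.
Qed.

Lemma Splus_gt c : c < Splus Omega eps u x ->
  exists2 y, path_ball Omega x eps y & c * rho x y < u y - u x.
Proof.
move=> cS; have c0 : 0 < Splus Omega eps u x - c by rewrite subr_gt0.
have [_ [y By <-]] := sup_adherent c0 Splus_has_sup.
rewrite opprB addrC subrK => cy; exists y => //.
by rewrite -ltr_pdivlMr// rho_gt0//; case: By.
Qed.

End OneStep.

Lemma SminusE (u : 'rV[R]_n -> R) x :
  Sminus Omega eps u x = Splus Omega eps (fun y => - u y) x.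
Proof.
rewrite /Sminus /Splus; congr sup; apply/seteqP; split => _ [y By <-]; exists y => //;
  by rewrite opprK addrC.
Qed.

(* [subsol u (f x) x] means - Delta u <= f at x; the reverse inequality is
   [subsol (- u) (- f x) x]. *)
Definition subsol (u : 'rV[R]_n -> R) c x :=
  Splus Omega eps (fun y => - u y) x <= Splus Omega eps u x + eps * c.

Lemma oppfunK (u : 'rV[R]_n -> R) : (fun y => - - u y) = u.
Proof. by apply/funext => y; rewrite opprK. Qed.

Lemma inf_laplacian_le (u : 'rV[R]_n -> R) c x :
  - inf_laplacian Omega eps u x <= c <-> subsol u c x.
Proof.
rewrite /inf_laplacian /subsol SminusE -mulrN opprB mulrC ler_pdivrMr// lerBlDr.
by rewrite addrC (mulrC c).
Qed.

Lemma inf_laplacian_ge (u : 'rV[R]_n -> R) c x :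
  - inf_laplacian Omega eps u x >= c <-> subsol (fun y => - u y) (- c) x.
Proof.
rewrite /inf_laplacian /subsol SminusE -mulrN opprB mulrC ler_pdivlMr// lerBrDr oppfunK.
by rewrite mulrN lerBrDr addrC (mulrC c).
Qed.

Definition bounded_by (u : 'rV[R]_n -> R) M := forall x, X x -> `|u x| <= M.

Lemma bounded_byN u M : bounded_by u M -> bounded_by (fun y => - u y) M.
Proof. by move=> uM x Xx; rewrite normrN; exact: uM. Qed.

Lemma subsolW u c c' x : c <= c' -> subsol u c x -> subsol u c' x.
Proof. by move=> cc' /le_trans; apply; rewrite lerD2l ler_wpM2l// ltW. Qed.

(* The supremum of [w - V] need not be attained: at a near-maximal point only
   interior targets y lose something, and there [rho x y = eps]. *)
Lemma strict_comparison (w V f : 'rV[R]_n -> R) gam Mw MV : 0 < gam ->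
  bounded_by w Mw -> bounded_by V MV ->
  (forall x, Omega x -> subsol w (f x) x) ->
  (forall x, Omega x -> subsol (fun y => - V y) (- (f x + gam)) x) ->
  (forall x, boundary Omega x -> w x <= V x) ->
  forall x, X x -> w x <= V x.
Proof.
move=> gam0 wM VM wsub Vsup wV x0 Xx0; rewrite leNgt; apply/negP => wVx0.
pose S := [set w x - V x | x in X].
have supS : has_sup S.
  split; first by exists (w x0 - V x0), x0.
  exists (Mw + MV) => _ [x Xx <-]; have := wM _ Xx; have := VM _ Xx.
  by rewrite !ler_norml => /andP[? ?] /andP[? ?]; lra.
have m0 : 0 < sup S.
  apply: lt_le_trans (sup_upper_bound supS (ex_intro2 _ _ x0 Xx0 erefl)).
  by rewrite subr_gt0.
set m := sup S in m0.
(* The bound by [m] forces the near-maximal point into the interior; the other one makes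
   [2 * (eta / eps) < eps * gam]. *)
pose eta := Num.min m (eps ^+ 2 * gam / 3).
have eta0 : 0 < eta by rewrite lt_min m0 divr_gt0// mulr_gt0// exprn_gt0.
have [_ [x Xx <-] xm] := sup_adherent eta0 supS.
rewrite -/m in xm.
have etam : eta <= m by rewrite ge_min lexx.
have eta3 : eta <= eps ^+ 2 * gam / 3 by rewrite ge_min lexx orbT.
have Ox : Omega x.
  by have [//|/wV] := closure_cases Xx; lra.
have step y : path_ball Omega x eps y -> w y - w x <= V y - V x + (eta / eps) * rho x y.
  move=> [Xy dy]; have [Oy|yb] := closure_cases Xy.
    rewrite rho_interior// divfK ?gt_eqF//.
    have := sup_upper_bound supS (ex_intro2 _ _ y Xy erefl); rewrite -/m; lra.
  have := wV _ yb; have : 0 <= eta / eps * rho x y.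
    by rewrite mulr_ge0 ?divr_ge0 ?ltW// rho_gt0.
  lra.
have Sp : Splus Omega eps w x <= Splus Omega eps V x + eta / eps.
  apply: (Splus_le wM) => // y By; apply: le_trans (step y By) _.
  by rewrite mulrDl lerD2r; exact: (Splus_ge VM).
have Sm : Splus Omega eps (fun y => - V y) x <= Splus Omega eps (fun y => - w y) x + eta / eps.
  apply: (Splus_le (bounded_byN VM)) => // y By.
  have := Splus_ge (bounded_byN wM) Ox By; have := step y By; rewrite mulrDl; lra.
have := wsub x Ox; have := Vsup x Ox; rewrite /subsol oppfunK => Vx wx.
have : eps * gam <= 2 * (eta / eps) by move: Sp Sm Vx wx; lra.
rewrite mulrA ler_pdivlMr// => h.
have : 0 < eps ^+ 2 * gam by rewrite mulr_gt0// exprn_gt0.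
by move: h eta3; rewrite expr2; lra.
Qed.

(** * Distance to the complement and the barrier *)

Definition exit_dist x := inf [set e x y | y in ~` Omega].

Lemma exit_dist_le x y : ~ Omega y -> exit_dist x <= e x y.
Proof.
by move=> nOy; apply: ge_inf; [exists 0 => _ [z _ <-]; exact: eucl_ge0|exists y].
Qed.

Lemma exit_distE x z : ~ Omega z -> (forall y, ~ Omega y -> e x z <= e x y) ->
  exit_dist x = e x z.
Proof.
move=> nOz zmin; apply/eqP; rewrite eq_le exit_dist_le//=.
by apply: lb_le_inf => [|_ [y nOy <-]]; [exists (e x z), z|exact: zmin].
Qed.

Lemma exit_dist0 x : ~ Omega x -> exit_dist x = 0.
Proof.
by move=> nOx; rewrite (exit_distE nOx) ?euclxx// => y _; exact: eucl_ge0.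
Qed.

Lemma exit_dist_lip x y : Omega x -> exit_dist y <= exit_dist x + e x y.
Proof.
move=> /nearest_exit[z [/boundaryP[_ nOz] zmin _ _]].
rewrite (exit_distE nOz zmin); apply: le_trans (exit_dist_le _ nOz) _.
by rewrite addrC (euclC x y); exact: eucl_triangle.
Qed.

Lemma exit_dist_bounds : exists T, forall x, X x -> 0 <= exit_dist x <= T.
Proof.
have [M XM] := closure_bounded.
have M0 x : X x -> 0 <= M by move=> /XM; exact: le_trans.
exists (n%:R * (M + M)) => x Xx.
have [Ox|xb] := closure_cases Xx; last first.
  rewrite exit_dist0; last by have [] := proj1 (boundaryP x) xb.
  by rewrite lexx mulr_ge0// addr_ge0// (M0 x).
have [z [/boundaryP[Xz nOz] zmin _ _]] := nearest_exit Ox.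
rewrite (exit_distE nOz zmin) eucl_ge0/=; apply: le_trans (eucl_le_norm _ _) _.
rewrite ler_wpM2l//; apply: le_trans (ler_normB _ _) _.
by rewrite lerD// XM.
Qed.

(* A concave parabola in the distance to the complement: towards a nearest exit
   point the slope is larger than in every other direction. *)
Lemma barrier K c : exists V M, [/\ bounded_by V M,
  forall x, Omega x -> subsol (fun y => - V y) (- K) x &
  forall x, X x -> c <= V x].
Proof.
have [T TH] := exit_dist_bounds.
(* [b / 2 >= K] is the concavity required; [a] makes [phi] nondecreasing up to [T + eps], which
   bounds the distance to the complement after one step. *)
pose b := 2 * (`|K| + 1); have b0 : 0 < b by rewrite mulr_gt0// ltr_wpDl.
pose a := b * (T + eps).
pose phi t := a * t - b / 2 * t ^+ 2.
have phi_mono s t : 0 <= s -> s <= t -> t <= T + eps -> phi s <= phi t.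
  move=> s0 st tT; rewrite -subr_ge0.
  have -> : phi t - phi s = (t - s) * (b * ((T + eps - t) / 2 + (T + eps - s) / 2)).
    by rewrite /phi /a; field.
  by rewrite mulr_ge0 ?subr_ge0// mulr_ge0 ?(ltW b0)//; lra.
have phi0 : phi 0 = 0 by rewrite /phi expr0n/= !mulr0 subr0.
pose V x := c + phi (exit_dist x).
have VM : bounded_by V (`|c| + phi T).
  move=> x Xx; have /andP[D0 DT] := TH x Xx.
  apply: le_trans (ler_normD _ _) _; rewrite lerD2l ger0_norm.
    by apply: phi_mono => //; rewrite lerDl ltW.
  rewrite -phi0; apply: phi_mono => //; apply: (le_trans DT).
  by rewrite lerDl ltW.
exists V, (`|c| + phi T); split => //; last first.
  move=> x Xx; rewrite lerDl -phi0; have /andP[D0 DT] := TH x Xx.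
  by apply: phi_mono => //; apply: (le_trans DT); rewrite lerDl ltW.
move=> x Ox; have Xx := sub_closure Ox.
have [z [zb zmin zO zd]] := nearest_exit Ox.
have /boundaryP[Xz nOz] := zb.
have DE := exit_distE nOz zmin; set D := exit_dist x in DE.
have /andP[D0 DT] : 0 <= D <= T by exact: TH.
rewrite /subsol oppfunK.
(* A boundary target does not lie higher than [x], and an interior one gains at most [eps] in
   distance to the complement: the chord slope of [phi] over [[D, D + eps]] bounds all ascents. *)
have Sp : Splus Omega eps V x <= a - b * (D + eps / 2).
  apply: (Splus_le VM) => // y [Xy dy].
  have [Oy|nOy] := pselect (Omega y).
    rewrite rho_interior//.
    have lip : exit_dist y <= D + eps.
      apply: le_trans (exit_dist_lip y Ox) _; rewrite lerD2l.
      exact: le_trans (eucl_le_path_dist Xx Xy) dy.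
    have /andP[Dy0 _] := TH y Xy.
    have -> : (a - b * (D + eps / 2)) * eps = phi (D + eps) - phi D by rewrite /phi; field.
    by have := phi_mono _ _ Dy0 lip; rewrite lerD2r => /(_ DT); rewrite /V -/D; lra.
  rewrite /V (exit_dist0 nOy) phi0 -/D.
  have : phi 0 <= phi D by apply: phi_mono => //; move: eps_gt0; lra.
  have : 0 <= (a - b * (D + eps / 2)) * rho x y.
    rewrite mulr_ge0 ?ltW ?(rho_gt0 Ox)// /a -mulrBr mulr_gt0//.
    by move: eps_gt0; lra.
  by rewrite phi0; lra.
have bK : eps * K <= b / 2 * eps.
  rewrite mulrC ler_pM2r// /b mulrAC divff// mul1r.
  by apply: le_trans (ler_norm K) _; rewrite lerDl.
have Sm y := Splus_ge (bounded_byN VM) Ox (y := y).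
(* Descend to the exit point if it is within reach, otherwise by [eps] along the segment to it. This
   slope exceeds the ascent bound by at least [b / 2 * (D + eps)] in the first case and [b * eps] in
   the second. *)
have [Deps|epsD] := leP D eps.
  have dz : d x z <= D.
    have := zd 1; rewrite mul1r scale1r addrC subrK DE; apply.
    by rewrite ler01 lexx.
  have := Sm z (conj Xz (le_trans dz Deps)).
  rewrite /V (exit_dist0 nOz) phi0 -/D (rho_boundary _ nOz) => Sz.
  have : a - b / 2 * D <= Splus Omega eps (fun y => - V y) x.
    rewrite -(@ler_pM2r _ (d x z)); last by rewrite -(rho_boundary x nOz) rho_gt0.
    apply: le_trans Sz.
    apply: (@le_trans _ _ ((a - b / 2 * D) * D)); last by rewrite /phi; lra.
    rewrite ler_wpM2l// /a.
    have : 0 <= b * (T - D + D / 2 + eps) by rewrite mulr_ge0 ?(ltW b0)//; move: eps_gt0; lra.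
    by lra.
  have : 0 <= b * D by rewrite mulr_ge0// ltW.
  by lra.
have D_gt0 : 0 < D := lt_trans eps_gt0 epsD.
have t01 : 0 <= eps / D < 1 by rewrite divr_ge0 ?ltW//= ltr_pdivrMr ?mul1r.
pose y := x + (eps / D) *: (z - x).
have Oy : Omega y by exact: zO.
have dy : d x y <= eps.
  have t01' : 0 <= eps / D <= 1 by have /andP[-> /ltW ->] := t01.
  by apply: le_trans (zd _ t01') _; rewrite -DE divfK ?gt_eqF.
have yD : exit_dist y <= D - eps.
  apply: le_trans (exit_dist_le _ nOz) _.
  have := eucl_line x z (eps / D) 1; rewrite scale1r -/y => yz.
  have -> : e y z = `|eps / D - 1| * D.
    by rewrite -DE in yz; rewrite -yz; congr (e y _); rewrite addrC subrK.
  rewrite distrC ger0_norm ?subr_ge0; last by case/andP: t01 => _ /ltW.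
  by rewrite mulrBl mul1r divfK ?gt_eqF.
have /andP[Dy0 _] := TH y (sub_closure Oy).
have DepsT : D - eps <= T + eps by move: eps_gt0; lra.
have := phi_mono _ _ Dy0 yD DepsT.
have := Sm y (conj (sub_closure Oy) dy); rewrite rho_interior// /V -/D => S1 S2.
have : a - b * D + b / 2 * eps <= Splus Omega eps (fun y => - V y) x.
  rewrite -(ler_pM2r eps_gt0); apply: le_trans S1.
  apply: (@le_trans _ _ (phi D - phi (D - eps))); last by lra.
  by rewrite /phi; lra.
have : 0 <= b * eps by rewrite mulr_ge0 ?ltW.
by lra.
Qed.

(** * The Perron envelope *)

Lemma Splus_monotone u v Mu Mv x : bounded_by u Mu -> bounded_by v Mv ->
  Omega x -> u x = v x -> (forall y, X y -> u y <= v y) ->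
  Splus Omega eps u x <= Splus Omega eps v x.
Proof.
move=> uM vM Ox uvx uv; apply: (Splus_le uM) => // y By.
by apply: le_trans (Splus_ge vM Ox By); rewrite uvx lerD2r uv//; case: By.
Qed.

Section Perron.
Variables (f g : 'rV[R]_n -> R).

Definition subsolutions : set ('rV[R]_n -> R) := [set w |
  [/\ exists M, bounded_by w M, forall x, Omega x -> subsol w (f x) x &
      forall x, boundary Omega x -> w x <= g x]].

Definition perron x := sup [set w x | w in subsolutions].

End Perron.

(** [V] depends only on the bounds [K] and [G], so the envelopes of all perturbations of [f] share
    one bound. The right-hand side [K + 1] leaves the gap 1 needed for strict comparison. *)
Lemma subsolutions_barrier g K G :
  (forall x, boundary Omega x -> `|g x| <= G) ->
  exists V M, bounded_by V M /\ forall f, (forall x, Omega x -> `|f x| <= K) ->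
    subsolutions f g (fun x => - V x) /\
    forall w, subsolutions f g w -> forall x, X x -> w x <= V x.
Proof.
move=> gG; have [V [M [VM Vsup GV]]] := barrier (K + 1) G.
exists V, M; split => // f fK; split.
  split; first by exists M; exact: bounded_byN.
    move=> x Ox; apply: subsolW (Vsup x Ox).
    by have := fK x Ox; rewrite ler_norml => /andP[]; lra.
  move=> x xb; have := GV x (proj1 (proj1 (boundaryP x) xb)).
  by have := gG x xb; rewrite ler_norml => /andP[]; lra.
move=> w [[Mw wM] wsub wg].
apply: (strict_comparison ltr01 wM VM wsub) => x.
  move=> Ox; apply: subsolW (Vsup x Ox).
  by have := fK x Ox; rewrite ler_norml => /andP[]; lra.
move=> xb; have := GV x (proj1 (proj1 (boundaryP x) xb)).
by have := wg x xb; have := gG x xb; rewrite ler_norml => /andP[]; lra.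
Qed.

Section PerronSolution.
Variables (g : 'rV[R]_n -> R) (G K : R).
Hypothesis gG : forall x, boundary Omega x -> `|g x| <= G.

Lemma perron_bounded : exists M, forall f, (forall x, Omega x -> `|f x| <= K) ->
  bounded_by (perron f g) M /\
  forall x, X x -> has_sup [set w x | w in subsolutions f g].
Proof.
have [V [M [VM H]]] := subsolutions_barrier K gG.
exists M => f /H[subV leV].
have hs x : X x -> has_sup [set w x | w in subsolutions f g].
  move=> Xx; split; first by exists (- V x), (fun x => - V x).
  by exists (V x) => _ [w wS <-]; exact: leV.
split => // x Xx; have := VM x Xx; rewrite !ler_norml => /andP[V1 V2]; apply/andP; split.
  apply: (@le_trans _ _ (- V x)); first by lra.
  by apply: sup_upper_bound; [exact: hs|exists (fun x => - V x)].
apply: le_trans V2; apply: ge_sup; first by case: (hs x Xx).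
by move=> _ [w wS <-]; exact: leV.
Qed.

Variable f : 'rV[R]_n -> R.
Hypothesis fK : forall x, Omega x -> `|f x| <= K.
Local Notation u := (perron f g).

Let perron_bound : exists M, bounded_by u M.
Proof. by have [M H] := perron_bounded; exists M; have [] := H f fK. Qed.

Lemma perron_ge w x : subsolutions f g w -> X x -> w x <= u x.
Proof.
move=> wS Xx; have [M H] := perron_bounded; have [_ hs] := H f fK.
by apply: sup_upper_bound; [exact: hs|exists w].
Qed.

Lemma perron_gt t x : X x -> t < u x -> exists2 w, subsolutions f g w & t < w x.
Proof.
move=> Xx; rewrite -subr_gt0 => tu; have [M H] := perron_bounded; have [_ hs] := H f fK.
by have [_ [w wS <-]] := sup_adherent tu (hs x Xx); rewrite opprB addrC subrK; exists w.
Qed.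

(** A near-optimal [w] at [x] lies below the envelope everywhere and within [c] of it at [x]; as
    [rho >= r], exchanging the two costs each slope at most [c / r]. *)
Lemma perron_subsolution : subsolutions f g u.
Proof.
have [M uM] := perron_bound; split; first by exists M.
- move=> x Ox; have Xx := sub_closure Ox; have [r r0 rH] := rho_bounds Ox.
  apply: (@le_of_small _ _ _ (2 / r)); first by rewrite divr_ge0// ltW.
  move=> c c0 _; have uc : u x - c < u x by rewrite ltrBlDr ltrDl.
  have [w wS wx] := perron_gt Xx uc.
  have [[Mw wM] wsub _] := wS.
  have cr y : X y -> c <= c / r * rho x y.
    by move=> Xy; rewrite -mulrA ler_peMr ?(ltW c0)// ler_pdivlMl// mulr1 rH.
  have Sp : Splus Omega eps w x <= Splus Omega eps u x + c / r.
    apply: (Splus_le wM) => // y By; have [Xy _] := By.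
    have := Splus_ge uM Ox By; have := perron_ge wS Xy; have := cr y Xy.
    by rewrite mulrDl; lra.
  have Sm : Splus Omega eps (fun y => - u y) x <= Splus Omega eps (fun y => - w y) x + c / r.
    apply: (Splus_le (bounded_byN uM)) => // y By; have [Xy _] := By.
    have := Splus_ge (bounded_byN wM) Ox By; have := perron_ge wS Xy; have := cr y Xy.
    by rewrite mulrDl; lra.
  have := wsub x Ox; rewrite /subsol mulrA (mulrC c) -mulrA; lra.
- move=> x xb; have [Xx _] := proj1 (boundaryP x) xb.
  apply: contrapT => /negP; rewrite -ltNge => /(perron_gt Xx)[w [_ _ wg]].
  by rewrite ltNge wg.
Qed.

Let bump p t : 'rV[R]_n -> R := fun x => if x == p then t else u x.

Let bump_bounded p t : exists M, bounded_by (bump p t) M.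
Proof.
have [M uM] := perron_bound; exists (`|t| + `|M|) => x Xx; rewrite /bump.
case: ifP => _; first by rewrite lerDl.
by apply: le_trans (uM x Xx) _; apply: le_trans (ler_norm M) _; rewrite lerDr.
Qed.

(** Raising [u] away from [x] increases the ascents from [x] and decreases the descents. *)
Let bump_off p t x : u p <= t -> Omega x -> x != p -> subsol (bump p t) (f x) x.
Proof.
move=> ut Ox xp; have [M uM] := perron_bound; have [M' bM] := bump_bounded p t.
have [_ /(_ x Ox) usub _] := perron_subsolution.
have ub y : u y <= bump p t y by rewrite /bump; case: eqP => // ->.
have bx : bump p t x = u x by rewrite /bump (negbTE xp).
have Sp : Splus Omega eps u x <= Splus Omega eps (bump p t) x.
  by apply: (Splus_monotone uM bM).
have Sm : Splus Omega eps (fun y => - bump p t y) x <= Splus Omega eps (fun y => - u y) x.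
  apply: (Splus_monotone (bounded_byN bM) (bounded_byN uM)) => //.
    by rewrite bx.
  by move=> y _; rewrite lerN2.
by move: usub; rewrite /subsol; lra.
Qed.

(** The operator imposes nothing at a boundary point, so the envelope can be raised to [g] there. *)
Lemma perron_boundary x : boundary Omega x -> u x = g x.
Proof.
move=> xb; have [Xx nOx] := proj1 (boundaryP x) xb.
have [_ usub ug] := perron_subsolution.
apply/eqP; rewrite eq_le ug//=.
have bS : subsolutions f g (bump x (g x)).
  split; first exact: bump_bounded.
    move=> y Oy; apply: bump_off => //; first exact: ug.
    by apply/eqP => yx; rewrite yx in Oy.
  by move=> y yb; rewrite /bump; case: eqP => [->//|_]; exact: ug.
by have := perron_ge bS Xx; rewrite /bump eqxx.
Qed.

(* Where the inequality is strict the Perron envelope could be raised at a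
   single point. *)
Lemma perron_supersolution x : Omega x -> subsol (fun y => - u y) (- f x) x.
Proof.
move=> Ox; have Xx := sub_closure Ox.
have [_ usub ug] := perron_subsolution.
rewrite /subsol oppfunK leNgt; apply/negP => gap.
pose k := Splus Omega eps u x + eps * f x - Splus Omega eps (fun y => - u y) x.
have k0 : 0 < k by rewrite /k; move: gap; lra.
have [r r0 rH] := rho_bounds Ox.
(* Raising [u] at [x] by [h] costs each slope at most [k / 2], as [rho >= r]; the two changes
   together use up the gap [k]. *)
pose h := k * r / 2; have h0 : 0 < h by rewrite !mulr_gt0// invr_gt0.
have [M uM] := perron_bound; have [M' bM] := bump_bounded x (u x + h).
have hr y : X y -> h <= k / 2 * rho x y.
  by move=> Xy; rewrite /h mulrAC ler_wpM2l ?rH// divr_ge0 ?ltW.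
have bx : bump x (u x + h) x = u x + h by rewrite /bump eqxx.
have by_ y : y != x -> bump x (u x + h) y = u y by rewrite /bump => /negbTE ->.
have Sp : Splus Omega eps u x <= Splus Omega eps (bump x (u x + h)) x + k / 2.
  apply: (Splus_le uM) => // y By; have [Xy _] := By.
  have [->|yx] := eqVneq y x.
    rewrite subrr mulr_ge0 ?addr_ge0 ?(Splus_ge0 bM)// ?(ltW (rho_gt0 Ox Xx))//.
    by rewrite divr_ge0 ?ltW.
  have := Splus_ge bM Ox By; rewrite bx by_// mulrDl; have := hr y Xy; lra.
have Sm : Splus Omega eps (fun y => - bump x (u x + h) y) x <=
    Splus Omega eps (fun y => - u y) x + k / 2.
  apply: (Splus_le (bounded_byN bM)) => // y By; have [Xy _] := By.
  have [->|yx] := eqVneq y x.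
    rewrite subrr mulr_ge0 ?addr_ge0 ?(Splus_ge0 (bounded_byN uM))// ?(ltW (rho_gt0 Ox Xx))//.
    by rewrite divr_ge0 ?ltW.
  have := Splus_ge (bounded_byN uM) Ox By; rewrite bx by_// mulrDl; have := hr y Xy; lra.
have bS : subsolutions f g (bump x (u x + h)).
  split; first exact: bump_bounded.
    move=> y Oy; have [->|yx] := eqVneq y x; last by apply: bump_off => //; rewrite lerDl ltW.
    by rewrite /subsol; move: Sp Sm; rewrite /k; lra.
  move=> y yb; rewrite /bump; case: eqP => [yx|_]; last exact: ug.
  by have [_] := proj1 (boundaryP y) yb; rewrite yx.
by have := perron_ge bS Xx; rewrite bx; move: h0; lra.
Qed.

End PerronSolution.

(** * Stability and continuity *)

(* If u(x) exceeded g(z), the steep descent from x to a nearest exit point would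
   force an equally steep ascent, which only a boundary point near z offers. *)
Lemma boundary_upper_bound (g : 'rV[R]_n -> R) z M K c :
  (forall c, 0 < c -> exists2 r, 0 < r & forall y, boundary Omega y -> e z y < r ->
     `|g z - g y| < c) ->
  boundary Omega z -> 0 < c ->
  exists2 r, 0 < r & forall u k x, bounded_by u M ->
    (forall y, boundary Omega y -> u y <= g y) ->
    Omega x -> subsol u k x -> k <= K -> e z x < r -> u x <= g z + c.
Proof.
move=> gz zb c0; have [eta eta0 etaH] := gz (c / 2) ltac:(lra).
(* A slope above [A] would gain more than [2 * |M|] over an interior step, where [rho = eps], and
   over a boundary step of length at least [eta / 2]. *)
pose A := 2 * `|M| / eps + 4 * `|M| / eta + 1.
have A0 : 0 < A by rewrite ltr_wpDl// addr_ge0// divr_ge0 ?mulr_ge0// ltW.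
have p1 : 0 <= 4 * `|M| / eta * eps.
  by rewrite mulr_ge0 ?(ltW eps_gt0)// divr_ge0 ?mulr_ge0// ltW.
have p2 : 0 <= 2 * `|M| / eps * (eta / 2).
  by rewrite !mulr_ge0 ?invr_ge0 ?(ltW eps_gt0) ?(ltW eta0).
have AM : 2 * `|M| < A * eps.
  have -> : A * eps = 2 * `|M| + 4 * `|M| / eta * eps + eps.
    by rewrite /A; field; rewrite !gt_eqF.
  by move: eps_gt0; lra.
have AM' : 2 * `|M| < A * (eta / 2).
  have -> : A * (eta / 2) = 2 * `|M| / eps * (eta / 2) + 2 * `|M| + eta / 2.
    by rewrite /A; field; rewrite !gt_eqF.
  by lra.
(* A descent steeper than [B] forces an ascent steeper than [A]; with the choice of [r] below, a
   drop of more than [c / 2] within distance [r] is steeper than [B]. *)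
pose B := A + eps * `|K| + 1.
have B0 : 0 < B by rewrite ltr_wpDl// addr_ge0 ?(ltW A0)// mulr_ge0// ltW.
pose r := Num.min (Num.min eps (eta / 2)) (c / (2 * B)).
have r0 : 0 < r by rewrite !lt_min eps_gt0 !divr_gt0// mulr_gt0.
exists r => // u k x uM ug Ox uk kK zx.
have [reps reta rB] : [/\ r <= eps, r <= eta / 2 & r * B <= c / 2].
  split; [by rewrite !ge_min lexx|by rewrite !ge_min lexx orbT|].
  by rewrite -ler_pdivlMr// -mulrA -invfM ge_min lexx orbT.
have Xx := sub_closure Ox.
rewrite leNgt; apply/negP => gu.
have [z' [z'b zmin _ zd]] := nearest_exit Ox.
have [Xz' nOz'] := proj1 (boundaryP z') z'b.
have [_ nOz] := proj1 (boundaryP z) zb.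
have xz' : e x z' < r by apply: le_lt_trans (zmin _ nOz) _; rewrite euclC.
have dxz' : d x z' < r.
  have := zd 1; rewrite mul1r scale1r addrC subrK => /(_ _)/le_lt_trans; apply => //.
  by rewrite ler01 lexx.
have zz' : e z z' < eta by have := eucl_triangle x z z'; lra.
have := etaH z' z'b zz'; rewrite ltr_norml => /andP[gz1 gz2].
have := Splus_ge (bounded_byN uM) Ox (conj Xz' (le_trans (ltW dxz') reps)).
set S := Splus Omega eps _ x => Sz'.
have rho0 := rho_gt0 Ox Xz'.
have uz' := ug z' z'b.
have cS : c / 2 < S * rho x z' by lra.
have S0 : 0 <= S by exact: (Splus_ge0 (bounded_byN uM)).
have BS : B < S.
  rewrite ltNge; apply/negP => SB.
  suff : S * rho x z' <= c / 2 by lra.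
  apply: le_trans rB; rewrite mulrC ler_pM ?(ltW rho0)//.
  by rewrite (rho_boundary _ nOz') ltW.
have AS : A < Splus Omega eps u x.
  move: uk; rewrite /subsol -/S => uk.
  have : eps * k <= eps * `|K|.
    by rewrite ler_wpM2l ?(ltW eps_gt0)// (le_trans kK)// ler_norm.
  by move: BS; rewrite /B; lra.
have [y [Xy dy] Ay] := Splus_gt uM Ox AS.
have u2 : u y - u x <= 2 * `|M|.
  have := uM _ Xy; have := uM _ Xx; rewrite !ler_norml.
  by have := ler_norm M; move=> ? /andP[? ?] /andP[? ?]; lra.
have [Oy|yb] := closure_cases Xy; first by rewrite rho_interior// in Ay; lra.
have [_ nOy] := proj1 (boundaryP y) yb.
rewrite (rho_boundary _ nOy) in Ay.
have dxy : d x y < eta / 2 by rewrite -(ltr_pM2l A0); lra.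
have xy := eucl_le_path_dist Xx Xy.
have zy : e z y < eta by have := eucl_triangle x z y; lra.
have := etaH y yb zy; rewrite ltr_norml => /andP[? ?].
have : 0 <= A * d x y by rewrite mulr_ge0 ?(ltW A0)// path_dist_ge0.
by have := ug y yb; lra.
Qed.

(** A target [y] of [x] has a nearby target [y'] of [xs k] with [rho] hardly larger, and [v k y'] is
    hardly above [U y]: descents of [U] are nearly descents of [v k]. These force ascents of [v k],
    whose targets cluster in the ball around [x] by compactness, and lower semicontinuity of [rho]
    transfers their slopes to [U]. *)
Lemma subsol_stability (v : nat -> 'rV[R]_n -> R) (U : 'rV[R]_n -> R)
    (xs : nat -> 'rV[R]_n) (cs : nat -> R) M x c :
  (forall k, bounded_by (v k) M) -> bounded_by U M ->
  Omega x -> (forall k, Omega (xs k)) -> (forall k, subsol (v k) (cs k) (xs k)) ->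
  (forall r, 0 < r -> exists N, forall k, (N <= k)%N ->
     [/\ e x (xs k) < r, U x - r < v k (xs k) & cs k <= c + r]) ->
  (forall z r, X z -> 0 < r -> exists N, exists2 s, 0 < s &
     forall k z', (N <= k)%N -> X z' -> e z z' < s -> v k z' <= U z + r) ->
  subsol U c x.
Proof.
move=> vM UM Ox Oxs vsub xlim Ulim.
have Xx := sub_closure Ox.
have [r r0 rH] := open_euclP Ox.
pose q := Num.min eps (r / 2).
have q0 : 0 < q by rewrite lt_min eps_gt0 divr_gt0.
have qrho k y : e x (xs k) < r / 2 -> X y -> q <= rho (xs k) y.
  move=> xk Xy; apply: rho_ge => // z xz; apply: rH.
  have := eucl_triangle (xs k) x z; lra.
rewrite /subsol; set lam := Splus Omega eps U x.
have lam0 : 0 <= lam by exact: (Splus_ge0 UM).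
apply: (Splus_le (bounded_byN UM)) => // y0 By0.
(* If [U] rises towards [y0], the slope is negative and the target [x] itself does better; so the
   slope [A] below may be taken nonnegative. *)
have [y By [Uyx uy0]] : exists2 y, path_ball Omega x eps y & U y <= U x /\
    (forall b, (U x - U y) <= b * rho x y -> - U y0 - - U x <= b * rho x y0).
  have [Uy|Uy] := leP (U y0) (U x).
    by exists y0 => //; split => // b; lra.
  exists x; first exact: path_ball_center.
  split => // b; rewrite subrr pmulr_lge0 ?rho_gt0// => b0.
  have : 0 <= b * rho x y0 by rewrite mulr_ge0// ltW// rho_gt0//; case: By0.
  by lra.
apply: uy0; have [Xy dy] := By.
have rxy : 0 < rho x y by apply: rho_gt0.
rewrite -ler_pdivrMr//; set A := _ / _.
have A0 : 0 <= A by rewrite divr_ge0 ?subr_ge0// ltW.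
(* Sum of the coefficients of [h] in the errors below: [3 / q], [(A + 2) / q], 1 and [eps]. *)
pose C := (A + 5) / q + 1 + eps.
have C0 : 0 <= C.
  by rewrite !addr_ge0 ?ler01 ?(ltW eps_gt0)// divr_ge0 ?(ltW q0)// addr_ge0.
apply: (le_of_small C0) => h h0 h1.
have [s s0 ssmall] : exists2 s, 0 < s & [/\ s <= h, s <= r / 2 & s <= eps].
  exists (Num.min h (Num.min (r / 2) eps)); first by rewrite !lt_min h0 eps_gt0 divr_gt0.
  by rewrite !ge_min !lexx !orbT.
have [sh sr seps] := ssmall.
have [N1 N1H] := xlim s s0.
have [N2 [s2 s20 N2H]] := Ulim y h Xy h0.
have [N3 N3H] := xlim (Num.min s (s2)) ltac:(by rewrite lt_min s0).
have near k : (N1 <= k)%N -> e x (xs k) < r by move=> /N1H[? _ _]; lra.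
pose N := maxn N1 (maxn N2 N3).
(* For small [k] the point [x] is a placeholder, so that the targets form a sequence in the
   closure. *)
have ex k : exists z, X z /\ ((N <= k)%N -> path_ball Omega (xs k) eps z /\
    A <= (v k z - U x + h) / rho (xs k) z + (h * (A + 2)) / q + h + eps * (c + h)).
  have [Nk|kN] := leqP N k; last by exists x; split.
  move: (Nk); rewrite !geq_max => /and3P[N1k N2k N3k].
  have [xk Uk ck] := N1H k N1k.
  have [xk3 _ _] := N3H k N3k.
  have [dxk dkx] := path_dist_near rH (near k N1k).
  have e0s : e x (xs k) <= s by rewrite ltW.
  have [y' [By' yy' ry']] := path_ball_move Ox (Oxs k) dkx (le_trans e0s seps) By.
  have [Xy' dy'] := By'.
  have xkr : e x (xs k) < r / 2 by exact: lt_le_trans xk sr.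
  have qk' := qrho k y' xkr Xy'.
  have vy' : v k y' <= U y + h.
    by apply: N2H => //; apply: le_lt_trans yy' _; move: xk3; rewrite lt_min => /andP[].
  have Sm := Splus_ge (bounded_byN (vM k)) (Oxs k) By'.
  have := vsub k; rewrite /subsol; set Sp := Splus Omega eps (v k) (xs k) => sub.
  have Sph : Sp - h < Sp by rewrite ltrBlDr ltrDl.
  have [z Bz zS] := Splus_gt (vM k) (Oxs k) Sph.
  have [Xz dz] := Bz; exists z; split => // _; split => //.
  have rk' : 0 < rho (xs k) y' by apply: rho_gt0.
  have rkz : 0 < rho (xs k) z by apply: rho_gt0.
  have h1' : A * rho x y = U x - U y by rewrite divfK// gt_eqF.
  have h2' : A * rho (xs k) y' <= U x - U y + A * h.
    by rewrite -h1' -mulrDr ler_wpM2l//; lra.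
  have hq : h * (A + 2) <= h * (A + 2) / q * rho (xs k) y'.
    rewrite -mulrA ler_peMr ?ler_pdivlMl// ?mulr1//.
    by rewrite mulr_ge0 ?(ltW h0)// addr_ge0.
  have SA : A <= Splus Omega eps (fun y => - v k y) (xs k) + h * (A + 2) / q.
    rewrite -(ler_pM2r rk') mulrDl; apply: le_trans h2' _; lra.
  have Sv : Sp - h <= (v k z - U x + h) / rho (xs k) z.
    rewrite ler_pdivlMr//; lra.
  have : eps * cs k <= eps * (c + h) by rewrite ler_wpM2l ?(ltW eps_gt0)//; lra.
  by move: SA Sv sub; lra.
have [zs zsP] := choice ex.
have [MX XM] := closure_bounded.
have [z zcl] := @bounded_cluster _ _ zs MX (fun k => XM _ (proj1 (zsP k))).
have Xz : X z.
  apply: (@closed_closure _ Omega); apply/closure_euclP => t t0.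
  by have [k _ kt] := zcl t 0%N t0; exists (zs k) => //; case: (zsP k).
have zball : path_ball Omega x eps z.
  split => //; apply: (@le_of_small _ _ _ 1) => // t t0 _; rewrite mulr1.
  have [t' t'0 tH] := rho_lsc Ox Xz t0.
  have [N4 N4H] := xlim t' t'0.
  have [k Nk zk] := zcl t' (maxn N N4) t'0.
  move: Nk; rewrite geq_max => /andP[Nk N4k].
  have [Xk [] // [_ dk] _] := zsP k; have [xk _ _] := N4H k N4k.
  by have [] := tH _ _ (Oxs k) Xk dk xk zk.
have hlam : 0 < h / (lam + 1) by rewrite divr_gt0// ltr_wpDl.
have [t' t'0 tH] := rho_lsc Ox Xz hlam.
have [N4 N4H] := xlim t' t'0.
have [N5 [s5 s50 N5H]] := Ulim z h Xz h0.
have [k Nk zk] := zcl (Num.min t' s5) (maxn N (maxn N4 N5)) ltac:(by rewrite lt_min t'0).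
move: Nk zk; rewrite geq_max lt_min => /andP[Nk N45k] /andP[zt zs5].
move: N45k; rewrite geq_max => /andP[N4k N5k].
have [Xk /(_ Nk)[[_ dk] Ak]] := zsP k; have [xk _ _] := N4H k N4k.
have [rk _] := tH _ _ (Oxs k) Xk dk xk zt.
have vz := N5H k _ N5k Xk zs5.
have Uz := Splus_ge UM Ox zball; rewrite -/lam in Uz.
have [xk1 _ _] : [/\ e x (xs k) < s, U x - s < v k (xs k) & cs k <= c + s].
  by apply: N1H; move: Nk; rewrite !geq_max => /and3P[].
have qk := qrho k _ (lt_le_trans xk1 sr) Xk.
have rk0 : 0 < rho (xs k) (zs k) by exact: lt_le_trans qk.
have lamr : lam * rho x z <= lam * rho (xs k) (zs k) + h.
  apply: (@le_trans _ _ (lam * (rho (xs k) (zs k) + h / (lam + 1)))).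
    by rewrite ler_wpM2l.
  rewrite mulrDr lerD2l mulrCA ler_piMr ?(ltW h0)//.
  by rewrite ler_pdivrMr ?ltr_wpDl// mul1r lerDl.
have Q : (v k (zs k) - U x + h) / rho (xs k) (zs k) <= lam + h * 3 / q.
  rewrite ler_pdivrMr// mulrDl.
  have : h * 3 <= h * 3 / q * rho (xs k) (zs k).
    rewrite -mulrA ler_peMr ?ler_pdivlMl// ?mulr1//; lra.
  by move: Uz vz lamr; lra.
apply: le_trans Ak _.
have -> : h * C = h * 3 / q + h * (A + 2) / q + h + eps * h.
  by rewrite /C; field; rewrite gt_eqF.
by lra.
Qed.

(** * Half-relaxed upper limits *)

(** For sequences nonincreasing in [k] this is the half-relaxed upper limit without a supremum over
    later indices; for constant sequences it is the upper semicontinuous envelope. *)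
Definition upper_limit (v : nat -> 'rV[R]_n -> R) x :=
  inf [set sup [set v k y | y in [set y | X y /\ e x y < k.+1%:R^-1]] | k in [set: nat]].

Section UpperLimit.
Variables (v : nat -> 'rV[R]_n -> R) (M : R).
Hypothesis vM : forall k, bounded_by (v k) M.
Hypothesis v_anti : forall k l y, (k <= l)%N -> X y -> v l y <= v k y.

Let near_values k x := [set v k y | y in [set y | X y /\ e x y < k.+1%:R^-1]].

Let near_values_sup k x : X x -> has_sup (near_values k x).
Proof.
move=> Xx; split; first by exists (v k x), x => //; rewrite /= euclxx invr_gt0.
by exists M => _ [y [Xy _] <-]; apply: le_trans (ler_norm _) (vM _ Xy).
Qed.

Let le_near_sup k x y : X x -> X y -> e x y < k.+1%:R^-1 -> v k y <= sup (near_values k x).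
Proof. by move=> Xx Xy xy; apply: sup_upper_bound; [exact: near_values_sup|exists y]. Qed.

Let sup_has_inf x : X x -> has_inf [set sup (near_values k x) | k in [set: nat]].
Proof.
move=> Xx; split; first by exists (sup (near_values 0 x)), 0%N.
exists (- M) => _ [k _ <-]; apply: le_trans (le_near_sup (y := x) Xx Xx _).
  by have := vM k Xx; rewrite ler_norml => /andP[].
by rewrite euclxx invr_gt0.
Qed.

Lemma upper_limit_ge x c : X x -> 0 < c -> exists N, exists2 s, 0 < s &
  forall k y, (N <= k)%N -> X y -> e x y < s -> v k y <= upper_limit v x + c.
Proof.
move=> Xx c0; have [_ [N _ <-] Nc] := inf_adherent c0 (sup_has_inf Xx).
exists N, N.+1%:R^-1; first by rewrite invr_gt0.
move=> k y Nk Xy xy; apply: le_trans (v_anti Nk Xy) _.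
by apply: le_trans (ltW Nc); exact: le_near_sup.
Qed.

Lemma upper_limit_adherent x k c : X x -> 0 < c ->
  exists y, [/\ X y, e x y < k.+1%:R^-1 & upper_limit v x - c < v k y].
Proof.
move=> Xx c0; have [_ [y [Xy xy] <-] yc] := sup_adherent c0 (near_values_sup k Xx).
exists y; split => //; apply: le_lt_trans yc; rewrite lerD2r.
by apply: ge_inf; [case: (sup_has_inf Xx)|exists k].
Qed.

Lemma upper_limit_bounded : bounded_by (upper_limit v) M.
Proof.
move=> x Xx; rewrite ler_norml; apply/andP; split.
  apply: lb_le_inf; first by case: (sup_has_inf Xx).
  move=> _ [k _ <-]; apply: le_trans (le_near_sup (y := x) Xx Xx _).
    by have := vM k Xx; rewrite ler_norml => /andP[].
  by rewrite euclxx invr_gt0.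
apply/ler_addgt0Pr => c c0; have [y [Xy _ yc]] := upper_limit_adherent 0 Xx c0.
by have := vM 0 Xy; rewrite ler_norml => /andP[_]; lra.
Qed.

Lemma upper_limit_usc x c : X x -> 0 < c -> exists2 s, 0 < s &
  forall y, X y -> e x y < s -> upper_limit v y <= upper_limit v x + c.
Proof.
move=> Xx c0; have c2 : 0 < c / 2 by lra.
have [N [s s0 sH]] := upper_limit_ge Xx c2.
exists (s / 2) => [|y Xy xy]; first by rewrite divr_gt0.
have s2 : 0 < s / 2 by lra.
have [N' _ N'H] := near_infty_natSinv_lt (PosNum s2).
have kN' := N'H _ (leq_maxr N N'); rewrite /= in kN'.
have [y' [Xy' yy' y'c]] := upper_limit_adherent (maxn N N') Xy c2.
have xy' : e x y' < s.
  apply: le_lt_trans (eucl_triangle y _ _) _.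
  by rewrite [ltRHS]splitr ltrD// (lt_trans yy').
by have := sH _ _ (leq_maxl N N') Xy' xy'; lra.
Qed.

End UpperLimit.

Definition usc_on (phi : 'rV[R]_n -> R) := forall x c, X x -> 0 < c -> exists2 s, 0 < s &
  forall y, X y -> e x y < s -> phi y <= phi x + c.

Lemma usc_on_argmax (phi : 'rV[R]_n -> R) M (E : set 'rV[R]_n) : usc_on phi -> bounded_by phi M ->
  E `<=` X -> E !=set0 ->
  (forall x, X x -> (forall r, 0 < r -> exists2 y, E y & e x y < r) -> E x) ->
  exists2 x, E x & forall y, E y -> phi y <= phi x.
Proof.
move=> usc phiM EX E0 Ecl.
have supE : has_sup [set phi y | y in E].
  split; first by have [y Ey] := E0; exists (phi y), y.
  by exists M => _ [y /EX Xy <-]; apply: le_trans (ler_norm _) (phiM _ Xy).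
have ex k : exists y, E y /\ sup [set phi y | y in E] - k.+1%:R^-1 < phi y.
  have k0 : 0 < k.+1%:R^-1 :> R by rewrite invr_gt0.
  by have [_ [y Ey <-] yk] := sup_adherent k0 supE; exists y.
have [ys ysP] := choice ex.
have [MX XM] := closure_bounded.
have [x xcl] := @bounded_cluster _ _ ys MX (fun k => XM _ (EX _ (proj1 (ysP k)))).
have Xx : X x.
  apply: (@closed_closure _ Omega); apply/closure_euclP => t t0.
  by have [k _ kt] := xcl t 0%N t0; exists (ys k) => //; apply: EX; case: (ysP k).
exists x.
  apply: Ecl => // r r0; have [k _ kt] := xcl r 0%N r0.
  by exists (ys k) => //; case: (ysP k).
move=> y Ey; apply: (@le_trans _ _ (sup [set phi y | y in E])).
  by apply: sup_upper_bound => //; exists y.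
apply: (@le_of_small _ _ _ 2) => // c c0 _.
have [s s0 sH] := usc x c Xx c0.
have [N _ NH] := near_infty_natSinv_lt (PosNum c0).
have [k Nk xk] := xcl s N s0.
have [Ek] := ysP k; have := sH _ (EX _ Ek) xk; have := NH k Nk; rewrite /=.
by move: (k.+1%:R^-1) => t; lra.
Qed.

(** * Continuity of the Perron envelope *)

Section PerronContinuity.
Variables (f g : 'rV[R]_n -> R) (K G : R).
Hypothesis fK : forall x, Omega x -> `|f x| <= K.
Hypothesis gG : forall x, boundary Omega x -> `|g x| <= G.
Hypothesis f_cont : forall x, Omega x -> forall c, 0 < c -> exists2 r, 0 < r &
  forall y, Omega y -> e x y < r -> `|f x - f y| < c.
Hypothesis g_cont : forall x, boundary Omega x -> forall c, 0 < c -> exists2 r, 0 < r &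
  forall y, boundary Omega y -> e x y < r -> `|g x - g y| < c.

Let fk k x := f x + k.+1%:R^-1.
Let uk k := perron (fk k) g.
Let u := perron f g.

Let inv_gt0 k : 0 < k.+1%:R^-1 :> R.
Proof. by rewrite invr_gt0. Qed.

Let inv_le1 k : k.+1%:R^-1 <= 1 :> R.
Proof. by rewrite invf_le1// ler1n. Qed.

Let fkK k x : Omega x -> `|fk k x| <= K + 1.
Proof.
move=> Ox; apply: le_trans (ler_normD _ _) _; rewrite lerD ?fK//.
by rewrite gtr0_norm ?inv_le1.
Qed.

Let uk_bounded : exists M, forall k, bounded_by (uk k) M.
Proof.
have [M H] := perron_bounded (K + 1) gG.
by exists M => k; have [] := H (fk k) (fkK k).
Qed.

Let u_bounded : exists M, bounded_by u M.
Proof. by have [M H] := perron_bounded K gG; exists M; have [] := H f fK. Qed.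

Let subsolutionsW (f1 f2 : 'rV[R]_n -> R) w : (forall x, Omega x -> f1 x <= f2 x) ->
  subsolutions f1 g w -> subsolutions f2 g w.
Proof.
move=> f12 [wM wsub wg]; split => // x Ox; apply: subsolW (wsub x Ox); exact: f12.
Qed.

Let uk_anti k l x : (k <= l)%N -> X x -> uk l x <= uk k x.
Proof.
move=> kl Xx; apply: (perron_ge gG (fkK k)) => //.
apply: subsolutionsW (perron_subsolution gG (fkK l)) => y _.
by rewrite lerD2l lef_pV2 ?posrE// ler_nat.
Qed.

Let u_le_uk k x : X x -> u x <= uk k x.
Proof.
move=> Xx; apply: (perron_ge gG (fkK k)) => //.
apply: subsolutionsW (perron_subsolution gG fK) => y _.
by rewrite lerDl ltW.
Qed.

Let U := upper_limit uk.

Let U_subsolution : subsolutions f g U.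
Proof.
have [M ukM] := uk_bounded.
split; first by exists M; exact: upper_limit_bounded.
- move=> x Ox; have Xx := sub_closure Ox.
  have [r r0 rH] := open_euclP Ox.
  have [N0 _ N0H] := near_infty_natSinv_lt (PosNum r0).
  (* The shift by [N0] keeps every approximating point inside [Omega]. *)
  have ex k := upper_limit_adherent ukM (k + N0) Xx (inv_gt0 (k + N0)).
  have [xs xsP] := choice ex.
  have Oxs k : Omega (xs k).
    apply: rH; have [_ xk _] := xsP k; apply: lt_trans xk _.
    by have := N0H _ (leq_addl k N0).
  apply: (@subsol_stability (fun k => uk (k + N0)) U xs (fun k => fk (k + N0) (xs k)) M) => //.
  + exact: upper_limit_bounded.
  + by move=> k; have [_ H _] := perron_subsolution gG (fkK (k + N0)); exact: H.
  + move=> c c0; have c2 : 0 < c / 2 by lra.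
    have [s s0 sH] := f_cont Ox c2.
    have m0 : 0 < Num.min s (c / 2) by rewrite lt_min s0.
    have [N _ NH] := near_infty_natSinv_lt (PosNum m0).
    exists N => k Nk; have [_ xk Uk] := xsP k.
    have := NH _ (leq_trans Nk (leq_addr N0 k)); rewrite /= lt_min => /andP[ks kc].
    have := sH _ (Oxs k) (lt_trans xk ks); rewrite ltr_norml => /andP[f1 f2].
    move: xk Uk ks kc; rewrite /fk -/U; move: ((k + N0).+1%:R^-1) => t xk Uk ks kc.
    by split; lra.
  + move=> z c Xz c0; have [N [s s0 sH]] := upper_limit_ge ukM uk_anti Xz c0.
    exists N, s => // k y Nk; apply: sH; exact: leq_trans Nk (leq_addr _ _).
- move=> z zb; apply/ler_addgt0Pr => c c0; have c2 : 0 < c / 2 by lra.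
  have [Xz nOz] := proj1 (boundaryP z) zb.
  have [r r0 rH] := boundary_upper_bound M (K + 1) (g_cont zb) zb c2.
  have [s s0 sH] := g_cont zb c2.
  have m0 : 0 < Num.min r s by rewrite lt_min r0.
  have [N _ NH] := near_infty_natSinv_lt (PosNum m0).
  have := NH N (leqnn N); rewrite /= lt_min => /andP[Nr Ns].
  have [y [Xy zy Uy]] := upper_limit_adherent ukM N Xz c2.
  have [_ usub ug] := perron_subsolution gG (fkK N).
  have [Oy|yb] := closure_cases Xy.
    have := rH (uk N) _ y (ukM N) ug Oy (usub y Oy) _ (lt_trans zy Nr).
    move=> /(_ (le_trans (ler_norm _) (fkK N Oy))); rewrite -/U in Uy; lra.
  have := sH y yb (lt_trans zy Ns); rewrite ltr_norml => /andP[g1 g2].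
  have := ug y yb; rewrite -/(uk N) -/U in Uy *; lra.
Qed.

(** [U] competes in the envelope [u], while every [uk k] lies above [u]. *)
Let uE x : X x -> u x = U x.
Proof.
move=> Xx; apply/eqP; rewrite eq_le; apply/andP; split; last first.
  by apply: (perron_ge gG fK) => //.
have [M ukM] := uk_bounded.
apply/ler_addgt0Pr => c c0; have [N [s s0 sH]] := upper_limit_ge ukM uk_anti Xx c0.
by apply: le_trans (u_le_uk N Xx) _; apply: sH; rewrite ?euclxx.
Qed.

Lemma perron_approximation x c : X x -> 0 < c -> exists2 gam, 0 < gam &
  perron (fun y => f y + gam) g x <= perron f g x + c.
Proof.
move=> Xx c0; have [M ukM] := uk_bounded.
have [N [s s0 sH]] := upper_limit_ge ukM uk_anti Xx c0.
exists N.+1%:R^-1 => //; rewrite -/u uE//; apply: (sH N) => //.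
by rewrite euclxx.
Qed.

Let u_usc : usc_on u.
Proof.
move=> x c Xx c0; have [M ukM] := uk_bounded.
have [s s0 sH] := upper_limit_usc ukM uk_anti Xx c0.
by exists s => // y Xy xy; rewrite !uE// sH.
Qed.

(** Minus the lower semicontinuous envelope of [u], as the upper limit of a constant sequence. *)
Let Nu := upper_limit (fun _ y => - u y).

Let Nu_bounded : exists M, bounded_by Nu M.
Proof.
have [M uM] := u_bounded; exists M.
by apply: upper_limit_bounded => k; exact: bounded_byN.
Qed.

Let Nu_ge x : X x -> - u x <= Nu x.
Proof.
move=> Xx; have [M uM] := u_bounded.
apply/ler_addgt0Pr => c c0.
have [N [s s0 sH]] := upper_limit_ge (fun k : nat => bounded_byN uM)
  (fun _ _ _ _ _ => lexx _) Xx c0.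
by apply: (sH N) => //; rewrite euclxx.
Qed.

Let Nu_usc : usc_on Nu.
Proof.
have [M uM] := u_bounded.
move=> x c Xx c0.
exact: (upper_limit_usc (fun k : nat => bounded_byN uM) (fun _ _ _ _ _ => lexx _) Xx c0).
Qed.

Let Nu_adherent x r c : X x -> 0 < r -> 0 < c ->
  exists y, [/\ X y, e x y < r & Nu x - c < - u y].
Proof.
move=> Xx r0 c0; have [M uM] := u_bounded.
have [N _ NH] := near_infty_natSinv_lt (PosNum r0).
have [y [Xy xy yc]] := upper_limit_adherent (fun k : nat => bounded_byN uM) N Xx c0.
by exists y; split => //; apply: lt_trans xy (NH N (leqnn N)).
Qed.

(** Since [u] is also a supersolution, [- u] is a subsolution for [- f], and the one-sided boundary
    estimate applies to it. *)
Let Nu_boundary z : boundary Omega z -> Nu z <= - g z.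
Proof.
move=> zb; apply/ler_addgt0Pr => c c0; have c2 : 0 < c / 2 by lra.
have [Xz nOz] := proj1 (boundaryP z) zb; have [M uM] := u_bounded.
have Ng_cont t : 0 < t -> exists2 r, 0 < r & forall y, boundary Omega y -> e z y < r ->
     `|- g z - - g y| < t.
  move=> /(g_cont zb)[r r0 rH]; exists r => // y yb zy.
  by rewrite -opprD normrN; exact: rH.
have [r r0 rH] := boundary_upper_bound (g := fun y => - g y) M K Ng_cont zb c2.
have [s s0 sH] := g_cont zb c2.
have m0 : 0 < Num.min r s by rewrite lt_min r0.
have [y [Xy]] := Nu_adherent Xz m0 c2; rewrite lt_min => /andP[zr zs] Nuy.
have [Oy|yb] := closure_cases Xy.
  have ug t : boundary Omega t -> - u t <= - g t.
    by move=> tb; rewrite lerN2 /u (perron_boundary gG fK tb) lexx.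
  have fKy : - f y <= K by have := fK Oy; rewrite ler_norml => /andP[]; lra.
  have := rH _ _ y (bounded_byN uM) ug Oy (perron_supersolution gG fK Oy) fKy zr.
  lra.
have := sH y yb zs; rewrite ltr_norml => /andP[g1 g2].
have uy : u y = g y by exact: (perron_boundary gG fK).
by move: Nuy; rewrite uy; lra.
Qed.

Let Nu_subsol x : Omega x -> subsol Nu (- f x) x.
Proof.
move=> Ox; have Xx := sub_closure Ox; have [M uM] := u_bounded.
have [r r0 rH] := open_euclP Ox.
have ex k : exists y, [/\ X y, e x y < Num.min r k.+1%:R^-1 & Nu x - k.+1%:R^-1 < - u y].
  by apply: Nu_adherent => //; rewrite ?lt_min ?r0 inv_gt0.
have [xs xsP] := choice ex.
have xsr k : e x (xs k) < r by have [_ + _] := xsP k; rewrite lt_min => /andP[].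
have Oxs k : Omega (xs k) by exact: rH.
apply: (@subsol_stability (fun _ y => - u y) Nu xs (fun k => - f (xs k)) M) => //.
- by move=> k; exact: bounded_byN.
- by apply: upper_limit_bounded => k; exact: bounded_byN.
- by move=> k; exact: (perron_supersolution gG fK).
- move=> c c0; have [s s0 sH] := f_cont Ox c0.
  have m0 : 0 < Num.min s c by rewrite lt_min s0.
  have [N _ NH] := near_infty_natSinv_lt (PosNum m0).
  exists N => k Nk; have [_ + Uk] := xsP k; rewrite lt_min => /andP[_ xk].
  have := NH _ Nk; rewrite /= lt_min => /andP[ks kc].
  have := sH _ (Oxs k) (lt_trans xk ks); rewrite ltr_norml => /andP[f1 f2].
  by move: xk Uk ks kc; move: (k.+1%:R^-1) => t xk Uk ks kc; split; lra.
- move=> z c Xz c0.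
  exact: (upper_limit_ge (fun k : nat => bounded_byN uM) (fun _ _ _ _ _ => lexx _) Xz c0).
Qed.

(* Let L = - Nu be the lower envelope of u. On the set E where u - L is maximal,
   take a minimum point x of L. All the slopes of u and L agree at x, and a
   descent direction would lead to a lower point of E; so u >= u(x) near x,
   whence L(x) >= u(x). *)
Let Nu_le x : X x -> Nu x <= - u x.
Proof.
move=> Xx; rewrite leNgt; apply/negP => gap0.
have [M uM] := u_bounded; have [M' NuM] := Nu_bounded.
pose phi y := u y + Nu y.
have phi_usc : usc_on phi.
  move=> y c Xy c0; have c2 : 0 < c / 2 by lra.
  have [s s0 sH] := u_usc Xy c2; have [t t0 tH] := Nu_usc Xy c2.
  exists (Num.min s t) => [|z Xz]; first by rewrite lt_min s0.
  rewrite lt_min => /andP[ys yt]; have := sH z Xz ys; have := tH z Xz yt.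
  by rewrite /phi; lra.
have phiM : bounded_by phi (M + M').
  by move=> y Xy; apply: le_trans (ler_normD _ _) _; rewrite lerD ?uM ?NuM.
have closed_level psi t y : usc_on psi -> X y ->
    (forall r, 0 < r -> exists2 z, [set z | X z /\ t <= psi z] z & e y z < r) -> t <= psi y.
  move=> usc Xy H; apply/ler_addgt0Pr => c c0; have [s s0 sH] := usc y c Xy c0.
  by have [z [Xz tz] yz] := H s s0; apply: le_trans tz (sH z Xz yz).
have [xh Xxh phi_max] : exists2 xh, X xh & forall y, X y -> phi y <= phi xh.
  apply: (usc_on_argmax phi_usc phiM) => //; first by exists x.
set m := phi xh in phi_max.
have m0 : 0 < m by apply: lt_le_trans (phi_max x Xx); rewrite /phi; lra.
pose E := [set y | X y /\ m <= phi y].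
have [xc [Xxc Exc] xc_max] : exists2 xc, E xc & forall y, E y -> Nu y <= Nu xc.
  apply: (usc_on_argmax Nu_usc NuM) => [y []//||y Xy Ey]; first by exists xh; split.
  by split => //; exact: (closed_level phi).
have phic : phi xc = m by apply/eqP; rewrite eq_le phi_max.
have Oxc : Omega xc.
  have [//|xb] := closure_cases Xxc; have := Nu_boundary xb.
  by move: m0; rewrite -phic /phi /u (perron_boundary gG fK xb); lra.
have phi_le y : X y -> u y - u xc <= - Nu y - - Nu xc.
  by move=> /phi_max; rewrite -phic /phi; lra.
have Sp : Splus Omega eps u xc <= Splus Omega eps (fun y => - Nu y) xc.
  apply: (Splus_le uM) => // y By; have [Xy _] := By.
  by apply: le_trans (phi_le y Xy) _; exact: (Splus_ge (bounded_byN NuM)).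
have Sm : Splus Omega eps Nu xc <= Splus Omega eps (fun y => - u y) xc.
  apply: (Splus_le NuM) => // y By; have [Xy _] := By.
  by have := Splus_ge (bounded_byN uM) Oxc By; have := phi_le y Xy; lra.
have [_ /(_ xc Oxc) usub _] := perron_subsolution gG fK.
have := Nu_subsol Oxc; move: usub; rewrite /subsol => usub Nusub.
set sig := Splus Omega eps (fun y => - u y) xc in Sm usub.
(* The four inequalities form a cycle in which [f] cancels, so all of them are equalities. *)
have NuS : Splus Omega eps Nu xc = sig by move: Sp Sm usub Nusub; rewrite /u; lra.
have sig0 : sig = 0.
  apply/eqP; rewrite eq_le (Splus_ge0 (bounded_byN uM))// andbT leNgt; apply/negP => sig0.
  have [r r0 rH] := rho_bounds Oxc.
  (* A nearly steepest ascent of [Nu] has [rho >= r], so it raises [Nu] by a fixed amount; as [u]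
     descends no faster than [sig], it nearly preserves [phi]. *)
  have steep c : 0 < c -> c <= sig / 2 -> exists y, [/\ X y, m - c * eps <= phi y &
      Nu xc + sig * r / 2 <= Nu y].
    move=> c0 cs.
    have : sig - c < Splus Omega eps Nu xc by rewrite NuS; lra.
    move=> /(Splus_gt NuM Oxc)[y By cy]; have [Xy dy] := By; exists y; split => //.
      have := Splus_ge (bounded_byN uM) Oxc By; rewrite -/sig.
      have : c * rho xc y <= c * eps by rewrite ler_wpM2l ?(ltW c0)// rho_le_eps.
      by rewrite -phic /phi; move: cy; lra.
    have : sig / 2 * r <= (sig - c) * rho xc y by rewrite ler_pM ?rH// ?(ltW r0)//; lra.
    by move: cy; lra.
  (* On this closed set [phi] attains its supremum, which is [m]; the maximizer then lies in [E]
     with a larger [Nu] than [xc]. *)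
  pose E' := [set y | X y /\ Nu xc + sig * r / 2 <= Nu y].
  have [ys [Xys Eys] ys_max] : exists2 ys, E' ys & forall y, E' y -> phi y <= phi ys.
    apply: (usc_on_argmax phi_usc phiM) => [y []//||y Xy Ey].
      by have [|y [Xy _ Ey]] := steep (sig / 2) _ (lexx _); [lra|exists y].
    by split => //; exact: (closed_level Nu).
  have Ey : E ys.
    split => //; apply: (@le_of_small _ _ _ (sig / 2 * eps)).
      by rewrite mulr_ge0 ?(ltW eps_gt0)//; lra.
    move=> c c0 c1; have cs : c * (sig / 2) <= sig / 2 by rewrite ler_piMl ?(ltW c1)//; lra.
    have cs0 : 0 < c * (sig / 2) by rewrite mulr_gt0//; lra.
    have [y [Xy my Ny]] := steep _ cs0 cs.
    by have := ys_max y (conj Xy Ny); rewrite mulrA; lra.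
  have := xc_max _ Ey; have : 0 < sig * r by rewrite mulr_gt0.
  by lra.
have [r r0 rH] := open_euclP Oxc.
suff : Nu xc <= - u xc by move: m0; rewrite -phic /phi; lra.
apply/ler_addgt0Pr => c c0.
have m0' : 0 < Num.min r eps by rewrite lt_min r0.
have [y [Xy]] := Nu_adherent Xxc m0' c0; rewrite lt_min => /andP[yr ye] yc.
have [dy _] := path_dist_near rH yr.
have := Splus_ge (bounded_byN uM) Oxc (conj Xy (le_trans dy (ltW ye))).
by rewrite -/sig sig0 mul0r; lra.
Qed.

Lemma perron_continuous x : X x -> forall c, 0 < c -> exists2 r, 0 < r &
  forall y, X y -> e x y < r -> `|perron f g x - perron f g y| < c.
Proof.
move=> Xx c c0; have c2 : 0 < c / 2 by lra.
have [s s0 sH] := u_usc Xx c2; have [t t0 tH] := Nu_usc Xx c2.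
exists (Num.min s t) => [|y Xy]; first by rewrite lt_min s0.
rewrite lt_min => /andP[xs xt]; have := sH y Xy xs; have := tH y Xy xt.
have := Nu_le Xx; have := Nu_ge Xy; rewrite -/u ltr_norml; lra.
Qed.

End PerronContinuity.

(** * Tug-of-war *)

Section Histories.
Variables (x0 : 'rV[R]_n).
Hypothesis Ox0 : Omega x0.
Implicit Types (h : seq 'rV[R]_n) (F : nat -> 'rV[R]_n -> R).

(* Unlike a partial game, a history may have just ended on the boundary. *)
Definition history h := path (fun x y => `[< Omega x /\ path_ball Omega x eps y >]) x0 h.

Lemma history_rcons h y : history h -> Omega (last x0 h) ->
  path_ball Omega (last x0 h) eps y -> history (rcons h y).
Proof. by move=> hh Oh By; rewrite /history rcons_path -/(history h) hh; apply/asboolP. Qed.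

Lemma history_partial_game h : history h -> Omega (last x0 h) ->
  partial_game Omega eps x0 h.
Proof.
move=> hh Oh; split => //; move: hh Oh; rewrite /history.
elim: h (x0) => //= y h IH x /andP[/asboolP[Ox By] hh] Oh.
rewrite IH// andbT; apply/asboolP; split => //.
by case: h hh Oh {IH} => //= z h /andP[/asboolP[]].
Qed.

Lemma history_closure h : history h -> X (last x0 h).
Proof.
elim/last_ind: h => [_|h y _]; first exact: sub_closure.
by rewrite /history rcons_path last_rcons => /andP[_ /asboolP[_ []]].
Qed.

Let pos h j := nth x0 (x0 :: h) j.

Lemma history_step h j : history h -> (j < size h)%N ->
  Omega (pos h j) /\ path_ball Omega (pos h j) eps (pos h j.+1).
Proof. by move=> /pathP hh jh; apply/asboolP; exact: hh. Qed.

(** The integrand sees the round as well as the position, so that the first [K] rounds can be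
    separated from the later ones. *)
Definition running_sum F h :=
  \sum_(j < size h) rho (pos h j) (pos h j.+1) * F j (pos h j).

Lemma position_rcons h y j : (j <= size h)%N -> pos (rcons h y) j = pos h j.
Proof. by move=> jh; rewrite /pos -rcons_cons nth_rcons /= ltnS jh. Qed.

Lemma running_sum_rcons F h y : running_sum F (rcons h y) =
  running_sum F h + rho (last x0 h) y * F (size h) (last x0 h).
Proof.
rewrite /running_sum size_rcons big_ord_recr /=; congr (_ + _).
  by apply: eq_bigr => j _; rewrite !position_rcons// ltnW.
rewrite position_rcons// {2}/pos -rcons_cons nth_rcons /= ltnn eqxx.
by rewrite /pos nth_last.
Qed.

Lemma running_sum_le F F' h : history h ->
  (forall j, (j < size h)%N -> Omega (pos h j) -> F j (pos h j) <= F' j (pos h j)) ->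
  running_sum F h <= running_sum F' h.
Proof.
move=> hh FF'; apply: ler_sum => j _; have [Oj [Xj _]] := history_step hh (ltn_ord j).
by rewrite ler_wpM2l ?FF'// ltW// rho_gt0.
Qed.

Lemma running_sumD F F' h :
  running_sum (fun j x => F j x + F' j x) h = running_sum F h + running_sum F' h.
Proof. by rewrite /running_sum -big_split; apply: eq_bigr => j _; rewrite mulrDr. Qed.

Lemma running_sumZ c F h :
  running_sum (fun j x => c * F j x) h = c * running_sum F h.
Proof. by rewrite /running_sum mulr_sumr; apply: eq_bigr => j _; rewrite mulrCA. Qed.

Lemma running_sum_ge0 F h : history h -> (forall j x, 0 <= F j x) -> 0 <= running_sum F h.
Proof.
move=> hh F0; apply: sumr_ge0 => j _; have [Oj [Xj _]] := history_step hh (ltn_ord j).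
by rewrite mulr_ge0// ltW// rho_gt0.
Qed.

Lemma history_rconsP h y : history (rcons h y) ->
  [/\ history h, Omega (last x0 h) & path_ball Omega (last x0 h) eps y].
Proof. by rewrite /history rcons_path => /andP[hh /asboolP[]]. Qed.

Lemma running_sum_early_le K h : history h ->
  running_sum (fun j _ => (j < K)%N%:R) h <= eps * K%:R.
Proof.
move=> hh; apply: (@le_trans _ _ (eps * (minn (size h) K)%:R)); last first.
  by rewrite ler_wpM2l ?(ltW eps_gt0)// ler_nat geq_minr.
elim/last_ind: h hh => [_|h y IH /history_rconsP[hh Oh [_ dy]]].
  by rewrite /running_sum big_ord0 min0n mulr0.
have -> : minn (size (rcons h y)) K = (minn (size h) K + (size h < K))%N.
  by rewrite size_rcons; case: (ltnP (size h) K); lia.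
rewrite running_sum_rcons natrD mulrDr lerD ?IH//.
by rewrite ler_wpM2r// rho_le_eps.
Qed.

Lemma rho_ge_eps x y : Omega x -> Omega y -> eps <= rho x y.
Proof. by move=> Ox Oy; rewrite /Defs.rho asboolT// le_max lexx orbT. Qed.

Lemma running_sum_late_ge K h : history h -> Omega (last x0 h) ->
  eps * ((size h)%:R - K%:R) <= running_sum (fun j _ => (K <= j)%N%:R) h.
Proof.
elim/last_ind: h => [_ _|h y IH hh].
  by rewrite /running_sum big_ord0 sub0r mulrN oppr_le0 mulr_ge0 ?(ltW eps_gt0).
have [hh' Oh _] := history_rconsP hh; rewrite last_rcons => Oy.
have [sK|Ks] := ltnP (size h) K.
  apply: (@le_trans _ _ 0); last exact: running_sum_ge0.
  by rewrite size_rcons mulr_ge0_le0 ?(ltW eps_gt0)// subr_le0 ler_nat.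
rewrite size_rcons running_sum_rcons Ks mulr1 -natr1 addrAC mulrDr mulr1.
by rewrite lerD ?IH// rho_ge_eps.
Qed.

(** The step that ends the game may be arbitrarily short; [K < size h] guarantees that the first [K]
    steps join interior points, each counting at least [eps]. *)
Lemma running_sum_early_ge K h : history h -> (K < size h)%N ->
  eps * K%:R <= running_sum (fun j _ => (j < K)%N%:R) h.
Proof.
have gen h' : history h' -> Omega (last x0 h') ->
    eps * (minn (size h') K)%:R <= running_sum (fun j _ => (j < K)%N%:R) h'.
  elim/last_ind: h' => [_ _|h' y IH hh].
    by rewrite /running_sum big_ord0 min0n mulr0.
  have [hh' Oh _] := history_rconsP hh; rewrite last_rcons => Oy.
  have -> : minn (size (rcons h' y)) K = (minn (size h') K + (size h' < K))%N.
    by rewrite size_rcons; case: (ltnP (size h') K); lia.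
  rewrite running_sum_rcons natrD mulrDr lerD ?IH//.
  by rewrite ler_wpM2r// rho_ge_eps.
case/lastP: h => // h y /history_rconsP[hh Oh [Xy _]]; rewrite size_rcons ltnS => Kh.
rewrite running_sum_rcons; have := gen h hh Oh; rewrite (minn_idPr Kh) => /le_trans; apply.
by rewrite lerDl mulr_ge0// ltW// rho_gt0.
Qed.

End Histories.

(** * Expectations over finitely many rounds *)

Section TwoStrategies.
Variables (x0 : 'rV[R]_n) (a b : 'rV[R]_n -> seq 'rV[R]_n -> 'rV[R]_n).
Hypothesis Ox0 : Omega x0.
Hypothesis a_strategy : strategy Omega eps a.
Hypothesis b_strategy : strategy Omega eps b.
Implicit Types (h : seq 'rV[R]_n) (phi psi : seq 'rV[R]_n -> R).

Local Notation history := (history x0).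
Local Notation p := (prob_I Omega eps a b x0).

Lemma moves_legal h : history h -> Omega (last x0 h) ->
  path_ball Omega (last x0 h) eps (a x0 h) /\ path_ball Omega (last x0 h) eps (b x0 h).
Proof.
by move=> hh Oh; have hp := history_partial_game Ox0 hh Oh; split; [exact: a_strategy|exact: b_strategy].
Qed.

Lemma history_moves h : history h -> Omega (last x0 h) ->
  history (rcons h (a x0 h)) /\ history (rcons h (b x0 h)).
Proof. by move=> hh Oh; have [Ba Bb] := moves_legal hh Oh; split; exact: history_rcons. Qed.

Lemma rho_moves_gt0 h : history h -> Omega (last x0 h) ->
  0 < rho (last x0 h) (a x0 h) /\ 0 < rho (last x0 h) (b x0 h).
Proof. by move=> hh Oh; have [[Xa _] [Xb _]] := moves_legal hh Oh; split; exact: rho_gt0. Qed.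

Lemma prob_I_bounds h : history h -> Omega (last x0 h) -> 0 <= p h <= 1.
Proof.
move=> hh Oh; have [ra rb] := rho_moves_gt0 hh Oh.
rewrite /prob_I/= divr_ge0 ?addr_ge0 ?(ltW ra) ?(ltW rb)//=.
by rewrite ler_pdivrMr ?addr_gt0// mul1r lerDr ltW.
Qed.

(* The expectation, started at history h, of phi at the end of the game if it
   ends within N steps, and of psi at the history reached after N steps if not. *)
Fixpoint expect phi psi N h : R :=
  if `[< Omega (last x0 h) >] then
    if N is N'.+1 then
      p h * expect phi psi N' (rcons h (a x0 h)) +
      (1 - p h) * expect phi psi N' (rcons h (b x0 h))
    else psi h
  else phi h.

Lemma expect_over phi psi N h : ~ Omega (last x0 h) -> expect phi psi N h = phi h.
Proof. by case: N => [|N] nOh /=; rewrite asboolF. Qed.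

Lemma expect_succ phi psi N h : Omega (last x0 h) -> expect phi psi N.+1 h =
  p h * expect phi psi N (rcons h (a x0 h)) +
  (1 - p h) * expect phi psi N (rcons h (b x0 h)).
Proof. by move=> Oh /=; rewrite asboolT. Qed.

Lemma expect_le phi phi' psi psi' N h : history h ->
  (forall k, history k -> ~ Omega (last x0 k) -> phi k <= phi' k) ->
  (forall k, history k -> Omega (last x0 k) -> size k = (size h + N)%N -> psi k <= psi' k) ->
  expect phi psi N h <= expect phi' psi' N h.
Proof.
move=> hh Hphi; elim: N h hh => [|N IH] h hh Hpsi.
  rewrite /=; case: asboolP => Oh; [apply: Hpsi => //|exact: Hphi].
  by rewrite addn0.
have [Oh|nOh] := pselect (Omega (last x0 h)); last first.
  by rewrite !expect_over//; exact: Hphi.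
have [ha hb] := history_moves hh Oh; have /andP[p0 p1] := prob_I_bounds hh Oh.
have Hp y k : history k -> Omega (last x0 k) -> size k = (size (rcons h y) + N)%N -> psi k <= psi' k.
  by rewrite size_rcons addSnnS; exact: Hpsi.
by rewrite !expect_succ// lerD// ler_wpM2l ?subr_ge0// IH//; exact: Hp.
Qed.

Lemma expectD phi phi' psi psi' N h :
  expect (fun k => phi k + phi' k) (fun k => psi k + psi' k) N h =
  expect phi psi N h + expect phi' psi' N h.
Proof.
elim: N h => [|N IH] h /=; case: asboolP => // _.
by rewrite !IH; ring.
Qed.

Lemma expectZ c phi psi N h :
  expect (fun k => c * phi k) (fun k => c * psi k) N h = c * expect phi psi N h.
Proof.
elim: N h => [|N IH] h /=; case: asboolP => // _.
by rewrite !IH; ring.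
Qed.

Lemma expect_cst c N h : expect (fun=> c) (fun=> c) N h = c.
Proof. by elim: N h => [|N IH] h /=; case: asboolP => // _; rewrite !IH; ring. Qed.

Lemma expect_split phi psi N h :
  expect phi psi N h = expect phi (fun=> 0) N h + expect (fun=> 0) psi N h.
Proof.
by elim: N h => [|N IH] h /=; case: asboolP => // _; rewrite ?addr0 ?add0r// !IH; ring.
Qed.

Lemma expect_ge0 phi psi N h : history h ->
  (forall k, history k -> 0 <= phi k) -> (forall k, history k -> 0 <= psi k) ->
  0 <= expect phi psi N h.
Proof.
move=> hh phi0 psi0; rewrite -(expect_cst 0 N h).
by apply: expect_le => // k hk *; [exact: phi0|exact: psi0].
Qed.

Lemma expect_supermartingale phi N h : history h ->
  (forall k, history k -> Omega (last x0 k) ->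
     p k * phi (rcons k (a x0 k)) + (1 - p k) * phi (rcons k (b x0 k)) <= phi k) ->
  expect phi phi N h <= phi h.
Proof.
move=> hh step; elim: N h hh => [|N IH] h hh; first by rewrite /=; case: asboolP.
have [Oh|nOh] := pselect (Omega (last x0 h)); last by rewrite expect_over.
have [ha hb] := history_moves hh Oh; have /andP[p0 p1] := prob_I_bounds hh Oh.
rewrite expect_succ//; apply: le_trans (step h hh Oh).
by rewrite lerD// ler_wpM2l ?subr_ge0// IH.
Qed.

Lemma expect_mono phi N N' h : history h -> (forall k, history k -> 0 <= phi k) ->
  (N <= N')%N -> expect phi (fun=> 0) N h <= expect phi (fun=> 0) N' h.
Proof.
move=> hh phi0; elim: N N' h hh => [|N IH] N' h hh NN'.
  rewrite [leLHS]/=; case: asboolP => Oh; first by apply: expect_ge0 => // *.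
  by rewrite expect_over.
case: N' NN' => // N' NN'; have [Oh|nOh] := pselect (Omega (last x0 h)); last first.
  by rewrite !expect_over.
have [ha hb] := history_moves hh Oh; have /andP[p0 p1] := prob_I_bounds hh Oh.
by rewrite !expect_succ// lerD// ler_wpM2l ?subr_ge0// IH.
Qed.

(** A game that ends after more than [K] rounds was still running after [K] rounds. *)
Lemma expect_late K M N h : history h -> (size h + M = K)%N ->
  expect (fun k => (K < size k)%N%:R) (fun=> 0) (M + N) h <= expect (fun=> 0) (fun=> 1) M h.
Proof.
elim: M h => [|M IH] h hh sK; have [Oh|nOh] := pselect (Omega (last x0 h)).
- rewrite [leRHS]/= asboolT//.
  apply: (@le_trans _ _ (expect (fun=> 1) (fun=> 1) N h)); last by rewrite expect_cst.
  by apply: expect_le => // k _ _ /=; case: (_ < _)%N; rewrite ?ler01 ?lexx.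
- by rewrite !expect_over//= -sK addn0 ltnn.
- have [ha hb] := history_moves hh Oh; have /andP[p0 p1] := prob_I_bounds hh Oh.
  rewrite addSn !expect_succ// lerD// ler_wpM2l ?subr_ge0// IH// size_rcons addSnnS//.
- by rewrite !expect_over//= -sK ltnNge leq_addr.
Qed.

End TwoStrategies.

(** * Near-optimal play for a supersolution *)

(** With [r] and [s] for the two values of [rho], the probabilities give the ascent [Sp * r] and the
    descent [Sm * s] weights proportional to [s] and [r], so both slopes are multiplied by
    [r * s / (r + s)], as is [eps * c]. The supersolution inequality then applies, and the tolerance
    costs at most [eps / 2 * eta] because [r] and [s] are at most [eps]. *)
Lemma one_step_mean (u : 'rV[R]_n -> R) M x y1 y2 c eta (p : R) : bounded_by u M -> Omega x ->
  path_ball Omega x eps y1 -> path_ball Omega x eps y2 -> 0 <= eta ->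
  subsol (fun y => - u y) (- c) x ->
  (Splus Omega eps (fun y => - u y) x - eta) * rho x y2 <= u x - u y2 ->
  p = rho x y2 / (rho x y1 + rho x y2) ->
  p * (u y1 + eps / 2 * (rho x y1 * c)) + (1 - p) * (u y2 + eps / 2 * (rho x y2 * c))
    <= u x + eps / 2 * eta.
Proof.
move=> uM Ox By1 By2 eta0 usup y2opt pE.
have [X1 d1] := By1; have [X2 d2] := By2.
have r1 : 0 < rho x y1 by exact: rho_gt0.
have r2 : 0 < rho x y2 by exact: rho_gt0.
have r1e := rho_le_eps d1; have r2e := rho_le_eps d2.
have y1le := Splus_ge uM Ox By1.
move: usup; rewrite /subsol oppfunK.
move: (Splus Omega eps u x) (Splus Omega eps (fun y => - u y) x) y1le y2opt => Sp Sm y1le y2opt usup.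
rewrite {}pE; move: (rho x y1) (rho x y2) r1 r2 r1e r2e y1le y2opt => r s r0 s0 re se y1le y2opt.
have rs0 : 0 < r + s by rewrite addr_gt0.
have -> : 1 - s / (r + s) = r / (r + s) by field; rewrite gt_eqF.
rewrite -(ler_pM2r rs0).
have -> : (s / (r + s) * (u y1 + eps / 2 * (r * c)) + r / (r + s) * (u y2 + eps / 2 * (s * c)))
   * (r + s) = s * u y1 + r * u y2 + eps * c * (r * s).
  by field; rewrite gt_eqF.
have e1 : s * (u y1 - u x) <= s * (Sp * r) by rewrite ler_wpM2l// ltW.
have e2 : r * ((Sm - eta) * s) <= r * (u x - u y2) by rewrite ler_wpM2l// ltW.
have S0 : Sp - Sm + eps * c <= 0 by lra.
have e3 : (Sp - Sm + eps * c) * (r * s) <= 0.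
  by rewrite mulr_le0_ge0// mulr_ge0// ltW.
have e4 : r * s <= eps * s by rewrite ler_wpM2r// ltW.
have e5 : r * s <= r * eps by rewrite ler_wpM2l// ltW.
have e6 : eta * (2 * (r * s)) <= eta * (eps * s + r * eps) by rewrite ler_wpM2l//; lra.
by move: e1 e2 e3 e6; lra.
Qed.

Lemma steepest_descent (u : 'rV[R]_n -> R) M : bounded_by u M ->
  exists pick : R -> 'rV[R]_n -> 'rV[R]_n, forall eta x, 0 < eta -> Omega x ->
    path_ball Omega x eps (pick eta x) /\
    (Splus Omega eps (fun y => - u y) x - eta) * rho x (pick eta x) <= u x - u (pick eta x).
Proof.
move=> uM.
have ex (q : R * 'rV[R]_n) : exists y, 0 < q.1 -> Omega q.2 ->
    path_ball Omega q.2 eps y /\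
    (Splus Omega eps (fun y => - u y) q.2 - q.1) * rho q.2 y <= u q.2 - u y.
  case: q => eta x /=; have [Ox|nOx] := pselect (Omega x); last by exists x.
  have [eta0|eta0] := ltP 0 eta; last by exists x.
  have /(Splus_gt (bounded_byN uM) Ox)[y By yS] :
      Splus Omega eps (fun y => - u y) x - eta < Splus Omega eps (fun y => - u y) x.
    by rewrite ltrBlDr ltrDl.
  by exists y => _ _; split => //; rewrite opprK (addrC (- u y)) in yS; exact: ltW.
have [pick pickP] := choice ex.
by exists (fun eta x => pick (eta, x)) => eta x; exact: (pickP (eta, x)).
Qed.

Section Minimizer.
Variables (f g u V : 'rV[R]_n -> R) (gam Kf G M del : R).
Hypothesis gam_ge0 : 0 <= gam.
Hypothesis del_gt0 : 0 < del.
Hypothesis Kf_ge0 : 0 <= Kf.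
Hypothesis fK : forall x, Omega x -> `|f x| <= Kf.
Hypothesis gG : forall x, boundary Omega x -> `|g x| <= G.
Hypothesis uM : bounded_by u M.
Hypothesis VM : bounded_by V M.
Hypothesis u_super : forall x, Omega x -> subsol (fun y => - u y) (- (f x + gam)) x.
Hypothesis V_super : forall x, Omega x -> subsol (fun y => - V y) (- (Kf + 1)) x.
Hypothesis gu : forall x, boundary Omega x -> g x <= u x.
Hypothesis gV : forall x, boundary Omega x -> g x <= V x.
Variables pick_u pick_V : R -> 'rV[R]_n -> 'rV[R]_n.
Hypothesis pick_uP : forall eta x, 0 < eta -> Omega x ->
  path_ball Omega x eps (pick_u eta x) /\
  (Splus Omega eps (fun y => - u y) x - eta) * rho x (pick_u eta x) <= u x - u (pick_u eta x).
Hypothesis pick_VP : forall eta x, 0 < eta -> Omega x ->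
  path_ball Omega x eps (pick_V eta x) /\
  (Splus Omega eps (fun y => - V y) x - eta) * rho x (pick_V eta x) <= V x - V (pick_V eta x).

(** Geometric error budget: [eps / 2 * eta k = err k - err k.+1], so the loss of each round is paid
    by the decrease of [err], and all rounds together lose at most [del]. *)
Let err k : R := del * 2^-1 ^+ k.
Let eta k : R := err k / eps.

Let err_gt0 k : 0 < err k.
Proof. by rewrite mulr_gt0// exprn_gt0// invr_gt0. Qed.

Let eta_gt0 k : 0 < eta k.
Proof. by rewrite divr_gt0. Qed.

Definition slow_strategy (x0 : 'rV[R]_n) (h : seq 'rV[R]_n) := pick_u (eta (size h)) (last x0 h).

(* After K rounds the player switches to the barrier V, which ends the game in
   bounded expected time whatever the opponent does. *)
Definition switching_strategy (K : nat) (x0 : 'rV[R]_n) (h : seq 'rV[R]_n) :=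
  if (size h < K)%N then slow_strategy x0 h else pick_V (eta (size h)) (last x0 h).

Lemma slow_strategyP : strategy Omega eps slow_strategy.
Proof.
move=> x0 h [Ox0 hh]; apply: (proj1 (pick_uP (eta_gt0 _) _)).
case/lastP: h hh => // h y; rewrite rcons_path last_rcons => /andP[_ /asboolP[]//].
Qed.

Lemma switching_strategyP K : strategy Omega eps (switching_strategy K).
Proof.
move=> x0 h hp; rewrite /switching_strategy; case: ifP => _; first exact: slow_strategyP.
apply: (proj1 (pick_VP (eta_gt0 _) _)); case: hp => Ox0.
by case/lastP: h => // h y; rewrite rcons_path last_rcons => /andP[_ /asboolP[]].
Qed.

Variable x0 : 'rV[R]_n.
Hypothesis Ox0 : Omega x0.
Variable K : nat.

Let M_ge0 : 0 <= M.
Proof. exact: le_trans (normr_ge0 _) (uM (sub_closure Ox0)). Qed.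

Definition outcome h := g (last x0 h) + eps / 2 * running_sum x0 (fun _ => f) h.

Let cost k x := if (k < K)%N then f x + gam else Kf + 1.

(** At [size h = K] the position was still reached by a move for [u], so [u] measures it. The
    barrier enters one round later, lowered by [2 * M] to lie below [u], so that the switch does not
    raise the potential. *)
Let base h := if (size h <= K)%N then u (last x0 h) else V (last x0 h) - 2 * M.

Definition potential h := base h + eps / 2 * running_sum x0 cost h + err (size h).

Let V_le_u x : X x -> V x - 2 * M <= u x.
Proof.
move=> Xx; have := uM Xx; have := VM Xx; rewrite !ler_norml => /andP[? ?] /andP[? ?]; lra.
Qed.

Variable a : 'rV[R]_n -> seq 'rV[R]_n -> 'rV[R]_n.
Hypothesis a_strategy : strategy Omega eps a.
Local Notation b := (switching_strategy K).
Local Notation history := (history x0).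
Local Notation p := (prob_I Omega eps a b x0).

Let b_strategy : strategy Omega eps b := @switching_strategyP K.

Lemma potential_supermartingale h : history h -> Omega (last x0 h) ->
  p h * potential (rcons h (a x0 h)) + (1 - p h) * potential (rcons h (b x0 h)) <= potential h.
Proof.
move=> hh Oh; have hp := history_partial_game Ox0 hh Oh.
have [Ba Bb] := moves_legal Ox0 a_strategy b_strategy hh Oh.
have /andP[p0 p1] := prob_I_bounds Ox0 a_strategy b_strategy hh Oh.
have errE : eps / 2 * eta (size h) = err (size h) - err (size h).+1.
  by rewrite /eta /err exprS; field; rewrite gt_eqF.
have Xh := sub_closure Oh.
have pE : p h = rho (last x0 h) (b x0 h) / (rho (last x0 h) (a x0 h) + rho (last x0 h) (b x0 h)) by [].
have key w : (forall y, base (rcons h y) <= w y) ->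
    p h * (w (a x0 h) + eps / 2 * (rho (last x0 h) (a x0 h) * cost (size h) (last x0 h))) +
    (1 - p h) * (w (b x0 h) + eps / 2 * (rho (last x0 h) (b x0 h) * cost (size h) (last x0 h)))
    <= base h + eps / 2 * eta (size h) ->
    p h * potential (rcons h (a x0 h)) + (1 - p h) * potential (rcons h (b x0 h)) <= potential h.
  move=> bw; rewrite errE /potential !running_sum_rcons !size_rcons => H.
  have bp : p h * base (rcons h (a x0 h)) <= p h * w (a x0 h) by rewrite ler_wpM2l.
  have bq : (1 - p h) * base (rcons h (b x0 h)) <= (1 - p h) * w (b x0 h).
    by rewrite ler_wpM2l// subr_ge0.
  by move: H bp bq; lra.
have [hK|Kh] := ltnP (size h) K.
  apply: (key u) => [y|]; first by rewrite /base size_rcons hK last_rcons.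
  have -> : cost (size h) (last x0 h) = f (last x0 h) + gam by rewrite /cost hK.
  rewrite /base (ltnW hK).
  apply: (one_step_mean uM _ _ _ _ _ _ pE) => //; [exact: ltW|exact: u_super|].
  by rewrite /switching_strategy hK; apply: (proj2 (pick_uP _ _)).
apply: (key (fun y => V y - 2 * M)) => [y|].
  by rewrite /base size_rcons leqNgt ltnS Kh last_rcons.
have bV : V (last x0 h) - 2 * M <= base h.
  by rewrite /base; case: ifP => // _; exact: V_le_u.
have -> : cost (size h) (last x0 h) = Kf + 1 by rewrite /cost (leq_gtF Kh).
have Vopt : (Splus Omega eps (fun y => - V y) (last x0 h) - eta (size h)) *
    rho (last x0 h) (b x0 h) <= V (last x0 h) - V (b x0 h).
  by rewrite /switching_strategy (leq_gtF Kh); exact: (proj2 (pick_VP _ _)).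
have := one_step_mean VM Oh Ba Bb (ltW (eta_gt0 _)) (V_super Oh) Vopt pE.
by move: bV; lra.
Qed.

Let early k (x : 'rV[R]_n) : R := (k < K)%N%:R.
Let late k (x : 'rV[R]_n) : R := (K <= k)%N%:R.

Let early_ge0 h : history h -> 0 <= running_sum x0 early h.
Proof. by move=> hh; apply: running_sum_ge0 => // j x; rewrite /early ler0n. Qed.

Let late_ge0 h : history h -> 0 <= running_sum x0 late h.
Proof. by move=> hh; apply: running_sum_ge0 => // j x; rewrite /late ler0n. Qed.

(** [base] is at least [- (3 * M)], and the running sum of [f] over the first [K] rounds is at least
    [- Kf * (eps * K)]. *)
Let defect := 3 * M + eps / 2 * (Kf * (eps * K%:R)).

Let defect_ge0 : 0 <= defect.
Proof.
by rewrite addr_ge0 ?mulr_ge0 ?ler0n ?(ltW eps_gt0)// invr_ge0.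
Qed.

Let eps2_gt0 : 0 < eps / 2.
Proof. by rewrite divr_gt0. Qed.

(** After the switch the cost [Kf + 1] is at least 1, so the potential of a game still running grows
    linearly with the number of rounds; as its mean stays bounded, the game has to end. *)
Lemma potential_ge h : history h ->
  eps / 2 * running_sum x0 late h <= potential h + defect.
Proof.
move=> hh; have Xh := history_closure Ox0 hh.
have cost_ge : - Kf * running_sum x0 early h + running_sum x0 late h <= running_sum x0 cost h.
  rewrite -running_sumZ -running_sumD; apply: running_sum_le => // j _ Oj.
  rewrite /early /late /cost; case: ltnP => _ /=.
    by rewrite mulr1 addr0; have := fK Oj; rewrite ler_norml; move: gam_ge0; lra.
  by rewrite mulr0 add0r lerDr.
have base_ge : - (3 * M) <= base h.
  rewrite /base; have := uM Xh; have := VM Xh; rewrite !ler_norml => /andP[? ?] /andP[? ?].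
  by case: ifP => _; move: M_ge0; lra.
have Kearly : Kf * running_sum x0 early h <= Kf * (eps * K%:R).
  by rewrite ler_wpM2l// running_sum_early_le.
have := err_gt0 (size h).
have : eps / 2 * (running_sum x0 late h - Kf * (eps * K%:R)) <= eps / 2 * running_sum x0 cost h.
  by rewrite ler_wpM2l ?(ltW eps2_gt0)//; lra.
rewrite /potential /defect; lra.
Qed.

(** A game that ends before the barrier enters loses nothing. Otherwise the switch costs [2 * M],
    but the surplus [gam] has been collected over [K] rounds with [rho >= eps]. *)
Lemma outcome_le h : history h -> ~ Omega (last x0 h) ->
  outcome h <= potential h + (2 * M - gam * eps ^+ 2 * K%:R / 2) * (K < size h)%N%:R.
Proof.
move=> hh nOh; have Xh := history_closure Ox0 hh.
have hb : boundary Omega (last x0 h) by exact/boundaryP.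
have e0 := err_gt0 (size h).
have costE : running_sum x0 (fun _ => f) h + gam * running_sum x0 early h <= running_sum x0 cost h.
  rewrite -running_sumZ -running_sumD; apply: running_sum_le => // j _ Oj.
  rewrite /early /cost; case: ltnP => _ /=; first by rewrite mulr1.
  by rewrite mulr0 addr0; have := fK Oj; rewrite ler_norml; lra.
have costE' := ler_wpM2l (ltW eps2_gt0) costE.
rewrite /outcome /potential /base; case: (leqP (size h) K) => hK /=.
  have : 0 <= eps / 2 * (gam * running_sum x0 early h).
    by rewrite mulr_ge0 ?(ltW eps2_gt0)// mulr_ge0// early_ge0.
  by rewrite mulr0 addr0; have := gu hb; lra.
have := running_sum_early_ge hh hK; rewrite -/early => Ke.
have : eps / 2 * (gam * (eps * K%:R)) <= eps / 2 * (gam * running_sum x0 early h).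
  by rewrite ler_wpM2l ?(ltW eps2_gt0)// ler_wpM2l.
have -> : gam * eps ^+ 2 * K%:R / 2 = eps / 2 * (gam * (eps * K%:R)) by field.
by rewrite mulr1; have := gV hb; lra.
Qed.

Local Notation stopped phi N := (expect x0 a b phi (fun=> 0) N [::]).
Local Notation alive psi N := (expect x0 a b (fun=> 0) psi N [::]).

Let h0 : history [::]. Proof. by []. Qed.

Lemma potential_mean N : stopped potential N + alive potential N <= u x0 + del.
Proof.
rewrite -expect_split.
apply: le_trans (expect_supermartingale Ox0 a_strategy b_strategy N h0 _) _.
  exact: potential_supermartingale.
by rewrite /potential /base /running_sum /= big_ord0 mulr0 addr0 /err expr0 mulr1.
Qed.

Lemma stopped_le1 N : 0 <= stopped (fun=> 1) N <= 1.
Proof.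
rewrite expect_ge0//=; last first.
rewrite -[leRHS](expect_cst x0 a b 1 N [::]).
by apply: expect_le.
Qed.

Lemma alive_le1 N : 0 <= alive (fun=> 1) N <= 1.
Proof.
rewrite expect_ge0//=; last first.
rewrite -[leRHS](expect_cst x0 a b 1 N [::]).
by apply: expect_le.
Qed.

Lemma stopped_potential_ge N : - defect <= stopped potential N.
Proof.
have /andP[s0 s1] := stopped_le1 N.
apply: (@le_trans _ _ (stopped (fun=> - defect * 1) N)).
  have <- : expect x0 a b (fun=> - defect * 1) (fun=> - defect * 0) N [::] = stopped (fun=> - defect * 1) N.
    by congr expect; apply/funext => ?; rewrite mulr0.
  rewrite expectZ; have := defect_ge0; nra.
apply: expect_le => // k hk _; rewrite mulr1 -subr_ge0 opprK.
apply: le_trans (potential_ge hk); by rewrite mulr_ge0 ?(ltW eps2_gt0)// late_ge0.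
Qed.

(** An inequality of Markov type for the potential: the probability of still playing decays like
    [1 / N]. *)
Lemma alive_bound N :
  (eps ^+ 2 / 2 * (N%:R - K%:R)) * alive (fun=> 1) N <= u x0 + del + 2 * defect.
Proof.
have /andP[r0 r1] := alive_le1 N.
have := potential_mean N; have := stopped_potential_ge N.
have : (eps ^+ 2 / 2 * (N%:R - K%:R) - defect) * alive (fun=> 1) N <= alive potential N.
  rewrite -expectZ; apply: expect_le => // [k hk _|k hk Ok /= sk]; first by rewrite mulr0.
  have := running_sum_late_ge K hk Ok; rewrite sk add0n -/late => lk.
  have := ler_wpM2l (ltW eps2_gt0) lk; have := potential_ge hk.
  by rewrite mulr1 expr2; lra.
have : defect * alive (fun=> 1) N <= defect by rewrite ler_piMr.
by rewrite mulrBl; lra.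
Qed.

Lemma outcome_mean N : stopped outcome N <= u x0 + del +
  (2 * M - gam * eps ^+ 2 * K%:R / 2) * stopped (fun k => (K < size k)%N%:R) N +
  defect * alive (fun=> 1) N.
Proof.
have := potential_mean N.
have : - defect * alive (fun=> 1) N <= alive potential N.
  rewrite -expectZ; apply: expect_le => // [k hk _|k hk Ok /= sk]; first by rewrite mulr0.
  rewrite mulr1 -subr_ge0 opprK; apply: le_trans (potential_ge hk).
  by rewrite mulr_ge0 ?(ltW eps2_gt0)// late_ge0.
have : stopped outcome N <= stopped potential N +
    (2 * M - gam * eps ^+ 2 * K%:R / 2) * stopped (fun k => (K < size k)%N%:R) N.
  rewrite -expectZ -expectD; apply: expect_le => // [k hk nOk|k hk Ok _].
    exact: outcome_le.
  by rewrite mulr0 addr0.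
by lra.
Qed.

(** This makes the expected payoff defined and finite: the absolute outcome is at most a constant
    plus a multiple of the potential, whose mean is bounded. *)
Lemma outcome_abs_mean : exists C, forall N, stopped (fun k => `|outcome k|) N <= C.
Proof.
pose c1 := `|G| + eps / 2 * (Kf * (eps * K%:R)).
have c10 : 0 <= c1 by rewrite addr_ge0// ?mulr_ge0 ?ler0n ?(ltW eps_gt0)// invr_ge0.
have abs_le k : history k -> ~ Omega (last x0 k) ->
    `|outcome k| <= c1 + Kf * (potential k + defect).
  move=> hk nOk; have kb : boundary Omega (last x0 k).
    by apply/boundaryP; split => //; exact: history_closure.
  have fle : `|running_sum x0 (fun _ => f) k| <= Kf * (eps * K%:R + running_sum x0 late k).
    apply: (@le_trans _ _ (Kf * (running_sum x0 early k + running_sum x0 late k))); last first.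
      by rewrite ler_wpM2l// lerD2r running_sum_early_le.
    rewrite -running_sumD -running_sumZ ler_norml -mulN1r -running_sumZ.
    apply/andP; split; apply: running_sum_le => // j _ Oj; rewrite /early /late;
      have := fK Oj; rewrite ler_norml => /andP[f1 f2]; case: ltnP => _ /=; lra.
  rewrite /outcome; apply: le_trans (ler_normD _ _) _.
  rewrite normrM (ger0_norm (ltW eps2_gt0)).
  have := ler_wpM2l (ltW eps2_gt0) fle.
  have := ler_wpM2l Kf_ge0 (potential_ge hk).
  have := gG kb; have := ler_norm G; rewrite /c1; lra.
exists (c1 + Kf * (`|u x0 + del| + 2 * defect)) => N.
have /andP[s0 s1] := stopped_le1 N; have /andP[r0 r1] := alive_le1 N.
have : stopped (fun k => `|outcome k|) N <=
    c1 * stopped (fun=> 1) N + Kf * (stopped potential N + defect * stopped (fun=> 1) N).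
  rewrite -!expectZ -!expectD -expectZ -expectD.
  apply: expect_le => // [k hk nOk|k hk Ok _].
    by rewrite !mulr1; exact: abs_le.
  by rewrite !mulr0 !addr0 mulr0.
have : - defect * alive (fun=> 1) N <= alive potential N.
  rewrite -expectZ; apply: expect_le => // [k hk _|k hk Ok /= sk]; first by rewrite mulr0.
  rewrite mulr1 -subr_ge0 opprK; apply: le_trans (potential_ge hk).
  by rewrite mulr_ge0 ?(ltW eps2_gt0)// late_ge0.
have := potential_mean N; have := ler_norm (u x0 + del).
have : c1 * stopped (fun=> 1) N <= c1 by rewrite ler_piMr.
have ds : defect * stopped (fun=> 1) N <= defect by rewrite ler_piMr.
have da : defect * alive (fun=> 1) N <= defect by rewrite ler_piMr.
move=> h1 h2 h3 h4 h5.
have : Kf * (stopped potential N + defect * stopped (fun=> 1) N) <=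
    Kf * (`|u x0 + del| + 2 * defect) by rewrite ler_wpM2l//; lra.
by lra.
Qed.

Lemma outcome_mean_limit c : 0 < c -> exists N0, forall N, (N0 <= N)%N ->
  alive (fun=> 1) N <= c /\
  stopped outcome N <= u x0 + del +
    (2 * M - gam * eps ^+ 2 * K%:R / 2) * stopped (fun k => (K < size k)%N%:R) N + c.
Proof.
move=> c0; pose A := `|u x0 + del| + 2 * defect + 1.
have A0 : 0 < A by rewrite ltr_wpDl// addr_ge0// mulr_ge0.
have e20 : 0 < eps ^+ 2 / 2 by rewrite divr_gt0// exprn_gt0.
have d10 : 0 < 1 + defect by rewrite ltr_pwDl.
(* After [T] rounds beyond [K], the probability of still playing times [1 + defect] is at most [c];
   this covers both conclusions at once. *)
pose T := (1 + defect) * A / c / (eps ^+ 2 / 2).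
have T0 : 0 < T by rewrite !divr_gt0// mulr_gt0.
exists (K + Num.bound T)%N => N NN.
have TN : T <= N%:R - K%:R.
  rewrite lerBrDl; have := archi_boundP (ltW T0).
  have : (K + Num.bound T)%:R <= N%:R :> R by rewrite ler_nat.
  by rewrite natrD; lra.
have /andP[r0 r1] := alive_le1 N.
have S : (1 + defect) * alive (fun=> 1) N <= c.
  have cA : 0 < A / c by rewrite divr_gt0.
  rewrite -(ler_pM2l cA) divfK ?gt_eqF//.
  apply: (@le_trans _ _ (eps ^+ 2 / 2 * (N%:R - K%:R) * alive (fun=> 1) N)); last first.
    by apply: le_trans (alive_bound N) _; rewrite /A; have := ler_norm (u x0 + del); lra.
  rewrite mulrA ler_wpM2r//.
  have -> : A / c * (1 + defect) = eps ^+ 2 / 2 * T by rewrite /T; field; rewrite !gt_eqF.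
  by rewrite ler_wpM2l// ltW.
have : 0 <= defect * alive (fun=> 1) N by rewrite mulr_ge0.
have := outcome_mean N.
by split; lra.
Qed.

End Minimizer.

(** * Expected payoffs as sums over outcomes *)

Fixpoint words N : seq (seq bool) :=
  if N is N'.+1 then
    [::] :: [seq true :: w | w <- words N'] ++ [seq false :: w | w <- words N']
  else [:: [::]].

Lemma mem_words N w : (w \in words N) = (size w <= N)%N.
Proof.
elim: N w => [|N IH] [|c w] //=.
rewrite inE /= mem_cat; case: c; rewrite ?ltnS -IH.
  rewrite mem_map; last by move=> ? ? [].
  by rewrite orbC; case: mapP => // -[? _].
rewrite orbC mem_map; last by move=> ? ? [].
by rewrite orbC; case: mapP => // -[? _].
Qed.

Lemma words_uniq N : uniq (words N).
Proof.
elim: N => //= N IH; rewrite mem_cat negb_or cat_uniq.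
have nt (c : bool) : [::] \notin [seq c :: w | w <- words N] by apply/mapP => -[].
rewrite !nt !map_inj_uniq ?IH ?andbT//=; try by move=> ? ? [].
by apply/hasPn => _ /mapP[w _ ->]; apply/mapP => -[].
Qed.

Section Expectation.
Variables (x0 : 'rV[R]_n) (a b : 'rV[R]_n -> seq 'rV[R]_n -> 'rV[R]_n).
Hypothesis Ox0 : Omega x0.
Hypothesis a_strategy : strategy Omega eps a.
Hypothesis b_strategy : strategy Omega eps b.
Implicit Types (h : seq 'rV[R]_n) (phi psi : seq 'rV[R]_n -> R) (w : seq bool).

Local Notation history := (history x0).
Local Notation pprob := (play_prob Omega eps a b x0).
Local Notation play := (play a b x0).
Local Notation stopped phi N := (expect x0 a b phi (fun=> 0) N [::]).

(** [terminal] by recursion from an arbitrary history, matching the recursion of [expect]. *)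
Fixpoint ends h w : Prop :=
  if w is c :: w' then
    Omega (last x0 h) /\ ends (rcons h (if c then a x0 h else b x0 h)) w'
  else ~ Omega (last x0 h).

Lemma expect_words phi N h : expect x0 a b phi (fun=> 0) N h =
  \sum_(w <- words N) if `[< ends h w >] then pprob h w * phi (play h w) else 0.
Proof.
elim: N h => [|N IH] h.
  rewrite big_seq1 /= mul1r; case: asboolP => Oh; last by rewrite asboolT.
  by rewrite asboolF// => /(_ Oh).
rewrite /= big_cons big_cat !big_map /=; case: asboolP => Oh; last first.
  rewrite asboolT// mul1r !big1 ?addr0// => w _; rewrite asboolF//; by case.
rewrite asboolF ?add0r; last by move=> /(_ Oh).
rewrite !IH !mulr_sumr; congr (_ + _); apply: eq_bigr => w _.
  have -> : `[< Omega (last x0 h) /\ ends (rcons h (a x0 h)) w >] = `[< ends (rcons h (a x0 h)) w >].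
    by apply: asbool_equiv_eq; split => [[]|].
  by case: asboolP; rewrite ?mulr0// mulrA.
have -> : `[< Omega (last x0 h) /\ ends (rcons h (b x0 h)) w >] = `[< ends (rcons h (b x0 h)) w >].
  by apply: asbool_equiv_eq; split => [[]|].
by case: asboolP; rewrite ?mulr0// mulrA.
Qed.

Lemma size_play h w : size (play h w) = (size h + size w)%N.
Proof. by elim: w h => [|c w IH] h /=; rewrite ?addn0// IH size_rcons addSnnS. Qed.

Lemma nth_play h w j : (j <= size h)%N -> nth x0 (x0 :: play h w) j = nth x0 (x0 :: h) j.
Proof.
elim: w h => [//|c w IH] h jh /=; rewrite IH ?size_rcons ?leqW//.
by rewrite -rcons_cons nth_rcons /= ltnS jh.
Qed.

Lemma history_move h (c : bool) : history h -> Omega (last x0 h) ->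
  history (rcons h (if c then a x0 h else b x0 h)).
Proof.
by move=> hh Oh; have [? ?] := history_moves Ox0 a_strategy b_strategy hh Oh; case: c.
Qed.

Lemma terminal_ends w : terminal Omega a b x0 w <-> ends [::] w.
Proof.
suff gen h : history h ->
    ((forall j, (j < size w)%N -> Omega (nth x0 (x0 :: play h w) (size h + j))) /\
     boundary Omega (nth x0 (x0 :: play h w) (size h + size w))) <-> ends h w.
  exact: (gen [::]).
elim: w h => [|c w IH] h hh.
  rewrite /= addn0 nth_last boundaryP; split => [[_ []]//|nOh].
  by split => //; split => //; exact: (history_closure Ox0 hh).
have nthl : nth x0 (x0 :: play h (c :: w)) (size h) = last x0 h by rewrite nth_play// nth_last.
have E j : (size h + j.+1)%N = (size (rcons h (if c then a x0 h else b x0 h)) + j)%N.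
  by rewrite size_rcons addSnnS.
split=> [[HO Hb]|[Oh /(IH _ (history_move c hh Oh))[HO Hb]]].
  have Oh : Omega (last x0 h) by rewrite -nthl -[size h]addn0; exact: HO.
  split => //; apply/(IH _ (history_move c hh Oh)); split.
    by move=> j jw; rewrite -E; exact: HO.
  by rewrite -E.
split; last by rewrite E.
by case=> [_|j jw]; [rewrite addn0 nthl|rewrite E; exact: HO].
Qed.

Lemma play_prob_ge0 h w : history h -> ends h w -> 0 <= pprob h w.
Proof.
elim: w h => [//|c w IH] h hh /= [Oh ew].
have /andP[p0 p1] := prob_I_bounds Ox0 a_strategy b_strategy hh Oh.
by rewrite mulr_ge0 ?IH//; [case: c ew => // _; rewrite subr_ge0|exact: history_move].
Qed.

(* The words ending the game within N rounds exhaust the terminal ones. *)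
Lemma esum_terminal phi : (forall h, 0 <= phi h) ->
  \esum_(w in terminal Omega a b x0) (pprob [::] w * phi (play [::] w))%:E =
  ereal_sup (range (fun N => (stopped phi N)%:E)).
Proof.
move=> phi0; apply/eqP; rewrite eq_le; apply/andP; split; last first.
  apply: ge_ereal_sup => _ [N _ <-]; apply: esum_ge.
  pose r := [seq w <- words N | `[< ends [::] w >]].
  exists [set` r].
    by split; [exact: finite_seq|move=> w /=; rewrite mem_filter => /andP[/asboolP/terminal_ends]].
  rewrite -fsbig_seq ?filter_uniq ?words_uniq// big_filter sumEFin lee_fin.
  by rewrite expect_words -big_mkcond lexx.
apply: ge_ereal_sup => _ [A [finA AT] <-].
pose N := \max_(w <- finmap.enum_fset (fset_set A)) size w.
pose r := [seq w <- words N | `[< ends [::] w >]].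
apply: (@le_trans _ _ (stopped phi N)%:E); last by apply: ereal_sup_ubound; exists N.
rewrite expect_words -big_mkcond -big_filter -/r -sumEFin [leRHS]fsbig_seq ?filter_uniq ?words_uniq//.
apply: lee_fsum_nneg_subset => //.
  move=> w; rewrite inE => Aw; rewrite inE /= mem_filter mem_words; apply/andP; split.
    by apply/asboolP/terminal_ends/AT.
  rewrite /N (big_rem w) /= ?leq_maxl//.
  by rewrite in_fset_set// inE.
move=> w; rewrite inE => /andP[_]; rewrite inE /= mem_filter => /andP[/asboolP ew _].
by rewrite lee_fin mulr_ge0// play_prob_ge0.
Qed.

Lemma terminates_asE :
  terminates_as Omega eps a b x0 <-> ereal_sup (range (fun N => (stopped (fun=> 1) N)%:E)) = 1%:E.
Proof.
rewrite /terminates_as -esum_terminal//.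
by under eq_esum do rewrite -[play_prob _ _ _ _ _ _ _]mulr1.
Qed.

Lemma payoffE f g w : payoff Omega eps f g a b x0 w = outcome f g x0 (play [::] w).
Proof.
rewrite /payoff /outcome /running_sum.
have -> : last x0 (play [::] w) = nth x0 (x0 :: play [::] w) (size w).
  by rewrite -[size w](size_play [::]) (nth_last x0 (x0 :: _)).
by rewrite size_play add0n big_add1 big_mkord.
Qed.

Lemma mean_posE f g : mean_pos Omega eps f g a b x0 =
  ereal_sup (range (fun N => (stopped (fun h => Num.max (outcome f g x0 h) 0) N)%:E)).
Proof.
rewrite /mean_pos -esum_terminal; last by move=> h; rewrite le_max lexx orbT.
apply: eq_esum => w /terminal_ends ew; rewrite funeposE /weighted_payoff payoffE.
by rewrite -EFin_max maxr_pMr ?mulr0// play_prob_ge0.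
Qed.

Lemma mean_negE f g : mean_neg Omega eps f g a b x0 =
  ereal_sup (range (fun N => (stopped (fun h => Num.max (- outcome f g x0 h) 0) N)%:E)).
Proof.
rewrite /mean_neg -esum_terminal; last by move=> h; rewrite le_max lexx orbT.
apply: eq_esum => w /terminal_ends ew; rewrite funenegE /weighted_payoff payoffE.
by rewrite -EFinN -EFin_max maxr_pMr ?mulr0 ?mulrN// play_prob_ge0.
Qed.

(** Exchanging the strategies turns [p] into [1 - p]. *)
Lemma expect_swap phi psi N h : history h ->
  expect x0 a b phi psi N h = expect x0 b a phi psi N h.
Proof.
elim: N h => [//|N IH] h hh /=; case: asboolP => // Oh.
have [ha hb] := history_moves Ox0 a_strategy b_strategy hh Oh.
have [ra rb] := rho_moves_gt0 Ox0 a_strategy b_strategy hh Oh.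
rewrite !IH// addrC /prob_I /=; congr (_ * _ + _ * _); field; rewrite gt_eqF ?addr_gt0//.
Qed.

End Expectation.

(** * Exchanging the players *)

Section Payoffs.
Variables (f g : 'rV[R]_n -> R).
Local Notation Nf := (fun y => - f y).
Local Notation Ng := (fun y => - g y).

Lemma outcomeN x0 h : outcome Nf Ng x0 h = - outcome f g x0 h.
Proof.
rewrite /outcome opprD -mulrN; congr (_ + _ * _).
by rewrite /running_sum -sumrN; apply: eq_bigr => j _; rewrite mulrN.
Qed.

(** The conventions +oo for [F_II] and -oo for [F_I] are mirror images, so the undefined cases match
    as well. *)
Lemma F_II_mirror x0 a b : Omega x0 -> strategy Omega eps a -> strategy Omega eps b ->
  F_II Omega eps f g a b x0 = (- F_I Omega eps Nf Ng b a x0)%E.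
Proof.
move=> Ox0 sa sb.
have swap phi : (fun N => (expect x0 a b phi (fun=> 0) N [::])%:E) =
    (fun N => (expect x0 b a phi (fun=> 0) N [::])%:E).
  by apply/funext => N; rewrite expect_swap.
have PQ : mean_pos Omega eps f g a b x0 = mean_neg Omega eps Nf Ng b a x0.
  have maxE : (fun h => Num.max (outcome f g x0 h) 0) =
      (fun h => Num.max (- outcome Nf Ng x0 h) 0).
    by apply/funext => h; rewrite outcomeN opprK.
  by rewrite mean_posE// mean_negE// swap maxE.
have QP : mean_neg Omega eps f g a b x0 = mean_pos Omega eps Nf Ng b a x0.
  have maxE : (fun h => Num.max (- outcome f g x0 h) 0) =
      (fun h => Num.max (outcome Nf Ng x0 h) 0).
    by apply/funext => h; rewrite outcomeN.
  by rewrite mean_posE// mean_negE// swap maxE.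
have T : terminates_as Omega eps a b x0 <-> terminates_as Omega eps b a x0.
  by rewrite !terminates_asE// swap.
have D : payoff_mean_defined Omega eps f g a b x0 <-> payoff_mean_defined Omega eps Nf Ng b a x0.
  rewrite /payoff_mean_defined T PQ QP.
  by split => -[? H]; split => // -[? ?]; exact: H.
rewrite /F_II /F_I (asbool_equiv_eq D); case: asboolP => // -[_].
rewrite PQ QP.
have : (0 <= mean_neg Omega eps Nf Ng b a x0)%E by apply: esum_ge0 => w _; exact: funeneg_ge0.
have : (0 <= mean_pos Omega eps Nf Ng b a x0)%E by apply: esum_ge0 => w _; exact: funepos_ge0.
(* The difference can be negated termwise because [payoff_mean_defined] excludes two infinite
   parts. *)
move: (mean_pos _ _ _ _ _ _ _) (mean_neg _ _ _ _ _ _ _) => [p| |] [q| |] // _ _ H.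
- by rewrite -!EFinB -EFinN opprB.
- by exfalso; exact: H.
Qed.

Lemma value_II_mirror x : value_II Omega eps f g x = (- value_I Omega eps Nf Ng x)%E.
Proof.
rewrite /value_II /value_I; case: asboolP => [Ox|_]; last by rewrite EFinN oppeK.
rewrite -ereal_infN; congr ereal_inf; rewrite [RHS]image_comp.
apply: eq_imagel => b sb /=; rewrite -ereal_supN; congr ereal_sup.
by rewrite [RHS]image_comp; apply: eq_imagel => a sa /=; exact: F_II_mirror.
Qed.

End Payoffs.

(** * Bounds for the values *)

Lemma expect_agree x0 a b b' phi psi N h :
  (forall k, (size k < size h + N)%N -> b x0 k = b' x0 k) ->
  expect x0 a b phi psi N h = expect x0 a b' phi psi N h.
Proof.
elim: N h => [//|N IH] h bb' /=; case: asboolP => // _.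
have E : b x0 h = b' x0 h by apply: bb'; rewrite -[ltnLHS]addn0 ltn_add2l.
have IH' m : expect x0 a b phi psi N (rcons h m) = expect x0 a b' phi psi N (rcons h m).
  by apply: IH => k; rewrite size_rcons addSnnS; exact: bb'.
by rewrite !IH' /prob_I E.
Qed.

(** The first bound makes both parts of the mean finite, the second gives almost sure termination.
    The positive part is nearly attained at a finite horizon, where it is at most the truncated mean
    outcome plus the negative part. *)
Lemma mean_le f g x0 a b B C : Omega x0 ->
  strategy Omega eps a -> strategy Omega eps b ->
  (forall N, expect x0 a b (fun h => `|outcome f g x0 h|) (fun=> 0) N [::] <= C) ->
  (forall c, 0 < c -> exists N, 1 - c <= expect x0 a b (fun=> 1) (fun=> 0) N [::]) ->
  (forall c, 0 < c -> exists N0, forall N, (N0 <= N)%N ->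
     expect x0 a b (outcome f g x0) (fun=> 0) N [::] <= B + c) ->
  (F_I Omega eps f g a b x0 <= B%:E)%E /\ (F_II Omega eps f g a b x0 <= B%:E)%E.
Proof.
move=> Ox0 sa sb absC one outB.
pose st phi N := expect x0 a b phi (fun=> 0) N [::].
have st_le phi phi' N : (forall k, phi k <= phi' k) -> st phi N <= st phi' N.
  by move=> H; apply: (expect_le Ox0 sa sb).
have T : terminates_as Omega eps a b x0.
  apply/(terminates_asE Ox0 sa sb)/eqP; rewrite eq_le; apply/andP; split.
    apply: ge_ereal_sup => _ [N _ <-]; rewrite lee_fin -[leRHS](expect_cst x0 a b 1 N [::]).
    by apply: (expect_le Ox0 sa sb).
  apply/lee_addgt0Pr => c c0; have [N Nc] := one c c0.
  apply: (@le_trans _ _ ((st (fun=> 1) N)%:E + c%:E)%E).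
    by rewrite -EFinD lee_fin -lerBlDr.
  by rewrite leeD2r// ereal_sup_ubound//; exists N.
have pos_fin phi : (forall k, 0 <= phi k <= `|outcome f g x0 k|) ->
    exists2 p, ereal_sup (range (fun N => (st phi N)%:E)) = p%:E &
      (forall N, st phi N <= p) /\ forall c, 0 < c -> exists N, p - c < st phi N.
  move=> phiH; set S := (X in ereal_sup X).
  have S0 N : (0 <= st phi N) by apply: (expect_ge0 Ox0 sa sb) => // k _; have /andP[] := phiH k.
  have SC : (ereal_sup S <= C%:E)%E.
    apply: ge_ereal_sup => _ [N _ <-]; rewrite lee_fin; apply: le_trans (absC N).
    by apply: st_le => k; have /andP[] := phiH k.
  have S0' : (0%:E <= ereal_sup S)%E.
    by apply: (@le_trans _ _ (st phi 0)%:E); rewrite ?lee_fin// ereal_sup_ubound//; exists 0%N.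
  have fin : ereal_sup S \is a fin_num.
    by rewrite ge0_fin_numE// (le_lt_trans SC)// ltry.
  exists (fine (ereal_sup S)); first by rewrite fineK.
  split=> [N|c c0]; first by rewrite -lee_fin fineK// ereal_sup_ubound//; exists N.
  have [_ [N _ <-]] := ub_ereal_sup_adherent c0 fin.
  by rewrite -(fineK fin) -EFinB lte_fin => Nc; exists N.
have [p pE [p_ub p_adh]] : exists2 p, mean_pos Omega eps f g a b x0 = p%:E &
   (forall N, st (fun h => Num.max (outcome f g x0 h) 0) N <= p) /\
   forall c, 0 < c -> exists N, p - c < st (fun h => Num.max (outcome f g x0 h) 0) N.
  rewrite mean_posE//; apply: pos_fin => k; rewrite le_max lexx orbT/= ge_max normr_ge0.
  by rewrite ler_norm.
have [q qE [q_ub _]] : exists2 q, mean_neg Omega eps f g a b x0 = q%:E &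
   (forall N, st (fun h => Num.max (- outcome f g x0 h) 0) N <= q) /\
   forall c, 0 < c -> exists N, q - c < st (fun h => Num.max (- outcome f g x0 h) 0) N.
  rewrite mean_negE//; apply: pos_fin => k; rewrite le_max lexx orbT/= ge_max normr_ge0.
  by rewrite -normrN ler_norm.
have D : payoff_mean_defined Omega eps f g a b x0 by split => //; rewrite pE => -[].
rewrite /F_I /F_II asboolT// pE qE -EFinB !lee_fin.
suff : p - q <= B by [].
apply: (@le_of_small _ _ _ 2) => // c c0 _.
have [N1 N1p] := p_adh c c0; have [N0 N0H] := outB c c0.
pose N := maxn N0 N1.
have pN : p - c < st (fun h => Num.max (outcome f g x0 h) 0) N.
  apply: lt_le_trans N1p _; apply: (expect_mono Ox0 sa sb); rewrite ?leq_maxr//.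
  by move=> k _; rewrite le_max lexx orbT.
have : st (fun h => Num.max (outcome f g x0 h) 0) N <=
    st (outcome f g x0) N + st (fun h => Num.max (- outcome f g x0 h) 0) N.
  rewrite /st -expectD; apply: (expect_le Ox0 sa sb) => [//|k _ _|k _ _ _]; last by rewrite addr0.
  by case: (leP 0 (outcome f g x0 k)) => ?; case: (leP 0 (- outcome f g x0 k)) => ?; lra.
have := q_ub N; have := N0H N (leq_maxl _ _); rewrite -/(st _ _); lra.
Qed.

Section ValueBounds.
Variables (f g u : 'rV[R]_n -> R) (gam Kf G Mu : R).
Hypothesis gam_ge0 : 0 <= gam.
Hypothesis fK : forall x, Omega x -> `|f x| <= Kf.
Hypothesis gG : forall x, boundary Omega x -> `|g x| <= G.
Hypothesis uMu : bounded_by u Mu.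
Hypothesis u_super : forall x, Omega x -> subsol (fun y => - u y) (- (f x + gam)) x.
Hypothesis gu : forall x, boundary Omega x -> g x <= u x.

Let setup x0 : Omega x0 -> 0 <= Kf /\ exists V M, [/\ bounded_by u M, bounded_by V M,
  forall x, Omega x -> subsol (fun y => - V y) (- (Kf + 1)) x &
  forall x, boundary Omega x -> g x <= V x].
Proof.
move=> Ox0; split; first exact: le_trans (normr_ge0 _) (fK Ox0).
have [V [MV [VM Vsup GV]]] := barrier (Kf + 1) G.
exists V, (Num.max Mu MV); split => //.
- by move=> x Xx; rewrite le_max uMu.
- by move=> x Xx; rewrite le_max VM// orbT.
- move=> x xb; apply: (le_trans (ler_norm _)); apply: (le_trans (gG xb)).
  by apply: GV; case: (proj1 (boundaryP x) xb).
Qed.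

(** [K] has to serve against every strategy of Player I; it is chosen with
    [gam * eps ^+ 2 * K / 2 >= 2 * M]. *)
Lemma value_II_le x0 : 0 < gam -> Omega x0 -> (value_II Omega eps f g x0 <= (u x0)%:E)%E.
Proof.
move=> gam0 Ox0; have [Kf0 [V [M [uM VM Vsup gV]]]] := setup Ox0.
have [pu puP] := steepest_descent uM; have [pV pVP] := steepest_descent VM.
have e20 : 0 < gam * eps ^+ 2 / 2 by rewrite divr_gt0// mulr_gt0// exprn_gt0.
pose K := Num.bound (2 * `|M| / (gam * eps ^+ 2 / 2)).
have KM : 2 * M - gam * eps ^+ 2 * K%:R / 2 <= 0.
  have -> : gam * eps ^+ 2 * K%:R / 2 = K%:R * (gam * eps ^+ 2 / 2) by ring.
  rewrite subr_le0 -ler_pdivrMr//.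
  have T0 : 0 <= 2 * `|M| / (gam * eps ^+ 2 / 2) by rewrite divr_ge0 ?(ltW e20)// mulr_ge0.
  apply: le_trans (ltW (archi_boundP T0)).
  by rewrite ler_wpM2r ?invr_ge0 ?(ltW e20)// ler_wpM2l// ler_norm.
rewrite /value_II asboolT//; apply/lee_addgt0Pr => del del0; rewrite -EFinD.
have sb : strategy Omega eps (switching_strategy del pu pV K) by exact: (switching_strategyP del0 puP pVP).
apply: (@le_trans _ _ (ereal_sup [set F_II Omega eps f g a (switching_strategy del pu pV K) x0 |
    a in strategy Omega eps])).
  by apply: ereal_inf_lbound; exists (switching_strategy del pu pV K).
apply: ge_ereal_sup => _ [a sa <-].
have lim := outcome_mean_limit gam_ge0 del0 Kf0 fK uM VM u_super Vsup gu gV puP pVP Ox0 K sa.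
have [C Cabs] := outcome_abs_mean gam_ge0 del0 Kf0 fK gG uM VM u_super Vsup puP pVP Ox0 K sa.
apply: (proj2 (mean_le Ox0 sa sb Cabs _ _)) => c c0.
  have [N NH] := lim c c0; exists N; have [aN _] := NH N (leqnn N).
  have := expect_split x0 a (switching_strategy del pu pV K) (fun=> 1) (fun=> 1) N [::].
  by rewrite expect_cst; lra.
have [N0 NH] := lim c c0; exists N0 => N /NH[_ oN].
apply: le_trans oN _; rewrite lerD2r gerDl mulr_le0_ge0//.
by apply: (expect_ge0 Ox0 sa sb) => // k _; exact: ler0n.
Qed.

(** Here [K] may depend on [a]. If play against [slow] does not terminate almost surely, [F_I] is
    -oo; otherwise some [K] leaves at most probability [q] of still playing, and the switch costs at
    most [2 * M * q]. *)
Lemma value_I_le x0 : gam = 0 -> Omega x0 -> (value_I Omega eps f g x0 <= (u x0)%:E)%E.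
Proof.
move=> gam0 Ox0; have [Kf0 [V [M [uM VM Vsup gV]]]] := setup Ox0.
have [pu puP] := steepest_descent uM; have [pV pVP] := steepest_descent VM.
rewrite /value_I asboolT//; apply: ge_ereal_sup => _ [a sa <-].
apply/lee_addgt0Pr => t t0; rewrite -EFinD.
have del0 : 0 < t / 2 by lra.
pose slow := slow_strategy (t / 2) pu.
have sslow : strategy Omega eps slow by exact: (slow_strategyP del0 puP).
have [T|nT] := pselect (terminates_as Omega eps a slow x0); last first.
  apply: (@le_trans _ _ (F_I Omega eps f g a slow x0)).
    by apply: ereal_inf_lbound; exists slow.
  by rewrite /F_I asboolF ?leNye// => -[].
(* The switch may use half of [t]; the other half is the budget [del]. The summand 1 avoids a zero
   denominator. *)
pose q := t / 2 / (2 * `|M| + 1).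
have M1 : 0 < 2 * `|M| + 1 by rewrite ltr_wpDl// mulr_ge0.
have q0 : 0 < q by rewrite divr_gt0.
move: T; rewrite terminates_asE// => T.
have fin : ereal_sup (range (fun N => (expect x0 a slow (fun=> 1) (fun=> 0) N [::])%:E)) \is a fin_num.
  by rewrite T.
have [_ [K _ <-]] := ub_ereal_sup_adherent q0 fin.
rewrite T -EFinB lte_fin => Kq.
pose b := switching_strategy (t / 2) pu pV K.
have sb : strategy Omega eps b by exact: (switching_strategyP del0 puP pVP).
have aliveK : expect x0 a b (fun=> 0) (fun=> 1) K [::] <= q.
  (* The two strategies coincide during the first [K] rounds, so the choice of [K] made for [slow]
     is valid for [b]. *)
  have -> : expect x0 a b (fun=> 0) (fun=> 1) K [::] = expect x0 a slow (fun=> 0) (fun=> 1) K [::].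
    by apply: expect_agree => k; rewrite add0n /b /switching_strategy => ->.
  have := expect_split x0 a slow (fun=> 1) (fun=> 1) K [::].
  by rewrite expect_cst; lra.
apply: (@le_trans _ _ (F_I Omega eps f g a b x0)).
  by apply: ereal_inf_lbound; exists b.
have lim := outcome_mean_limit gam_ge0 del0 Kf0 fK uM VM u_super Vsup gu gV puP pVP Ox0 K sa.
have [C Cabs] := outcome_abs_mean gam_ge0 del0 Kf0 fK gG uM VM u_super Vsup puP pVP Ox0 K sa.
apply: (proj1 (mean_le Ox0 sa sb Cabs _ _)) => c c0.
  have [N NH] := lim c c0; exists N; have [aN _] := NH N (leqnn N).
  have := expect_split x0 a b (fun=> 1) (fun=> 1) N [::].
  by rewrite expect_cst -/b in aN *; lra.
have [N0 NH] := lim c c0; exists (maxn N0 K) => N; rewrite geq_max => /andP[/NH[_ oN] KN].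
apply: le_trans oN _; rewrite lerD2r -addrA lerD2l gam0 !mul0r subr0.
set s := expect _ _ _ _ _ _ _.
have s0 : 0 <= s by apply: (expect_ge0 Ox0 sa sb) => // k _; exact: ler0n.
have sq : s <= q.
  apply: le_trans aliveK; rewrite /s -(subnKC KN).
  exact: (expect_late Ox0 sa sb).
have : 2 * M * s <= t / 2.
  apply: (@le_trans _ _ ((2 * `|M| + 1) * s)).
    by rewrite ler_wpM2r//; have := ler_norm M; lra.
  by rewrite -ler_pdivlMl// mulrC.
by lra.
Qed.

End ValueBounds.

Lemma subsolutions_opp f g w Mw : bounded_by w Mw ->
  (forall x, Omega x -> subsol (fun y => - w y) (- f x) x) ->
  (forall x, boundary Omega x -> g x <= w x) ->
  subsolutions (fun y => - f y) (fun y => - g y) (fun y => - w y).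
Proof.
move=> wM wsuper gw; split => //; first by exists Mw; exact: bounded_byN.
by move=> x xb; rewrite lerN2 gw.
Qed.

(** From above, the envelope for [f + gam] is a supersolution with gap [gam], close to
    [perron f g x] for a suitable [gam]. From below, after exchanging the players, [- perron f g] is
    a supersolution for [- f] without gap, which suffices for the value of Player I. *)
Lemma value_II_perron (f g : 'rV[R]_n -> R) (K G : R) :
  (forall x, Omega x -> `|f x| <= K) ->
  (forall x, boundary Omega x -> `|g x| <= G) ->
  (forall x, Omega x -> forall c, 0 < c -> exists2 r, 0 < r &
    forall y, Omega y -> e x y < r -> `|f x - f y| < c) ->
  (forall x, boundary Omega x -> forall c, 0 < c -> exists2 r, 0 < r &
    forall y, boundary Omega y -> e x y < r -> `|g x - g y| < c) ->
  forall x, X x -> value_II Omega eps f g x = (perron f g x)%:E.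
Proof.
move=> fK gG f_cont g_cont x Xx.
have [Ox|xb] := closure_cases Xx; last first.
  have [_ nOx] := proj1 (boundaryP x) xb.
  by rewrite /value_II asboolF// (perron_boundary gG fK).
apply/eqP; rewrite eq_le; apply/andP; split.
  apply/lee_addgt0Pr => c c0; rewrite -EFinD.
  have [gam gam0 ux] := perron_approximation fK gG f_cont g_cont Xx c0.
  have fgK y : Omega y -> `|f y + gam| <= K + gam.
    by move=> Oy; apply: le_trans (ler_normD _ _) _; rewrite lerD ?fK// gtr0_norm.
  have [M /(_ _ fgK)[uM _]] := perron_bounded (K + gam) gG.
  apply: (@le_trans _ _ (perron (fun y => f y + gam) g x)%:E); last by rewrite lee_fin.
  apply: (value_II_le (ltW gam0) fK gG uM) => // y; first exact: (perron_supersolution gG fgK).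
  by move=> yb; rewrite (perron_boundary gG fgK).
have [M /(_ _ fK)[uM _]] := perron_bounded K gG.
have fKN y : Omega y -> `|- f y| <= K by rewrite normrN; exact: fK.
have gGN y : boundary Omega y -> `|- g y| <= G by rewrite normrN; exact: gG.
rewrite value_II_mirror -[leLHS]oppeK leeN2 -EFinN.
apply: (@value_I_le _ _ (fun y => - perron f g y) 0 K G M) => //.
- exact: bounded_byN.
- move=> y Oy; rewrite addr0 opprK oppfunK.
  by have [_ H _] := perron_subsolution gG fK; exact: H.
- by move=> y yb; rewrite (perron_boundary gG fK).
Qed.

Lemma bounded_onP (f : 'rV[R]_n -> R) (A : set 'rV[R]_n) :
  [bounded f x | x in A] -> exists K, forall x, A x -> `|f x| <= K.
Proof.
by move=> /pinfty_ex_gt0[K _ fK]; exists K.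
Qed.

Lemma boundary_compact : compact (boundary Omega).
Proof.
apply: bounded_closed_compact.
  have [M XM] := closure_bounded.
  exists M; split; first exact: num_real.
  by move=> N MN x [Xx _] /=; apply: le_trans (XM _ Xx) (ltW MN).
rewrite /boundary setDE; apply: closedI; first exact: closed_closure.
by apply: open_closedC; exact: open_interior.
Qed.

Lemma perron_value_functions (f g : 'rV[R]_n -> R) :
  {within Omega, continuous f} -> [bounded f x | x in Omega] ->
  {within boundary Omega, continuous g} ->
  exists u_low u_up : 'rV[R]_n -> R,
    [/\ [/\ {within X, continuous u_low},
            forall x, Omega x -> - inf_laplacian Omega eps u_low x = f x &
            forall x, boundary Omega x -> u_low x = g x],
        [/\ {within X, continuous u_up},
            forall x, Omega x -> - inf_laplacian Omega eps u_up x = f x &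
            forall x, boundary Omega x -> u_up x = g x],
        forall w : 'rV[R]_n -> R, [bounded w x | x in X] ->
          (forall x, Omega x -> - inf_laplacian Omega eps w x <= f x) ->
          (forall x, boundary Omega x -> w x <= g x) ->
          forall x, X x -> w x <= u_up x,
        forall w : 'rV[R]_n -> R, [bounded w x | x in X] ->
          (forall x, Omega x -> - inf_laplacian Omega eps w x >= f x) ->
          (forall x, boundary Omega x -> w x >= g x) ->
          forall x, X x -> w x >= u_low x &
        forall x, X x ->
          value_I Omega eps f g x = (u_low x)%:E /\
          value_II Omega eps f g x = (u_up x)%:E].
Proof.
move=> /within_continuous_euclP f_cont /bounded_onP[K fK] g_cont'.
have [G gG] : exists G, forall x, boundary Omega x -> `|g x| <= G.
  apply: bounded_onP.
  have [N0 [N0r gN]] := compact_bounded (continuous_compact g_cont' boundary_compact).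
  by exists N0; split => // N NN x xb; apply: (gN N NN); exists x.
move: g_cont' => /within_continuous_euclP g_cont.
pose Nf y := - f y; pose Ng y := - g y.
have NfK x : Omega x -> `|Nf x| <= K by rewrite normrN; exact: fK.
have NgG x : boundary Omega x -> `|Ng x| <= G by rewrite normrN; exact: gG.
have Nf_cont x : Omega x -> forall c, 0 < c -> exists2 r, 0 < r &
    forall y, Omega y -> e x y < r -> `|Nf x - Nf y| < c.
  move=> Ox c /(f_cont x Ox)[r r0 rH]; exists r => // y Oy xy.
  by rewrite /Nf /Ng -opprD normrN rH.
have Ng_cont x : boundary Omega x -> forall c, 0 < c -> exists2 r, 0 < r &
    forall y, boundary Omega y -> e x y < r -> `|Ng x - Ng y| < c.
  move=> xb c /(g_cont x xb)[r r0 rH]; exists r => // y yb xy.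
  by rewrite /Nf /Ng -opprD normrN rH.
exists (fun x => - perron Nf Ng x), (perron f g); split.
- split.
  + apply/within_continuous_euclP => x Xx c c0.
    have [r r0 rH] := perron_continuous NfK NgG Nf_cont Ng_cont Xx c0.
    by exists r => // y Xy xy; rewrite -opprD normrN rH.
  + move=> x Ox; apply/eqP; rewrite eq_le; apply/andP; split.
      apply/inf_laplacian_le; rewrite -[f x]opprK; exact: (perron_supersolution NgG NfK).
    apply/inf_laplacian_ge; rewrite oppfunK.
    by have [_ H _] := perron_subsolution NgG NfK; exact: H.
  + by move=> x xb; rewrite (perron_boundary NgG NfK xb) opprK.
- split.
  + apply/within_continuous_euclP => x Xx c c0.
    exact: (perron_continuous fK gG f_cont g_cont Xx c0).
  + move=> x Ox; apply/eqP; rewrite eq_le; apply/andP; split.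
      apply/inf_laplacian_le; have [_ H _] := perron_subsolution gG fK; exact: H.
    apply/inf_laplacian_ge; exact: (perron_supersolution gG fK).
  + by move=> x xb; rewrite (perron_boundary gG fK xb).
- move=> w /bounded_onP[M wM] wsub wg x Xx; apply: (perron_ge gG fK) => //.
  by split => //; [exists M|move=> y Oy; apply/inf_laplacian_le/wsub].
- move=> w /bounded_onP[M wM] wsup wg x Xx; rewrite lerNl.
  apply: (perron_ge NgG NfK (w := fun y => - w y)) => //; apply: (subsolutions_opp wM) => // y Oy.
  exact/inf_laplacian_ge/wsup.
- move=> x Xx; split; last exact: (value_II_perron fK gG f_cont g_cont).
  have := value_II_perron NfK NgG Nf_cont Ng_cont Xx.
  rewrite value_II_mirror (oppfunK f) (oppfunK g) => vI.
  by rewrite -[LHS]oppeK vI EFinN.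
Qed.

End PathMetric.

Theorem theorem2p9 (R : realType) (n : nat) (n_gt0 : (0 < n)%N)
  (Omega : set 'rV[R]_n)
  (Omega_bounded : bounded_set Omega)
  (Omega_connected : connected Omega)
  (Omega_open : open Omega)
  (Omega_diam : (path_diam Omega < +oo)%E)
  (f g : 'rV[R]_n -> R)
  (f_continuous : {within Omega, continuous f})
  (f_bounded : [bounded f x | x in Omega])
  (g_continuous : {within boundary Omega, continuous g}) :
  forall eps : R, 0 < eps ->
  exists u_low u_up : 'rV[R]_n -> R,
    [/\ [/\ {within closure Omega, continuous u_low},
            forall x, Omega x -> - inf_laplacian Omega eps u_low x = f x &
            forall x, boundary Omega x -> u_low x = g x],
        [/\ {within closure Omega, continuous u_up},
            forall x, Omega x -> - inf_laplacian Omega eps u_up x = f x &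
            forall x, boundary Omega x -> u_up x = g x],
        forall w : 'rV[R]_n -> R,
          [bounded w x | x in closure Omega] ->
          (forall x, Omega x -> - inf_laplacian Omega eps w x <= f x) ->
          (forall x, boundary Omega x -> w x <= g x) ->
          forall x, closure Omega x -> w x <= u_up x,
        forall w : 'rV[R]_n -> R,
          [bounded w x | x in closure Omega] ->
          (forall x, Omega x -> - inf_laplacian Omega eps w x >= f x) ->
          (forall x, boundary Omega x -> w x >= g x) ->
          forall x, closure Omega x -> w x >= u_low x &
        forall x, closure Omega x ->
          value_I Omega eps f g x = (u_low x)%:E /\
          value_II Omega eps f g x = (u_up x)%:E].
Proof.
by move=> eps eps_gt0; apply: perron_value_functions.
Qed.
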